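(* Let $a_1,b_1,c_1,d_1,a_2,b_2,c_2,d_2\in(-1,1)$ and $\gamma,\delta\ge0$, and let $j,k,m,n$ be nonnegative integers. For $x=\cos\theta$ with $\theta\in[0,\pi]$ and $y\in[-1,1]$ put $$p_{j,k}^{(\gamma,\delta)}(x,y)=\frac{p_j(x;a_1,b_1,c_1,d_1q^{\gamma k+\delta}|q)\,p_k(y;a_2,b_2,c_2,d_2|q)}{(d_1q^{\gamma k+\delta}e^{i\theta};q)_\infty},$$ $$W(x,y)=\frac{h(x,1)h(x,\sqrt q)h(x,-1)h(x,-\sqrt q)}{h(x,a_1)h(x,b_1)h(x,c_1)\sqrt{1-x^2}}\cdot\frac{h(y,1)h(y,\sqrt q)h(y,-1)h(y,-\sqrt q)}{h(y,a_2)h(y,b_2)h(y,c_2)h(y,d_2)\sqrt{1-y^2}}.$$ Then $$\int_{-1}^1\int_{-1}^1p_{j,k}^{(\gamma,\delta)}(x,y)\,\overline{p_{m,n}^{(\gamma,\delta)}(x,y)}\,W(x,y)\,dx\,dy$$ $$=\frac{4\pi^2\,\delta_{j,m}\delta_{k,n}\,(a_1b_1c_1d_1q^{2m+\gamma n+\delta};q)_\infty\,(a_1b_1c_1d_1q^{m+\gamma n+\delta-1};q)_m}{(q^{m+1},a_1b_1q^m,a_1c_1q^m,b_1c_1q^m,a_1d_1q^{m+\gamma n+\delta},b_1d_1q^{m+\gamma n+\delta},c_1d_1q^{m+\gamma n+\delta};q)_\infty}\cdot\frac{(a_2b_2c_2d_2q^{2n};q)_\infty\,(a_2b_2c_2d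_2q^{n-1};q)_n}{(q^{n+1},a_2b_2q^n,a_2c_2q^n,a_2d_2q^n,b_2c_2q^n,b_2d_2q^n,c_2d_2q^n;q)_\infty}.$$
   Context: $0<q<1$; $(a;q)_n=\prod_{k=0}^{n-1}(1-aq^k)$ (also for $n=\infty$), $(a_1,\dots,a_r;q)_n=\prod_i(a_i;q)_n$. $h(x,a)=\prod_{k=0}^\infty(1-2axq^k+a^2q^{2k})$. The Askey–Wilson polynomials, for $a,b,c,d\in(-1,1)$ and $x=\cos\theta$, are $$p_n(\cos\theta;a,b,c,d|q)=\frac{(ab,ac,ad;q)_n}{a^n}\sum_{k=0}^n\frac{(q^{-n},abcdq^{n-1},ae^{i\theta},ae^{-i\theta};q)_k}{(ab,ac,ad,q;q)_k}\,q^k,$$ extended by continuity to $a=0$. *)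

(* Defs.v *)
From mathcomp Require Import all_boot all_order all_algebra.
From mathcomp Require Import all_classical all_reals all_analysis.
From mathcomp Require Import complex.
Set Implicit Arguments.
Unset Strict Implicit.
Unset Printing Implicit Defensive.
Import Order.TTheory GRing.Theory Num.Theory.
Import numFieldNormedType.Exports.
Local Open Scope classical_set_scope.
Local Open Scope complex_scope.
Local Open Scope ring_scope.

(* The q-shifted factorials are defined over an arbitrary numFieldType because
   they are used both over R and over R[i]. *)
Definition qpoch (K : numFieldType) (a q : K) (n : nat) : K :=
  \prod_(k < n) (1 - a * q ^+ k).

Definition qpochs (K : numFieldType) (s : seq K) (q : K) (n : nat) : K :=
  \prod_(a <- s) qpoch a q n.

Definition qpoch_inf (K : numFieldType) (a q : K) : K :=
  lim (qpoch a q n @[n --> \oo]).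

Definition qpochs_inf (K : numFieldType) (s : seq K) (q : K) : K :=
  \prod_(a <- s) qpoch_inf a q.

Definition hfun (R : realType) (q x a : R) : R :=
  lim (\prod_(k < n) (1 - 2 * a * x * q ^+ k + a ^+ 2 * q ^+ (2 * k))
         @[n --> \oo]).

Definition expi (R : realType) (t : R) : R[i] := cos t +i* sin t.

(* The defining formula of p_n(cos t; a, b, c, d | q), meaningful for a != 0. *)
Definition aw_formula (R : realType) (q : R) (n : nat) (t a b c d : R) : R[i] :=
  (qpochs [:: a * b; a * c; a * d] q n / a ^+ n)%:C *
  \sum_(k < n.+1)
    qpochs [:: (q ^- n)%:C; (a * b * c * d * q ^ (n%:Z - 1))%:C;
               a%:C * expi t; a%:C * expi (- t)] q%:C k
    / (qpochs [:: a * b; a * c; a * d; q] q k)%:C * (q ^+ k)%:C.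

Definition limC (K : numFieldType) (T : Type) (F : set_system T) (f : T -> K)
  : K := lim (f x @[x --> F]).

(* At a = 0 the polynomial is the limit of the formula as a tends to 0. *)
Definition askey_wilson (R : realType) (q : R) (n : nat) (x a b c d : R)
  : R[i] :=
  if a == 0 then limC 0^' (fun a' : R => aw_formula q n (acos x) a' b c d)
  else aw_formula q n (acos x) a b c d.

Definition biv_aw (R : realType) (q a1 b1 c1 d1 a2 b2 c2 d2 gamma delta : R)
    (j k : nat) (x y : R) : R[i] :=
  let d := d1 * q `^ (gamma * k%:R + delta) in
  askey_wilson q j x a1 b1 c1 d * askey_wilson q k y a2 b2 c2 d2
  / qpoch_inf (d%:C * expi (acos x)) q%:C.

Definition hnum (R : realType) (q x : R) : R :=
  hfun q x 1 * hfun q x (Num.sqrt q) * hfun q x (- 1)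
  * hfun q x (- Num.sqrt q).

Definition biv_weight (R : realType) (q a1 b1 c1 a2 b2 c2 d2 x y : R) : R :=
  hnum q x
  / (hfun q x a1 * hfun q x b1 * hfun q x c1 * Num.sqrt (1 - x ^+ 2))
  * (hnum q y
     / (hfun q y a2 * hfun q y b2 * hfun q y c2 * hfun q y d2
        * Num.sqrt (1 - y ^+ 2))).

(* Lebesgue integration of complex-valued functions, componentwise. *)
Definition integrableC (R : realType) (d : measure_display)
    (T : measurableType d) (mu : {measure set T -> \bar R}) (D : set T)
    (f : T -> R[i]) : Prop :=
  mu.-integrable D (EFin \o (fun z => complex.Re (f z))) /\
  mu.-integrable D (EFin \o (fun z => complex.Im (f z))).

Definition integralC (R : realType) (d : measure_display)
    (T : measurableType d) (mu : {measure set T -> \bar R}) (D : set T)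
    (f : T -> R[i]) : R[i] :=
  Rintegral mu D (fun z => complex.Re (f z))
  +i* Rintegral mu D (fun z => complex.Im (f z)).

Definition lebesgue2 (R : realType) :=
  (@lebesgue_measure R \x @lebesgue_measure R)%E.

Definition square (R : realType) : set (R * R) := `[-1, 1] `*` `[-1, 1].

(* Main.v *)
Require Import Defs.
From mathcomp Require Import all_boot all_order all_algebra.
From mathcomp Require Import all_classical all_reals all_analysis.
From mathcomp Require Import measurable_realfun complex.
From mathcomp Require Import ring lra zify.
Import Order.TTheory GRing.Theory Num.Theory.
Import numFieldNormedType.Exports.
Local Open Scope classical_set_scope.
Local Open Scope complex_scope.
Local Open Scope ring_scope.
Import ComplexField.Normc.
Set Implicit Arguments.
Unset Strict Implicit.
Unset Printing Implicit Defensive.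

(** The integrand separates. Its y-part is the product of two Askey-Wilson
    polynomials with the parameters [a2, b2, c2, d2] and their weight; it does
    not involve x, so the double integral vanishes for [k <> n] by orthogonality
    in y. For [k = n] the two denominators of the x-part are conjugate and
    multiply to [h(x, d)] with [d = d1 q^(gamma n + delta)], so that the x-part is
    an Askey-Wilson integral as well. Everything thus rests on the
    one-variable orthogonality [aw_orthogonality], transported to x = cos t
    by [aw_int_x].

    Total mass [aw_integral]. On the unit circle the weight is
    [(z^2, z^-2; q)_oo / prod_u (u z, u / z; q)_oo] over the four parameters u.
    With [s = sqrt q], the function
    [F z = (z - 1/z) (q z^2, q z^-2; q)_oo / prod_u (u s z, u s / z; q)_oo]
    changes sign under [z -> 1/z] and has no pole between the circles of radii
    s and 1/s, so its mean over the first circle equals the mean over the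
    second, hence its own opposite, hence 0. But [F (s z)] for [|z| = 1] is the
    weight at z times an elementary factor whose real part is a polynomial of
    degree at most one in cos t. This gives the first moment [first_moment], which is
    equivalent to the recursion
    [(1 - abcd) I(aq, b, c, d) = (1 - ab)(1 - ac)(1 - ad) I(a, b, c, d)] for the total
    mass I. Iterating it lets each parameter tend to 0, and the remaining
    constant I(0, 0, 0, 0) is read off from the parameters q, -q, s, -s, for
    which the weight is [4 sin^2 t].

    Orthogonality. Multiplying the weight by [(b z, b / z; q)_m] replaces the
    parameter b by [b q^m], so the integral of the n-th polynomial against this
    basis element is a terminating sum of total masses. That sum is an n-th
    q-difference ([qdiff]) of a function of [q^k], which for [m < n] is a polynomial
    of degree less than n and is annihilated, and for [m = n] has one simple pole
    and is evaluated by [qdiff_div]. The argument needs [a <> 0], which is in the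
    definition of the polynomials, and [b <> 0], without which the products do
    not span. The case [b = 0] follows by continuity. For [a = 0] the same
    q-differences show that [a^n] times the n-th polynomial is a polynomial in a
    divisible by [a^n] ([aw_series_coef]), so that the limit defining the
    polynomial exists and orthogonality passes to it. *)

(** * Arithmetic of real numbers inside the complex numbers *)

Section complex_arithmetic.
Variable R : realType.
Implicit Types (x y : R) (z w : R[i]).

Lemma real_complexM x y : (x * y)%:C = x%:C * y%:C :> R[i].
Proof. exact: (rmorphM (real_complex R)). Qed.

Lemma real_complexN x : (- x)%:C = - x%:C :> R[i].
Proof. exact: (rmorphN (real_complex R)). Qed.

Lemma real_complexV x : (x^-1)%:C = x%:C^-1 :> R[i].
Proof. exact: (fmorphV (real_complex R)). Qed.

Lemma real_complexX x k : (x ^+ k)%:C = x%:C ^+ k :> R[i].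
Proof. exact: (rmorphXn (real_complex R)). Qed.

Lemma real_complex_sum m (f : 'I_m -> R) :
  (\sum_(i < m) f i)%:C = \sum_(i < m) (f i)%:C :> R[i].
Proof. exact: (rmorph_sum (real_complex R)). Qed.

Lemma real_complex_neq0 x : x != 0 -> x%:C != 0 :> R[i].
Proof. by rewrite (inj_eq (@complexI R)). Qed.

Lemma conjcM z w : conjc (z * w) = conjc z * conjc w.
Proof. exact: (rmorphM (@conjc R)). Qed.

End complex_arithmetic.

(** * Componentwise limits of complex-valued functions *)

Lemma cvg_complex (R : realType) (T : Type) (F : set_system T) (FF : Filter F)
    (f : T -> R[i]) (x y : R) :
  complex.Re (f t) @[t --> F] --> x -> complex.Im (f t) @[t --> F] --> y ->
  (f : T -> (R[i] : numFieldType)) @ F --> (x +i* y : (R[i] : numFieldType)).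
Proof.
move=> fx fy; apply/cvgrPdist_lt => e; case: e => e e' /[dup] egt0.
rewrite ltcE /= => /andP[/eqP e'0 e0]; rewrite {}e'0 in egt0 *.
have e20 : 0 < e / 2 by rewrite divr_gt0.
near=> t.
have h1 : `|x - complex.Re (f t)| < e / 2.
  by near: t; move/cvgrPdist_lt : fx; apply.
have h2 : `|y - complex.Im (f t)| < e / 2.
  by near: t; move/cvgrPdist_lt : fy; apply.
rewrite normc_def ltcR -[ltRHS]gtr0_norm // -sqrtr_sqr ltr_sqrt ?exprn_gt0 //.
move: h1 h2; case: (f t) => a b /=.
rewrite !ltr_norml => /andP[? ?] /andP[? ?]; nra.
Unshelve. all: by end_near. Qed.

(** The topology of the complex numbers as a numeric field is only ever met
    through this lemma; all other limits are taken on the two components. *)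
Lemma lim_complex (R : realType) (T : Type) (F : set_system T)
    (FF : ProperFilter F) (f : T -> R[i]) (l : R[i]) :
  complex.Re (f t) @[t --> F] --> complex.Re l ->
  complex.Im (f t) @[t --> F] --> complex.Im l ->
  @limC (R[i] : numFieldType) T F f = l.
Proof.
move=> fx fy; apply: cvg_lim; first exact: norm_hausdorff.
rewrite (_ : l = complex.Re l +i* complex.Im l); last by case: (l).
exact: cvg_complex.
Qed.

Definition cvgC (R : realType) (T : Type) (F : set_system T) (f : T -> R[i])
    (l : R[i]) :=
  complex.Re (f t) @[t --> F] --> complex.Re l /\
  complex.Im (f t) @[t --> F] --> complex.Im l.

Section cvgC.
Variables (R : realType) (T : Type) (F : set_system T) (FF : Filter F).
Implicit Types (f g : T -> R[i]) (l m : R[i]).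

Lemma cvgC_cst l : cvgC F (fun=> l) l.
Proof. by split; apply: cvg_cst. Qed.

Lemma cvgC_real (f : T -> R) (x : R) :
  f @ F --> x -> cvgC F (fun t => (f t)%:C) x%:C.
Proof. by split => //=; apply: cvg_cst. Qed.

Lemma cvgCD f g l m : cvgC F f l -> cvgC F g m ->
  cvgC F (fun t => f t + g t) (l + m).
Proof.
move=> [f1 f2] [g1 g2]; split; rewrite raddfD /=.
  by under eq_fun do rewrite raddfD; apply: cvgD.
by under eq_fun do rewrite raddfD; apply: cvgD.
Qed.

Lemma cvgCM f g l m : cvgC F f l -> cvgC F g m ->
  cvgC F (fun t => f t * g t) (l * m).
Proof.
have ReM (z w : R[i]) : complex.Re (z * w) =
  complex.Re z * complex.Re w - complex.Im z * complex.Im w.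
  by case: z; case: w.
have ImM (z w : R[i]) : complex.Im (z * w) =
  complex.Re z * complex.Im w + complex.Im z * complex.Re w.
  by case: z; case: w.
move=> [f1 f2] [g1 g2]; split; rewrite ?ReM ?ImM.
  by under eq_fun do rewrite ReM; apply: cvgB; apply: cvgM.
by under eq_fun do rewrite ImM; apply: cvgD; apply: cvgM.
Qed.

Lemma cvgCN f l : cvgC F f l -> cvgC F (fun t => - f t) (- l).
Proof.
move=> fl; rewrite -mulN1r; under eq_fun do rewrite -mulN1r.
by apply: cvgCM => //; apply: cvgC_cst.
Qed.

Lemma cvgCB f g l m : cvgC F f l -> cvgC F g m ->
  cvgC F (fun t => f t - g t) (l - m).
Proof. by move=> fl gm; apply: cvgCD => //; apply: cvgCN. Qed.

Lemma cvgCV f l : l != 0 -> cvgC F f l -> cvgC F (fun t => (f t)^-1) l^-1.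
Proof.
have ReV (z : R[i]) : complex.Re z^-1 =
  complex.Re z / (complex.Re z ^+ 2 + complex.Im z ^+ 2) by case: z.
have ImV (z : R[i]) : complex.Im z^-1 =
  - (complex.Im z / (complex.Re z ^+ 2 + complex.Im z ^+ 2)) by case: z.
move=> l0 [f1 f2].
have n0 : complex.Re l ^+ 2 + complex.Im l ^+ 2 != 0.
  apply: contra l0; case: l {f1 f2} => x y /=.
  by rewrite paddr_eq0 ?sqr_ge0 // !sqrf_eq0 eq_complex.
have fn : (complex.Re (f t) ^+ 2 + complex.Im (f t) ^+ 2)^-1 @[t --> F] -->
    (complex.Re l ^+ 2 + complex.Im l ^+ 2)^-1.
  by apply: cvgV => //; exact: (cvgD (cvgM f1 f1) (cvgM f2 f2)).
split; rewrite ?ReV ?ImV.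
  by under eq_fun do rewrite ReV; apply: cvgM.
by under eq_fun do rewrite ImV; apply: cvgN; apply: cvgM.
Qed.

Lemma cvgC_conj f l : cvgC F f l -> cvgC F (fun t => conjc (f t)) (conjc l).
Proof.
have RJ (z : R[i]) : complex.Re (conjc z) = complex.Re z by case: z.
have IJ (z : R[i]) : complex.Im (conjc z) = - complex.Im z by case: z.
move=> [f1 f2]; split; rewrite ?RJ ?IJ; first by under eq_fun do rewrite RJ.
by under eq_fun do rewrite IJ; apply: cvgN.
Qed.

Lemma cvgC_prod (I : Type) (r : seq I) (P : pred I) (f : I -> T -> R[i])
    (l : I -> R[i]) : (forall i, P i -> cvgC F (f i) (l i)) ->
  cvgC F (fun t => \prod_(i <- r | P i) f i t) (\prod_(i <- r | P i) l i).
Proof.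
move=> fl; elim: r => [|i r ih].
  by rewrite big_nil; under eq_fun do rewrite big_nil; apply: cvgC_cst.
rewrite big_cons; under eq_fun do rewrite big_cons.
move: (@fl i); case: (P i) => [/(_ isT) fli|_]; last exact: ih.
by apply: cvgCM.
Qed.

Lemma cvgCX n f l : cvgC F f l -> cvgC F (fun t => f t ^+ n) (l ^+ n).
Proof.
move=> fl; elim: n => [|n ih]; first exact: cvgC_cst.
by under eq_fun do rewrite exprS; rewrite exprS; apply: cvgCM.
Qed.

Lemma cvgC_exprz (m : int) f l : l != 0 -> cvgC F f l ->
  cvgC F (fun t => f t ^ m) (l ^ m).
Proof.
move=> l0 fl; case: m => n; rewrite /exprz; first exact: cvgCX.
by apply: cvgCV; [rewrite expf_neq0|exact: cvgCX].
Qed.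

End cvgC.

(** * Infinite products with geometrically small factors *)

(** Adding and subtracting the geometric tail turns the sequence into a
    nonincreasing and a nondecreasing one with the same limit. *)
Lemma cvg_of_geometric_steps (R : realType) (q C : R) (x : nat -> R) :
  0 < q < 1 -> (forall n, `|x n.+1 - x n| <= C * q ^+ n) ->
  exists l, x @ \oo --> l /\ forall n, `|l - x n| <= C / (1 - q) * q ^+ n.
Proof.
move=> /andP[q0 q1] xC; set D := C / (1 - q).
have C0 : 0 <= C by have := le_trans (normr_ge0 _) (xC 0); rewrite expr0 mulr1.
have D0 : 0 <= D by rewrite divr_ge0 // subr_ge0 ltW.
have DC : D * (1 - q) = C by rewrite /D -mulrA mulVf ?mulr1 // lt0r_neq0 // subr_gt0.
have step n : D * q ^+ n - D * q ^+ n.+1 = C * q ^+ n by rewrite -DC exprS; ring.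
have qn n : 0 <= q ^+ n by rewrite exprn_ge0 // ltW.
pose a n := x n - D * q ^+ n; pose b n := x n + D * q ^+ n.
have a_nd : nondecreasing_seq a.
  apply/nondecreasing_seqP => n; rewrite /a.
  by have := xC n; rewrite ler_norml => /andP[]; have := step n; lra.
have b_ni : nonincreasing_seq b.
  apply/nonincreasing_seqP => n; rewrite /b.
  by have := xC n; rewrite ler_norml => /andP[]; have := step n; lra.
have Dq0 : (fun n => D * q ^+ n) @ \oo --> (0 : R).
  by apply: (@cvg_geometric R D q); rewrite ger0_norm // ltW.
have ab n m : a n <= b m.
  apply: (@le_trans _ _ (a (maxn n m))); first by apply: a_nd; rewrite leq_maxl.
  apply: (@le_trans _ _ (b (maxn n m))); last by apply: b_ni; rewrite leq_maxr.
  by rewrite /a /b; have := mulr_ge0 D0 (qn (maxn n m)); lra.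
have acv : cvgn a by apply: nondecreasing_is_cvgn => //; exists (b 0) => _ [n _ <-].
exists (limn a); split.
  rewrite -[limn a]addr0 (_ : x = fun n => a n + D * q ^+ n).
    exact: cvgD.
  by apply/funext => n; rewrite /a subrK.
move=> n; rewrite ler_norml; apply/andP; split.
  by have := nondecreasing_cvgn_le a_nd acv n; rewrite /a; lra.
have : limn a <= b n by apply: limr_le => //; near=> m; apply: ab.
rewrite /b; lra.
Unshelve. all: by end_near. Qed.

(** Locally uniform limits of continuous functions are continuous, for the
    geometric rate at which all the products below converge. *)
Lemma geometric_limit_cont (R : realType) (q C : R) (g : R -> R)
    (g_ : nat -> R -> R) (x : R) : 0 < q < 1 -> 0 <= C ->
  (forall N, continuous (g_ N)) ->
  (\forall y \near x, forall N, `|g y - g_ N y| <= C * q ^+ N) ->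
  {for x, continuous g}.
Proof.
move=> /andP[q0 q1] C0 cg gC; apply/cvgrPdist_lt => e e0.
have cv0 : (fun N => C * q ^+ N) @ \oo --> (0 : R).
  by apply: (@cvg_geometric R _ q); rewrite ger0_norm // ltW.
have e3 : 0 < e / 3 by rewrite divr_gt0.
have [N _ /(_ N (leqnn N)) NC] : \forall N \near \oo, `|0 - C * q ^+ N| < e / 3.
  by move/cvgrPdist_lt : cv0; apply.
have t0 : 0 <= C * q ^+ N by rewrite mulr_ge0 // exprn_ge0 // ltW.
rewrite /= sub0r normrN ger0_norm // in NC.
have ax := nbhs_singleton gC N.
near=> y.
have ay : `|g y - g_ N y| <= C * q ^+ N by near: y; apply: filterS gC.
have xy : `|g_ N x - g_ N y| < e / 3.
  by near: y; have /cvgrPdist_lt := cg N x; apply.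
have := le_lt_trans ax NC; have := le_lt_trans ay NC; move: xy.
by rewrite !ltr_norml => /andP[? ?] /andP[? ?] /andP[? ?]; apply/andP; split; lra.
Unshelve. all: by end_near. Qed.

Section products.
Variable R : realType.
Implicit Types (z w : R[i]).

Lemma normcRe z : `|complex.Re z| <= normc z.
Proof.
case: z => x y /=; rewrite -sqrtr_sqr ler_sqrt ?lerDl ?sqr_ge0 //.
by rewrite addr_ge0 ?sqr_ge0.
Qed.

Lemma normcIm z : `|complex.Im z| <= normc z.
Proof.
case: z => x y /=; rewrite -sqrtr_sqr ler_sqrt ?lerDr ?sqr_ge0 //.
by rewrite addr_ge0 ?sqr_ge0.
Qed.

Lemma normc_leD z : normc z <= `|complex.Re z| + `|complex.Im z|.
Proof.
case: z => x y /=; rewrite -[leRHS]ger0_norm ?addr_ge0 // -sqrtr_sqr.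
rewrite ler_sqrt ?sqr_ge0 // sqrrD !real_normK ?num_real //.
by rewrite lerD2r lerDl mulrn_wge0 // mulr_ge0.
Qed.

Lemma normc_ge0 z : 0 <= normc z.
Proof. by case: z => x y; rewrite sqrtr_ge0. Qed.

Lemma normcR (x : R) : normc x%:C = `|x|.
Proof. by rewrite /= expr0n addr0 sqrtr_sqr. Qed.

Lemma normc_prod (I : Type) (r : seq I) (P : pred I) (f : I -> R[i]) :
  normc (\prod_(i <- r | P i) f i) = \prod_(i <- r | P i) normc (f i).
Proof. by apply: (big_morph (@normc R)); [exact: normcM|exact: normc1]. Qed.

Variables (q : R) (hq : 0 < q < 1).
Let q0 : 0 < q. Proof. by case/andP: hq. Qed.
Let q1 : q < 1. Proof. by case/andP: hq. Qed.

Lemma sum_geometric_le (M : R) n : 0 <= M ->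
  \sum_(k < n) M * q ^+ k <= M / (1 - q).
Proof.
move=> M0; rewrite -mulr_sumr ler_wpM2l //.
have := subrX1 q n; rewrite -(opprB 1) => e.
have q10 : 0 < 1 - q by rewrite subr_gt0.
rewrite -(ler_pM2l q10) mulfV ?lt0r_neq0 //.
by have := exprn_ge0 n (ltW q0); lra.
Qed.

(** The bound [expR (M / (1 - q))] comes from [1 + x <= expR x] factorwise. *)
Definition prod_bound (M : R) := expR (M / (1 - q)).

Lemma prod_bound_gt0 M : 0 < prod_bound M. Proof. exact: expR_gt0. Qed.

Lemma prod1D_le (M : R) (u : nat -> R) n : 0 <= M ->
  (forall k, 0 <= u k <= 1 + M * q ^+ k) -> \prod_(k < n) u k <= prod_bound M.
Proof.
move=> M0 uM; apply: (@le_trans _ _ (\prod_(k < n) expR (M * q ^+ k))).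
  apply: ler_prod => k _; case/andP: (uM k) => -> /= h.
  exact: le_trans h (expR_ge1Dx _).
rewrite -(big_morph expR (@expRD _) (expR0 R)) ler_expR.
exact: sum_geometric_le.
Qed.

Lemma normc_prod1D_le (M : R) (u : nat -> R[i]) n :
  (forall k, normc (u k) <= M * q ^+ k) ->
  normc (\prod_(k < n) (1 + u k)) <= prod_bound M.
Proof.
move=> uM; have M0 : 0 <= M.
  by have := le_trans (normc_ge0 _) (uM 0); rewrite expr0 mulr1.
rewrite normc_prod; apply: (prod1D_le (u := fun k => normc (1 + u k))) => // k.
rewrite normc_ge0 /= (le_trans (le_normcD _ _)) // lerD //.
by rewrite normc1.
Qed.

Lemma prod1D_cvg (M : R) (u : nat -> R[i]) :
  (forall k, normc (u k) <= M * q ^+ k) ->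
  exists l, cvgC \oo (fun n => \prod_(k < n) (1 + u k)) l /\
    forall n, normc (l - \prod_(k < n) (1 + u k)) <=
      2 * (prod_bound M * M / (1 - q)) * q ^+ n.
Proof.
move=> uM; set P := fun n => \prod_(k < n) (1 + u k).
have step n : normc (P n.+1 - P n) <= prod_bound M * M * q ^+ n.
  rewrite /P big_ord_recr /= mulrDr mulr1 addrAC subrr add0r normcM -mulrA.
  by apply: ler_pM => //; rewrite ?normc_ge0 //; exact: normc_prod1D_le.
have [|l1 [l1c l1b]] := cvg_of_geometric_steps (x := fun n => complex.Re (P n)) hq (C := prod_bound M * M).
  move=> n; apply: le_trans (step n); rewrite -raddfB; exact: normcRe.
have [|l2 [l2c l2b]] := cvg_of_geometric_steps (x := fun n => complex.Im (P n)) hq (C := prod_bound M * M).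
  move=> n; apply: le_trans (step n); rewrite -raddfB; exact: normcIm.
exists (l1 +i* l2); split => [//|n]; apply: le_trans (normc_leD _) _.
rewrite -mulrA (mulr_natl _ 2) mulr2n !raddfB; exact: (lerD (l1b n) (l2b n)).
Qed.

End products.

(** * Integrals of continuous functions over [0, pi] *)

Section int0pi.
Variable R : realType.
Implicit Types f g : R -> R.

Definition int0pi f := \int[@lebesgue_measure R]_(t in `[0, pi]) f t.

Lemma integrable0pi f : continuous f ->
  (@lebesgue_measure R).-integrable `[0, pi] (EFin \o f).
Proof.
move=> cf; apply: continuous_compact_integrable; first exact: segment_compact.
exact: continuous_subspaceT.
Qed.

Lemma int0pi_ext f g : (forall t, f t = g t) -> int0pi f = int0pi g.
Proof. by move=> fg; congr int0pi; apply/funext. Qed.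

Lemma int0piD f g : continuous f -> continuous g ->
  int0pi (fun t => f t + g t) = int0pi f + int0pi g.
Proof. by move=> cf cg; rewrite /int0pi RintegralD //; exact: integrable0pi. Qed.

Lemma int0piB f g : continuous f -> continuous g ->
  int0pi (fun t => f t - g t) = int0pi f - int0pi g.
Proof. by move=> cf cg; rewrite /int0pi RintegralB //; exact: integrable0pi. Qed.

Lemma int0piZ (r : R) f : continuous f ->
  int0pi (fun t => r * f t) = r * int0pi f.
Proof. by move=> cf; rewrite /int0pi RintegralZl //; exact: integrable0pi. Qed.

Lemma int0pi_cst (r : R) : int0pi (fun=> r) = r * pi.
Proof. rewrite /int0pi Rintegral_cst //; congr (_ * _).
have := @lebesgue_measure_itv R `[0, pi]; rewrite /= lte_fin pi_gt0 oppr0 adde0.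
by move=> h; rewrite (_ : _ `[0, pi]%classic = pi%:E). Qed.

Lemma int0pi_norm_le f (B : R) : continuous f -> (forall t, `|f t| <= B) ->
  `|int0pi f| <= B * pi.
Proof.
move=> cf fB; apply: le_trans (le_normr_Rintegral _ _) _ => //.
  exact: integrable0pi.
rewrite -int0pi_cst; apply: le_Rintegral => //; apply: integrable0pi.
  by move=> x; apply: cvg_norm; exact: cf.
by move=> x; exact: cvg_cst.
Qed.

(** Bounded convergence. *)
Lemma int0pi_cvg (f_ : nat -> R -> R) f (B : R) :
  (forall n, continuous (f_ n)) -> continuous f ->
  (forall n t, `|f_ n t| <= B) ->
  (forall t, f_ n t @[n --> \oo] --> f t) ->
  int0pi (f_ n) @[n --> \oo] --> int0pi f.
Proof.
move=> cf_ cf fB ff.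
have := @dominated_cvg _ _ _ (@lebesgue_measure R) `[0, pi]%classic _
  (fun n t => (f_ n t)%:E) (fun t => (f t)%:E) (fun=> B%:E).
move=> /(_ (measurable_itv _)) h.
apply: fine_cvg; rewrite fineK; last first.
  by apply: integrable_fin_num => //; exact: integrable0pi.
apply: h => //.
- by move=> n; have /integrableP[] := integrable0pi (cf_ n).
- by move=> t _; apply: cvg_EFin; [near=> n|exact: ff].
- by apply: (@integrable0pi (fun=> B)) => x; exact: cvg_cst.
- by move=> n t _; rewrite lee_fin.
Unshelve. all: by end_near. Qed.

Lemma int0pi_FTC (F f : R -> R) : continuous f ->
  (forall t : R, is_derive t (1 : R) F (f t)) -> int0pi f = F pi - F 0.
Proof.
move=> cf dF.
have cF : continuous F.
  move=> t; apply: differentiable_continuous; apply/derivable1_diffP.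
  by have [] := dF t.
rewrite /int0pi /Rintegral (continuous_FTC2 (F := F)) //.
- exact: pi_gt0.
- exact: continuous_subspaceT.
- split.
  + by move=> t _; have [] := dF t.
  + by apply: cvg_at_right_filter; exact: cF.
  + by apply: cvg_at_left_filter; exact: cF.
- by move=> t _; rewrite derive1E; have [_ ->] := dF t.
Qed.

End int0pi.

(** * The unit circle *)

Section expi.
Variable R : realType.
Implicit Types t u : R.

Lemma expi0 : expi (0 : R) = 1.
Proof. by rewrite /expi cos0 sin0. Qed.

Lemma expiD t u : expi (t + u) = expi t * expi u.
Proof. by rewrite /expi cosD sinD; apply/eqP; rewrite eq_complex /= eqxx addrC eqxx. Qed.

Lemma expiN t : expi (- t) = (expi t)^-1.
Proof.
rewrite /expi cosN sinN; apply/eqP; rewrite eq_complex /= cos2Dsin2 !divr1.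
by rewrite !eqxx.
Qed.

Lemma expiNJ t : expi (- t) = conjc (expi t).
Proof. by rewrite /expi cosN sinN. Qed.

Lemma normc_expi t : normc (expi t) = 1.
Proof. by rewrite /= cos2Dsin2 sqrtr1. Qed.

Lemma expi_neq0 t : expi t != 0.
Proof.
apply/negP => /eqP e; have := normc_expi t; rewrite e normc0 => /eqP.
by rewrite eq_sym oner_eq0.
Qed.

Lemma expiX n t : expi t ^+ n = expi (n%:R * t).
Proof.
elim: n => [|n ih]; first by rewrite mul0r expi0.
by rewrite exprSr ih -expiD -natr1 mulrDl mul1r.
Qed.

Lemma expi_exprz (m : int) t : expi t ^ m = expi (m%:~R * t).
Proof.
case: m => n; first by rewrite -exprnP expiX.
by rewrite NegzE -exprnN expiX mulrNz mulNr expiN.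
Qed.

Lemma cvgC_expi t : cvgC (nbhs t) (@expi R) (expi t).
Proof. by split; [exact: continuous_cos|exact: continuous_sin]. Qed.

Lemma sin_nat_pi n : sin (n%:R * pi : R) = 0.
Proof.
elim: n => [|n ih]; first by rewrite mul0r sin0.
by rewrite -natr1 mulrDl mul1r sinDpi ih oppr0.
Qed.

Lemma sin_int_pi (m : int) : sin (m%:~R * pi : R) = 0.
Proof.
case: m => n; first exact: sin_nat_pi.
by rewrite NegzE mulrNz mulNr sinN sin_nat_pi oppr0.
Qed.

Lemma int0pi_cos (m : int) : m != 0 -> int0pi (fun t => cos (m%:~R * t)) = 0 :> R.
Proof.
move=> m0; have mR0 : m%:~R != 0 :> R by rewrite intr_eq0.
have cf : continuous (fun t : R => cos (m%:~R * t)).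
  by move=> t; apply: continuous_comp; [exact: mulrl_continuous|exact: continuous_cos].
have dF (t : R) : is_derive t (1 : R) (fun t => m%:~R^-1 * sin (m%:~R * t)) (cos (m%:~R * t)).
  have d1 : is_derive t (1 : R) (fun t : R => m%:~R * t) (m%:~R : R).
    apply: is_derive_eq; by rewrite /GRing.scale /= ?mulr1 ?mulr0 ?addr0 ?add0r ?scaler0.
  have d2 : is_derive t (1 : R) (fun t : R => sin (m%:~R * t)) (m%:~R * cos (m%:~R * t)).
    rewrite mulrC; exact: (@is_derive1_comp _ sin _ _ _ _ (is_derive_sin _) d1).
  by apply: (@is_derive_eq _ _ _ _ _ _ _ _ (is_deriveZ _ d2)); rewrite /GRing.scale /= mulKf.
by rewrite (int0pi_FTC cf dF) /= sin_int_pi !mulr0 sin0 mulr0 subrr.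
Qed.
End expi.

(** * Shifting the contour between two circles *)

Section shift.
Variables (R : realType).
Implicit Types (rho t B : R) (F G : R[i] -> R[i]) (n m : int).

Definition circ rho t : R[i] := rho%:C * expi t.

Definition contC (f : R -> R[i]) := forall t, cvgC (nbhs t) f (f t).

(** Only real parts are integrated, over the upper half circle: for functions
    that commute with conjugation this is half of the integral over the circle. *)
Definition moment rho F n :=
  int0pi (fun t => complex.Re (circ rho t ^ n * F (circ rho t))).

Lemma circ_neq0 rho t : 0 < rho -> circ rho t != 0.
Proof.
move=> r0; rewrite mulf_neq0 ?expi_neq0 //.
by rewrite real_complex_neq0 // lt0r_neq0.
Qed.

Lemma normcX (z : R[i]) k : normc (z ^+ k) = normc z ^+ k.
Proof. by elim: k => [|k ih]; rewrite ?normc1 // !exprS normcM ih. Qed.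

Lemma normc_exprz (z : R[i]) n : normc (z ^ n) = normc z ^ n.
Proof. by case: n => k; rewrite ?NegzE -?exprnN ?normcV normcX. Qed.

Lemma normc_circ rho t n : 0 < rho -> normc (circ rho t ^ n) = rho ^ n.
Proof.
by move=> r0; rewrite normc_exprz normcM normcR normc_expi mulr1 gtr0_norm.
Qed.

Lemma contC_circ rho n : 0 < rho -> contC (fun t => circ rho t ^ n).
Proof.
move=> r0 t; apply: cvgC_exprz; first exact: circ_neq0.
by apply: cvgCM; [exact: cvgC_cst|exact: cvgC_expi].
Qed.

Lemma contCM f g : contC f -> contC g -> contC (fun t => f t * g t).
Proof. by move=> cf cg t; apply: cvgCM. Qed.

Lemma contC_cst l : contC (fun=> l).
Proof. by move=> t; apply: cvgC_cst. Qed.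

Variable s : R.
Hypothesis s01 : 0 < s < 1.
Let s0 : 0 < s. Proof. by case/andP: s01. Qed.

Definition two_radii rho := rho = s \/ rho = s^-1.

Lemma two_radii_gt0 rho : two_radii rho -> 0 < rho.
Proof. by move=> [->|->]; rewrite ?invr_gt0. Qed.
Hint Resolve two_radii_gt0 : core.

(** Functions whose Laurent coefficients, computed on the circles of radii [s]
    and [1/s], agree. This is the part of Cauchy's theorem that is needed, and
    it can be checked factor by factor on products and quotients. *)
Record shift_invariant F : Prop := ShiftInvariant {
  shift_cont : forall rho, two_radii rho -> contC (fun t => F (circ rho t));
  shift_bound : exists B, forall rho t, two_radii rho -> normc (F (circ rho t)) <= B;
  shift_moment : forall n, moment s F n = moment s^-1 F n }.

Lemma moment_cont F rho n : shift_invariant F -> two_radii rho ->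
  continuous (fun t => complex.Re (circ rho t ^ n * F (circ rho t))).
Proof.
move=> sF rr t; have [] // := @contCM _ _ (contC_circ n (two_radii_gt0 rr)) (shift_cont sF rr) t.
Qed.

Lemma shift_invariant1 : shift_invariant (fun=> 1).
Proof.
split.
- by move=> rho _; apply: contC_cst.
- by exists 1 => rho t _; rewrite normc1.
suff h rho n : two_radii rho -> moment rho (fun=> 1) n = if n == 0 then pi else 0.
  by move=> n; rewrite !h //; [right|left].
move=> /two_radii_gt0 r0; rewrite /moment.
rewrite (int0pi_ext (g := fun t => rho ^ n * cos (n%:~R * t))); last first.
  move=> t; rewrite mulr1 /circ expfzMl expi_exprz -rmorphXz ?unitfE ?lt0r_neq0 //=.
  by rewrite mul0r subr0.
have [->|n0] := eqVneq n 0.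
  rewrite (int0pi_ext (g := fun=> 1)) ?int0pi_cst ?mul1r // => t.
  by rewrite mul0r cos0 mulr1.
rewrite int0piZ ?int0pi_cos ?mulr0 // => t.
by apply: continuous_comp; [exact: mulrl_continuous|exact: continuous_cos].
Qed.

Lemma moment_mul (b : R) F rho n m :
  (forall n, continuous (fun t => complex.Re (circ rho t ^ n * F (circ rho t)))) ->
  0 < rho ->
  moment rho (fun z => (1 - b%:C * z ^ m) * F z) n =
  moment rho F n - b * moment rho F (n + m).
Proof.
move=> cF r0; rewrite /moment -int0piZ // -int0piB //; last first.
  by move=> t; apply: cvgM; [exact: cvg_cst|exact: cF].
apply: int0pi_ext => t.
rewrite expfzDr ?circ_neq0 // mulrBl mulrBr mul1r raddfB /=; congr (_ - _).
set z := circ rho t ^ n; set w := circ rho t ^ m.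
rewrite (_ : z * (b%:C * w * _) = b%:C * (z * w * F (circ rho t))); last by ring.
by case: (z * w * _) => x y /=; rewrite mul0r subr0.
Qed.

Lemma shift_invariantM (b : R) F m : shift_invariant F ->
  shift_invariant (fun z => (1 - b%:C * z ^ m) * F z).
Proof.
move=> sF; split.
- move=> rho rr; apply: contCM; last exact: shift_cont.
  move=> t; apply: cvgCB; first exact: cvgC_cst.
  by apply: (contCM (contC_cst _) (contC_circ _ _)); exact: two_radii_gt0.
- have [B FB] := shift_bound sF.
  have B0 : 0 <= B by apply: le_trans (FB s 0 _); [exact: normc_ge0|left].
  have r0 rho : two_radii rho -> 0 <= rho ^ m by move=> /two_radii_gt0 h; rewrite ltW // exprz_gt0.
  have sm : 0 <= s ^ m by apply: r0; left.
  have sVm : 0 <= s^-1 ^ m by apply: r0; right.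
  exists ((1 + `|b| * (s ^ m + s^-1 ^ m)) * B) => rho t rr.
  rewrite normcM; apply: ler_pM; rewrite ?normc_ge0 //; last exact: FB.
  apply: le_trans (le_normcD _ _) _.
  rewrite normc1 normcN lerD2l normcM normcR normc_circ ?two_radii_gt0 //.
  by rewrite ler_wpM2l //; case: rr => ->; rewrite ?lerDl ?lerDr.
- move=> n; rewrite !moment_mul ?invr_gt0 //.
  + by rewrite !(shift_moment sF).
  + by move=> k; apply: moment_cont => //; right.
  + by move=> k; apply: moment_cont => //; left.
Qed.

(** The difference [D n] of the two moments of [F / (1 - u)], with
    [u = a z ^ m], satisfies [D n = a * D (n + m)] because the moments of [F]
    agree; iterating, [D n = a ^ J * D (n + m J)], which tends to 0 with
    [|u| ^ J]. *)
Lemma shift_invariantV (a : R) (kappa : R) F m : shift_invariant F ->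
  kappa < 1 -> (forall rho, two_radii rho -> `|a| * rho ^ m <= kappa) ->
  shift_invariant (fun z => F z / (1 - a%:C * z ^ m)).
Proof.
move=> sF k1 ak; pose G z := F z / (1 - a%:C * z ^ m).
have rs : two_radii s by left.
have rsV : two_radii s^-1 by right.
have kappa0 : 0 <= kappa.
  by apply: le_trans (ak s rs); rewrite mulr_ge0 // ltW // exprz_gt0.
have den rho t : two_radii rho -> 1 - kappa <= normc (1 - a%:C * circ rho t ^ m).
  move=> rr; have := le_normcD (1 - a%:C * circ rho t ^ m) (a%:C * circ rho t ^ m).
  rewrite (_ : (_ + _ : Rcomplex R) = (1 : R[i])); last exact: subrK.
  rewrite normc1 normcM normcR normc_circ ?two_radii_gt0 //.
  by have := ak _ rr; lra.
have den0 rho t : two_radii rho -> 1 - a%:C * circ rho t ^ m != 0.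
  move=> rr; apply/negP => /eqP e; have := den rho t rr.
  by rewrite e normc0; lra.
have cG rho : two_radii rho -> contC (fun t => G (circ rho t)).
  move=> rr; apply: contCM; first exact: shift_cont.
  move=> t; apply: cvgCV; first exact: den0.
  apply: cvgCB; first exact: cvgC_cst.
  by apply: (contCM (contC_cst _) (contC_circ _ _)); exact: two_radii_gt0.
have [B FB] := shift_bound sF.
have B0 : 0 <= B by apply: le_trans (FB s 0 _); [exact: normc_ge0|left].
have GB rho t : two_radii rho -> normc (G (circ rho t)) <= B / (1 - kappa).
  move=> rr; rewrite normcM normcV; apply: ler_pM; rewrite ?normc_ge0 ?invr_ge0 ?normc_ge0 //.
    exact: FB.
  have := den rho t rr; move=> h; rewrite lef_pV2 // posrE; lra.
have cGn rho n : two_radii rho ->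
    continuous (fun t => complex.Re (circ rho t ^ n * G (circ rho t))).
  by move=> rr t; have [] := @contCM _ _ (contC_circ n (two_radii_gt0 rr)) (cG _ rr) t.
split => [//||n]; first by exists (B / (1 - kappa)).
have mG rho k : two_radii rho -> moment rho F k = moment rho G k - a * moment rho G (k + m).
  move=> rr; rewrite -moment_mul ?two_radii_gt0 //; last by move=> j; exact: cGn.
  apply: int0pi_ext => t; congr (complex.Re (_ * _)); rewrite /G mulrCA.
  by rewrite mulfV ?mulr1 // den0.
pose D k := moment s G k - moment s^-1 G k.
have DS k : D k = a * D (k + m).
  have := shift_moment sF k; rewrite (mG _ _ rs) (mG _ _ rsV) /D.
  move: (moment s G k) (moment s^-1 G k) (moment s G (k + m)) (moment s^-1 G (k + m)).
  by move=> x y x' y' e; lra.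
have DJ J k : D k = a ^+ J * D (k + m *~ J).
  elim: J k => [|J ih] k; first by rewrite mul1r mulr0z addr0.
  by rewrite ih DS mulrA -exprSr -addrA intS mulrzDr mulr1z [m + _]addrC.
have mb rho k J : two_radii rho ->
    `|a ^+ J * moment rho G (k + m *~ J)| <= rho ^ k * (B / (1 - kappa)) * pi * kappa ^+ J.
  move=> rr; have r0 := two_radii_gt0 rr.
  rewrite normrM normrX mulrC.
  have h : `|moment rho G (k + m *~ J)| <= rho ^ (k + m *~ J) * (B / (1 - kappa)) * pi.
    apply: int0pi_norm_le; first exact: cGn.
    move=> t; apply: le_trans (normcRe _) _; rewrite normcM normc_circ //.
    by rewrite ler_wpM2l ?GB // ltW // exprz_gt0.
  apply: le_trans (ler_wpM2r _ h) _; first by rewrite exprn_ge0.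
  rewrite expfzDr ?lt0r_neq0 // -mulrzr -exprz_exp intz -exprnP.
  rewrite (_ : _ * _ * _ * _ * _ = rho ^ k * (B / (1 - kappa)) * pi * (`|a| * rho ^ m) ^+ J); last first.
    by rewrite exprMn; ring.
  rewrite ler_wpM2l //; last first.
    by rewrite lerXn2r // ?nnegrE ?ak // mulr_ge0 // ltW // exprz_gt0.
  rewrite !mulr_ge0 ?pi_ge0 ?invr_ge0 ?subr_ge0 //; first by rewrite ltW // exprz_gt0.
  exact: ltW.
suff -> : moment s G n = moment s^-1 G n by [].
apply/eqP; rewrite -subr_eq0 -/(D n).
set C := (s ^ n + s^-1 ^ n) * (B / (1 - kappa)) * pi.
have DC J : `|D n| <= C * kappa ^+ J.
  rewrite (DJ J) /D mulrBr; apply: le_trans (ler_normB _ _) _.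
  by rewrite /C !mulrDl; apply: lerD; exact: mb.
have C0 : (fun J => C * kappa ^+ J) @ \oo --> (0 : R).
  by apply: (@cvg_geometric R C kappa); rewrite ger0_norm.
rewrite -normr_le0; apply: (cvgr_to_ge C0); near=> J; exact: DC.
Unshelve. all: by end_near. Qed.

Lemma shift_invariant_prod (N : nat) (b : nat -> R) F m : shift_invariant F ->
  shift_invariant (fun z => (\prod_(k < N) (1 - (b k)%:C * z ^ m)) * F z).
Proof.
elim: N F => [|N ih] F sF.
  rewrite (_ : (fun z => _) = F) //; apply/funext => z.
  by rewrite big_ord0 mul1r.
rewrite (_ : (fun z => _) = fun z => \prod_(k < N) (1 - (b k)%:C * z ^ m) *
  ((1 - (b N)%:C * z ^ m) * F z)); first by apply: ih; exact: shift_invariantM.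
by apply/funext => z; rewrite big_ord_recr mulrA.
Qed.

Lemma shift_invariant_div (N : nat) (a : nat -> R) (kappa : R) F m :
  shift_invariant F -> kappa < 1 ->
  (forall k rho, two_radii rho -> `|a k| * rho ^ m <= kappa) ->
  shift_invariant (fun z => F z / \prod_(k < N) (1 - (a k)%:C * z ^ m)).
Proof.
move=> + k1 ak; elim: N F => [|N ih] F sF.
  rewrite (_ : (fun z => _) = F) //; apply/funext => z.
  by rewrite big_ord0 divr1.
rewrite (_ : (fun z => _) = fun z => F z / (1 - (a N)%:C * z ^ m) /
  \prod_(k < N) (1 - (a k)%:C * z ^ m)).
  by apply: ih; apply: shift_invariantV sF k1 _ => rho; exact: ak.
by apply/funext => z; rewrite big_ord_recr /= invfM mulrCA mulrC.
Qed.

(** The circles of radii [s] and [1/s] are exchanged by [z -> 1/z], so that the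
    mean on the first one is its own opposite. *)
Lemma int0pi_antisymmetric F : shift_invariant F ->
  (forall z, z != 0 -> F z^-1 = - F z) ->
  (forall z, F (conjc z) = conjc (F z)) ->
  int0pi (fun t => complex.Re (F (circ s t))) = 0.
Proof.
move=> sF FV FJ; have rs : two_radii s by left.
have := shift_moment sF 0; rewrite /moment.
under [X in int0pi X = _]eq_fun do rewrite expr0z mul1r.
rewrite [in RHS](int0pi_ext (g := fun t => -1 * complex.Re (F (circ s t)))).
  have c : continuous (fun t => complex.Re (F (circ s t))).
    by move=> t; have [] := shift_cont sF rs t.
  by rewrite int0piZ //; lra.
move=> t; rewrite expr0z mul1r.
have -> : circ s^-1 t = (conjc (circ s t))^-1.
  have -> : conjc (circ s t) = s%:C * expi (- t).
    rewrite expiNJ /circ; case: (expi t) => x y; apply/eqP.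
    by rewrite eq_complex /= !mul0r !subr0 !addr0 mulrN !eqxx.
  by rewrite invfM expiN invrK /circ -fmorphV.
rewrite FV ?conjc_eq0 ?circ_neq0 // FJ raddfN mulN1r.
by case: (F _).
Qed.

End shift.

(** * The function h and the weight *)

Section hfun.
Variables (R : realType) (q : R) (hq : 0 < q < 1).
Let q0 : 0 < q. Proof. by case/andP: hq. Qed.
Let q1 : q < 1. Proof. by case/andP: hq. Qed.
Implicit Types (a x t X : R).

Let qX_ge0 k : 0 <= q ^+ k. Proof. by rewrite exprn_ge0 // ltW. Qed.
Let qX_le1 k : q ^+ k <= 1. Proof. by rewrite exprn_ile1 // ltW. Qed.

Definition h_trunc N x a : R :=
  \prod_(k < N) (1 - 2 * a * x * q ^+ k + a ^+ 2 * q ^+ (2 * k)).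

(** The constant in the speed of convergence of the product defining h, for
    arguments bounded by [X] and parameters bounded by 1. *)
Definition h_rate (X : R) :=
  2 * (prod_bound q (2 * X + 1) * (2 * X + 1) / (1 - q)).

Lemma h_rate_ge0 X : 0 <= X -> 0 <= h_rate X.
Proof.
move=> X0; rewrite mulr_ge0 // mulr_ge0 ?invr_ge0 ?subr_ge0 ?(ltW q1) //.
by rewrite mulr_ge0 ?(ltW (prod_bound_gt0 _ _)) // addr_ge0 // mulr_ge0.
Qed.

Lemma prod_bound_le (M M' : R) : M <= M' -> prod_bound q M <= prod_bound q M'.
Proof. by move=> MM; rewrite ler_expR ler_wpM2r // invr_ge0 subr_ge0 ltW. Qed.

Lemma h_factor_le X a x k : `|a| <= 1 -> `|x| <= X ->
  `|- (2 * a * x * q ^+ k) + a ^+ 2 * q ^+ (2 * k)| <= `|a| * (2 * X + 1) * q ^+ k.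
Proof.
move=> a1 xX; apply: le_trans (ler_normD _ _) _.
rewrite normrN !normrM !normrX [`|2|]ger0_norm // ![`|q|]ger0_norm ?(ltW q0) //.
have -> : `|a| * (2 * X + 1) * q ^+ k = 2 * `|a| * X * q ^+ k + `|a| * 1 * q ^+ k by ring.
apply: lerD; first by rewrite ler_wpM2r // ler_wpM2l // mulr_ge0.
rewrite mulr1 -mulrA ler_wpM2l // mulnC exprM expr2 mulrA ler_piMl //.
by rewrite mulr_ile1.
Qed.

Lemma hfun_approx X x a : `|a| <= 1 -> `|x| <= X ->
  h_trunc N x a @[N --> \oo] --> hfun q x a /\
  forall N, `|hfun q x a - h_trunc N x a| <= `|a| * h_rate X * q ^+ N.
Proof.
move=> a1 xX; set M := `|a| * (2 * X + 1).
have X0 : 0 <= X by apply: le_trans xX.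
pose u k : R[i] := (- (2 * a * x * q ^+ k) + a ^+ 2 * q ^+ (2 * k))%:C.
have [|l [[lc _] lb]] := prod1D_cvg hq (M := M) (u := u).
  by move=> k; rewrite /u normcR h_factor_le.
have E N : \prod_(k < N) (1 + u k) = (h_trunc N x a)%:C.
  by rewrite rmorph_prod; apply: eq_bigr => k _; apply/eqP; rewrite eq_complex /= addrA addr0 !eqxx.
have lc' : h_trunc N x a @[N --> \oo] --> complex.Re l.
  by apply: cvg_trans lc; apply: near_eq_cvg; near=> N; rewrite /= E.
have e : hfun q x a = complex.Re l by exact: cvg_lim lc'.
rewrite e; split => // N.
apply: (@le_trans _ _ (normc (l - (h_trunc N x a)%:C))).
  by apply: le_trans (normcRe _); rewrite raddfB.
rewrite -E; apply: le_trans (lb N) _.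
have -> : `|a| * h_rate X * q ^+ N =
    2 * (prod_bound q (2 * X + 1) * M / (1 - q)) * q ^+ N by rewrite /h_rate /M; ring.
have M10 : 0 <= 2 * X + 1 by rewrite addr_ge0 // mulr_ge0.
have M0 : 0 <= M by rewrite mulr_ge0.
rewrite ler_wpM2r // ler_wpM2l // ler_wpM2r ?invr_ge0 ?subr_ge0 ?(ltW q1) //.
by rewrite ler_wpM2r // prod_bound_le // /M ler_piMl.
Unshelve. all: by end_near. Qed.

Lemma hfun_cvg a x : `|a| <= 1 -> h_trunc N x a @[N --> \oo] --> hfun q x a.
Proof. by move=> a1; have [] := hfun_approx a1 (lexx `|x|). Qed.

Lemma hfun_near1 a x : `|a| <= 1 -> `|x| <= 1 ->
  `|hfun q x a - 1| <= `|a| * h_rate 1.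
Proof.
move=> a1 x1; have [_ /(_ 0)] := hfun_approx a1 x1.
by rewrite /h_trunc big_ord0 expr0 mulr1.
Qed.

Lemma h_trunc_cont N a : continuous (h_trunc N ^~ a).
Proof.
move=> x; change (h_trunc N y a @[y --> x] --> h_trunc N x a); elim: N => [|N ih].
  by under eq_fun do rewrite /h_trunc big_ord0; rewrite /h_trunc big_ord0; exact: cvg_cst.
have E y : h_trunc N.+1 y a =
    h_trunc N y a * (1 - 2 * a * y * q ^+ N + a ^+ 2 * q ^+ (2 * N)).
  by rewrite /h_trunc big_ord_recr.
rewrite E; under eq_fun do rewrite E.
apply: cvgM => //; apply: cvgD; last exact: cvg_cst.
apply: cvgB; first exact: cvg_cst.
by apply: cvgM; [apply: cvgM; [exact: cvg_cst|exact: cvg_id]|exact: cvg_cst].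
Qed.

Lemma hfun_cont a : `|a| <= 1 -> continuous (hfun q ^~ a).
Proof.
move=> a1 x; set X := `|x| + 1; have X0 : 0 <= X by rewrite addr_ge0.
apply: (@geometric_limit_cont _ q (`|a| * h_rate X) _ (fun N y => h_trunc N y a)) => //.
- by rewrite mulr_ge0 // h_rate_ge0.
- by move=> N; exact: h_trunc_cont.
near=> y => N; suff yX : `|y| <= X by have [_ ->] := hfun_approx a1 yX.
have : `|x - y| <= 1.
  by near: y; have /cvgrPdist_le : y @[y --> x] --> x by []; apply.
have := ler_normB (x - y) x; rewrite (_ : x - y - x = - y); last by ring.
by rewrite normrN /X; lra.
Unshelve. all: by end_near. Qed.

Lemma h_trunc_recl N a x : h_trunc N.+1 x a = (1 - 2 * a * x + a ^+ 2) * h_trunc N x (a * q).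
Proof.
rewrite /h_trunc big_ord_recl /= expr0 !mulr1; congr (_ * _).
by apply: eq_bigr => k _; rewrite /bump /= add1n mulnS exprD !exprS !expr0; ring.
Qed.

Lemma normr_Mq a : `|a| <= 1 -> `|a * q| <= 1.
Proof. by move=> a1; rewrite normrM (gtr0_norm q0) mulr_ile1 // ltW. Qed.

Lemma hfun_rec a x : `|a| <= 1 ->
  hfun q x a = (1 - 2 * a * x + a ^+ 2) * hfun q x (a * q).
Proof.
move=> a1.
have h1 : h_trunc N.+1 x a @[N --> \oo] --> hfun q x a.
  by rewrite (cvg_shiftS (fun N => h_trunc N x a)); exact: hfun_cvg.
have h2 : h_trunc N.+1 x a @[N --> \oo] --> (1 - 2 * a * x + a ^+ 2) * hfun q x (a * q).
  under eq_fun do rewrite h_trunc_recl.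
  by apply: cvgM; [exact: cvg_cst|apply: hfun_cvg; exact: normr_Mq].
by rewrite -(cvg_lim _ h1) // -(cvg_lim _ h2).
Qed.

Lemma prod1B_lower (rho : R) N : 0 <= rho < 1 ->
  (prod_bound q (rho / (1 - rho)))^-1 <= \prod_(k < N) (1 - rho * q ^+ k).
Proof.
move=> /andP[r0 r1].
have rk k : 0 <= rho * q ^+ k <= rho by rewrite mulr_ge0 //= ler_piMr.
have p0 : 0 < \prod_(k < N) (1 - rho * q ^+ k).
  by apply: prodr_gt0 => k _; have /andP[] := rk k; lra.
rewrite -[leRHS]invrK lef_pV2 ?posrE ?invr_gt0 ?prod_bound_gt0 // -prodfV.
have d0 : 0 <= (1 - rho)^-1 by rewrite invr_ge0; lra.
apply: (@prod1D_le R q hq _ (fun k => (1 - rho * q ^+ k)^-1)); first by rewrite mulr_ge0.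
move=> k; have /andP[a b] := rk k; rewrite invr_ge0 subr_ge0 (le_trans b) ?(ltW r1) //=.
have e : 0 < 1 - rho * q ^+ k by lra.
rewrite -[leLHS]mul1r ler_pdivrMr //.
have -> : (1 + rho / (1 - rho) * q ^+ k) * (1 - rho * q ^+ k) =
  1 + rho * q ^+ k * ((1 - rho * q ^+ k) / (1 - rho) - 1) by ring.
rewrite lerDl mulr_ge0 // subr_ge0 ler_pdivlMr; lra.
Qed.

(** A lower bound of h on [-1, 1] for parameters bounded by [rho]: each factor
    is at least [(1 - rho q^k)^2], and the product of the inverses of the
    [1 - rho q^k] is bounded by [prod1D_le]. *)
Definition h_low (rho : R) := (prod_bound q (rho / (1 - rho)))^-1 ^+ 2.

Lemma h_low_gt0 rho : 0 < h_low rho.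
Proof. by rewrite exprn_gt0 // invr_gt0 prod_bound_gt0. Qed.

Lemma h_trunc_ge (rho : R) N a x : `|a| <= rho -> rho < 1 -> `|x| <= 1 ->
  h_low rho <= h_trunc N x a.
Proof.
move=> ar r1 x1; have r0 : 0 <= rho by apply: le_trans ar.
have hp : 0 <= rho < 1 by rewrite r0.
apply: (@le_trans _ _ ((\prod_(k < N) (1 - rho * q ^+ k)) ^+ 2)).
  by rewrite lerXn2r ?nnegrE ?invr_ge0 ?(ltW (prod_bound_gt0 _ _)) ?prod1B_lower //
    prodr_ge0 // => k _; rewrite subr_ge0 mulr_ile1 // ltW.
rewrite expr2 -big_split /=; apply: ler_prod => k _.
rewrite sqr_ge0 /=.
have : `|a * q ^+ k| <= rho * q ^+ k.
  by rewrite normrM [`|q ^+ k|]ger0_norm // ler_wpM2r.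
have : rho * q ^+ k <= 1 by rewrite mulr_ile1 // ltW.
rewrite (_ : 2 * a * x * q ^+ k = 2 * (a * q ^+ k) * x); last by ring.
rewrite (_ : a ^+ 2 * q ^+ (2 * k) = (a * q ^+ k) ^+ 2); last first.
  by rewrite exprMn mulnC exprM.
move: (a * q ^+ k) (rho * q ^+ k) => u r.
move=> r1' ur; have ux : u * x <= `|u|.
  by apply: le_trans (ler_norm _) _; rewrite normrM ler_piMr.
have u2 : u ^+ 2 = `|u| ^+ 2 by rewrite real_normK ?num_real.
have : (1 - r) * (1 - r) <= (1 - `|u|) * (1 - `|u|) by apply: ler_pM; lra.
by rewrite u2; lra.
Qed.

Lemma hfun_ge (rho : R) a x : `|a| <= rho -> rho < 1 -> `|x| <= 1 ->
  h_low rho <= hfun q x a.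
Proof.
move=> ar r1 x1; have a1 : `|a| <= 1 by apply: le_trans ar (ltW r1).
apply: (cvgr_to_ge (hfun_cvg a1)); near=> N; exact: h_trunc_ge.
Unshelve. all: by end_near. Qed.

Lemma hfun_gt0 a x : `|a| < 1 -> `|x| <= 1 -> 0 < hfun q x a.
Proof. by move=> a1 x1; apply: lt_le_trans (h_low_gt0 _) (hfun_ge (lexx _) _ _). Qed.

Lemma hfun0 x : hfun q x 0 = 1.
Proof.
have [_ /(_ 0)] := @hfun_approx `|x| x 0 (ltac:(by rewrite normr0)) (lexx _).
by rewrite normr0 !mul0r normr_le0 /h_trunc big_ord0 subr_eq0 => /eqP.
Qed.

(** The factors of index 0 of h(x, 1) and h(x, -1) give [4 (1 - x^2)], which makes
    the weight vanish at the end points in spite of the square root. *)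
Lemma hnumE x : hnum q x =
  4 * (1 - x ^+ 2) * (hfun q x q * hfun q x (- q) * hfun q x (Num.sqrt q) *
  hfun q x (- Num.sqrt q)).
Proof.
rewrite /hnum (@hfun_rec 1) ?normr1 // (@hfun_rec (- 1)) ?normrN ?normr1 //.
by rewrite mul1r mulN1r; ring.
Qed.

Definition aw_weight a b c d x :=
  hnum q x / (hfun q x a * hfun q x b * hfun q x c * hfun q x d).

End hfun.

(** * The first moment of the weight *)

Section AWshift.
Variables (R : realType) (q : R) (hq : 0 < q < 1).
Let q0 : 0 < q. Proof. by case/andP: hq. Qed.
Let q1 : q < 1. Proof. by case/andP: hq. Qed.
Let qX_ge0 k : 0 <= q ^+ k. Proof. by rewrite exprn_ge0 // ltW. Qed.
Let qX_le1 k : q ^+ k <= 1. Proof. by rewrite exprn_ile1 // ltW. Qed.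
Local Notation s := (Num.sqrt q).
Let ss : s * s = q. Proof. by rewrite -expr2 sqr_sqrtr // ltW. Qed.
Let s0 : 0 < s. Proof. by rewrite sqrtr_gt0. Qed.
Let s1 : s < 1. Proof. by rewrite -sqrtr1 ltr_sqrt. Qed.
Let s01 : 0 < s < 1. Proof. by rewrite s0. Qed.

Definition qfactor N (a : R) (z : R[i]) : R[i] :=
  \prod_(k < N) (1 - (a * q ^+ k)%:C * z).

Definition hfactor N (a : R) (z : R[i]) := qfactor N a z * qfactor N a z^-1.

(** The function [F] of the contour shift, with all products truncated. The
    parameters of the numerator come from
    [(q z^2; q)_oo = (s z, - s z, q z, - q z; q)_oo] for [s = sqrt q]. *)
Definition shift_fun (a b c d : R) N (z : R[i]) : R[i] :=
  (z - z^-1) * (hfactor N s z * hfactor N (- s) z * hfactor N (s * s) z * hfactor N (- s * s) z)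
  / hfactor N (a * s) z / hfactor N (b * s) z / hfactor N (c * s) z / hfactor N (d * s) z.

Lemma conjc_prod N (f : 'I_N -> R[i]) :
  conjc (\prod_k f k) = \prod_k conjc (f k).
Proof. exact: (rmorph_prod (@conjc R)). Qed.

Lemma qfactorJ N a z : qfactor N a (conjc z) = conjc (qfactor N a z).
Proof.
rewrite /qfactor conjc_prod; apply: eq_bigr => k _.
case: z => x y; apply/eqP; rewrite eq_complex /=; apply/andP; split; apply/eqP; ring.
Qed.

Lemma hfactorJ N a z : hfactor N a (conjc z) = conjc (hfactor N a z).
Proof. by rewrite /hfactor -conjc_inv !qfactorJ -rmorphM. Qed.

Lemma hfactorV N a z : hfactor N a z^-1 = hfactor N a z.
Proof. by rewrite /hfactor invrK mulrC. Qed.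

Lemma shift_funV a b c d N z : shift_fun a b c d N z^-1 = - shift_fun a b c d N z.
Proof. by rewrite /shift_fun !hfactorV invrK -opprB !mulNr. Qed.

Lemma shift_funJ a b c d N z : shift_fun a b c d N (conjc z) = conjc (shift_fun a b c d N z).
Proof. rewrite /shift_fun !hfactorJ -conjc_inv -!(conjc_inv (hfactor _ _ _)).
by rewrite -(rmorphB (@conjc R)) -!(rmorphM (@conjc R)). Qed.

Lemma shift_invariant_ext (F G : R[i] -> R[i]) : F =1 G ->
  shift_invariant s F -> shift_invariant s G.
Proof. by move=> /funext ->. Qed.

Lemma shift_invariant_exprz F (m : int) : shift_invariant s F ->
  shift_invariant s (fun z => z ^ m * F z).
Proof.
move=> sF; split.
- move=> rho rr.
  exact: (contCM (contC_circ m (two_radii_gt0 s01 rr)) (shift_cont sF rr)).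
- have [B FB] := shift_bound sF.
  have B0 : 0 <= B by apply: le_trans (FB s 0 _); [exact: normc_ge0|left].
  exists ((s ^ m + s^-1 ^ m) * B) => rho t rr.
  have sm : 0 <= s ^ m by rewrite ltW // exprz_gt0.
  have sVm : 0 <= s^-1 ^ m by rewrite ltW // exprz_gt0 // invr_gt0.
  rewrite normcM normc_circ; last exact: two_radii_gt0 rr.
  apply: ler_pM; rewrite ?normc_ge0 ?FB //.
    by case: rr => ->.
  by case: rr => ->; rewrite ?lerDl ?lerDr.
- move=> n; have h rho : two_radii s rho ->
      moment rho (fun z => z ^ m * F z) n = moment rho F (n + m).
    move=> /(two_radii_gt0 s01) r0; apply: int0pi_ext => t.
    by rewrite expfzDr ?circ_neq0 // mulrA.
  by rewrite !h ?(shift_moment sF) //; [right|left].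
Qed.

Lemma shift_invariant_hfactor N (a : R) F : shift_invariant s F ->
  shift_invariant s (fun z => hfactor N a z * F z).
Proof.
move=> sF; have h1 := shift_invariant_prod s01 N (fun k => a * q ^+ k) 1 sF.
apply: shift_invariant_ext (shift_invariant_prod s01 N (fun k => a * q ^+ k) (-1) h1).
move=> z /=; rewrite mulrA; congr (_ * _); rewrite mulrC /hfactor.
by congr (_ * _); apply: eq_bigr => k _; rewrite ?expr1z ?exprN1.
Qed.

Lemma shift_invariant_hfactorV N (a : R) F : `|a| < 1 -> shift_invariant s F ->
  shift_invariant s (fun z => F z / hfactor N (a * s) z).
Proof.
move=> a1 sF.
have ak k : `|a * s * q ^+ k| <= `|a| * s.
  by rewrite !normrM (gtr0_norm s0) [`|q ^+ k|]ger0_norm // ler_piMr // mulr_ge0 // ltW.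
have sV : s * s^-1 = 1 by rewrite mulfV // lt0r_neq0.
have sle : s <= s^-1 by rewrite -[s^-1]mul1r ler_pdivlMr // mulr_ile1 ?ltW.
have bnd k rho : two_radii s rho ->
    `|a * s * q ^+ k| * rho ^ 1 <= `|a| /\ `|a * s * q ^+ k| * rho ^ (-1) <= `|a|.
  move=> rr; rewrite expr1z exprN1.
  have r1 : 0 < rho <= s^-1 by case: rr => ->; rewrite ?s0 ?invr_gt0 ?s0 //= ?lexx.
  have r2 : 0 < rho^-1 <= s^-1.
    by case: rr => ->; rewrite ?invrK ?s0 ?invr_gt0 ?s0 //= ?lexx.
  case/andP: r1 => r10 r1; case/andP: r2 => r20 r2.
  split.
    apply: (@le_trans _ _ (`|a| * s * s^-1)); last by rewrite -mulrA sV mulr1.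
    by apply: ler_pM => //; exact: ltW.
  apply: (@le_trans _ _ (`|a| * s * s^-1)); last by rewrite -mulrA sV mulr1.
  by apply: ler_pM => //; exact: ltW.
have h1 := @shift_invariant_div R s s01 N (fun k => a * s * q ^+ k) `|a| F 1 sF a1
  (fun k rho rr => proj1 (bnd k rho rr)).
apply: shift_invariant_ext (@shift_invariant_div R s s01 N (fun k => a * s * q ^+ k)
  `|a| _ (-1) h1 a1 (fun k rho rr => proj2 (bnd k rho rr))).
by move=> z /=; rewrite -mulrA -invfM; congr (_ / _).
Qed.

Variables (a b c d : R).
Hypotheses (ha : `|a| < 1) (hb : `|b| < 1) (hc : `|c| < 1) (hd : `|d| < 1).

Lemma shift_invariant_shift_fun N : shift_invariant s (shift_fun a b c d N).
Proof.
(* [z^-1 (1 - z^2)] is the opposite of [z - z^-1]; the factor [1 - 2 z^0 = -1]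
   corrects the sign. *)
have h1 := shift_invariantM s01 1 2 (shift_invariant1 s01).
have h2 := shift_invariantM s01 2 0 (shift_invariant_exprz (-1) h1).
have h3 := shift_invariant_hfactor N s (shift_invariant_hfactor N (- s)
  (shift_invariant_hfactor N (s * s) (shift_invariant_hfactor N (- s * s) h2))).
have h4 := shift_invariant_hfactorV N hd (shift_invariant_hfactorV N hc
  (shift_invariant_hfactorV N hb (shift_invariant_hfactorV N ha h3))).
apply: shift_invariant_ext h4 => z /=; rewrite /shift_fun; do 4!congr (_ / _).
rewrite (_ : (1 - 2%:C * z ^ 0) * _ = z - z^-1); first by ring.
rewrite expr0z !mulr1 exprN1 (_ : 2%:C = 2) ?rmorph_nat //.
have [->|z0] := eqVneq z 0; first by rewrite invr0 mul0r mulr0 subrr.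
by rewrite mulrBr mulr1 mul1r -exprnP expr2 mulKf //; ring.
Qed.

Lemma int0pi_shift_fun N : int0pi (fun t => complex.Re (shift_fun a b c d N (circ s t))) = 0.
Proof.
apply: (int0pi_antisymmetric s01 (shift_invariant_shift_fun N)) => z; last exact: shift_funJ.
by rewrite shift_funV.
Qed.

Lemma qfactor_le N (u : R) z : `|u| * normc z <= 1 ->
  normc (qfactor N u z) <= prod_bound q 1.
Proof.
move=> uz; apply: (normc_prod1D_le hq (u := fun k => - ((u * q ^+ k)%:C * z))) => k.
rewrite normcN normcM normcR normrM [`|q ^+ k|]ger0_norm // mulrAC.
by rewrite ler_wpM2r.
Qed.

Lemma qfactor_ge N (u rho : R) z : `|u| * normc z <= rho -> rho < 1 ->
  (prod_bound q (rho / (1 - rho)))^-1 <= normc (qfactor N u z).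
Proof.
move=> uz r1; have r0 : 0 <= rho.
  by apply: le_trans uz; rewrite mulr_ge0 ?normc_ge0.
apply: (@le_trans _ _ (\prod_(k < N) (1 - rho * q ^+ k))).
  by apply: prod1B_lower; rewrite ?r0.
rewrite normc_prod; apply: ler_prod => k _.
rewrite subr_ge0 mulr_ile1 ?(ltW r1) //=.
have := le_normcD (1 - (u * q ^+ k)%:C * z) ((u * q ^+ k)%:C * z).
rewrite (_ : (_ + _ : Rcomplex R) = (1 : R[i])); last exact: subrK.
rewrite normc1 normcM normcR normrM [`|q ^+ k|]ger0_norm // mulrAC.
by have : `|u| * normc z * q ^+ k <= rho * q ^+ k by [rewrite ler_wpM2r]; lra.
Qed.

Let normc_circ1 t : normc (circ s t) = s.
Proof. by rewrite -[circ s t]expr1z normc_circ. Qed.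

Lemma hfactor_le N (g : R) t : `|g| <= 1 ->
  normc (hfactor N (g * s) (circ s t)) <= prod_bound q 1 ^+ 2.
Proof.
move=> g1; have h : `|g| * s <= 1 by rewrite mulr_ile1 // ltW.
rewrite normcM expr2; apply: ler_pM; rewrite ?normc_ge0 //; apply: qfactor_le.
  by rewrite normc_circ1 normrM (gtr0_norm s0) -mulrA ss mulr_ile1 // ltW.
by rewrite normcV normc_circ1 normrM (gtr0_norm s0) mulfK // lt0r_neq0.
Qed.

Lemma hfactor_ge N (g : R) t : `|g| < 1 ->
  h_low q `|g| <= normc (hfactor N (g * s) (circ s t)).
Proof.
move=> g1; rewrite normcM /h_low expr2.
have p0 rho : 0 <= (prod_bound q rho)^-1 by rewrite invr_ge0 ltW // prod_bound_gt0.
apply: ler_pM => //; apply: qfactor_ge => //.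
  by rewrite normc_circ1 normrM (gtr0_norm s0) -mulrA ler_piMr // ss ltW.
by rewrite normcV normc_circ1 normrM (gtr0_norm s0) mulfK // lt0r_neq0.
Qed.

(** The domination needed to let the truncation tend to infinity. *)
Lemma shift_fun_bounded : exists B, forall N t,
  `|complex.Re (shift_fun a b c d N (circ s t))| <= B.
Proof.
exists ((s + s^-1) * (prod_bound q 1 ^+ 2 * prod_bound q 1 ^+ 2 *
  prod_bound q 1 ^+ 2 * prod_bound q 1 ^+ 2) / h_low q `|a| / h_low q `|b| /
  h_low q `|c| / h_low q `|d|) => N t.
apply: le_trans (normcRe _) _.
have n1 (u : R) : `|u| < 1 -> 0 <= normc (hfactor N (u * s) (circ s t))^-1 <= (h_low q `|u|)^-1.
  move=> u1; rewrite normc_ge0 normcV lef_pV2 ?hfactor_ge // posrE ?h_low_gt0 //.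
  exact: lt_le_trans (h_low_gt0 _ _) (hfactor_ge _ _ u1).
have n2 (u : R) : `|u| <= 1 ->
    0 <= normc (hfactor N (u * s) (circ s t)) <= prod_bound q 1 ^+ 2.
  by move=> u1; rewrite normc_ge0 hfactor_le.
have /andP[a0 al] := n1 _ ha; have /andP[b0 bl] := n1 _ hb.
have /andP[c0 cl] := n1 _ hc; have /andP[d0 dl] := n1 _ hd.
have s1' : `|s| <= 1 by rewrite ger0_norm ltW.
have /andP[e0 el] := n2 1 (ltac:(by rewrite normr1)).
have /andP[f0 fl] := n2 (-1) (ltac:(by rewrite normrN normr1)).
have /andP[g0 gl] := n2 s s1'.
have /andP[h0 hl] := n2 (- s) (ltac:(by rewrite normrN)).
rewrite mul1r in e0 el; rewrite mulN1r in f0 fl.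
move: e0 el f0 fl g0 gl h0 hl a0 al b0 bl c0 cl d0 dl; rewrite /shift_fun.
move: (hfactor N s _) (hfactor N (- s) _) (hfactor N (s * s) _) (hfactor N (- s * s) _)
  (hfactor N (a * s) _)^-1 (hfactor N (b * s) _)^-1 (hfactor N (c * s) _)^-1 (hfactor N (d * s) _)^-1.
move=> ? ? ? ? ? ? ? ? *.
rewrite !normcM !ler_pM ?mulr_ge0 ?normc_ge0 //.
apply: le_trans (le_normcD _ _) _; rewrite normcN normcV normc_circ1.
by [].
Qed.

(** On the circle of radius [sqrt q] the product telescopes to the one on the unit
    circle, up to its first and last factors. *)
Lemma hfactor_circ N (g t : R) :
  hfactor N (g * s) (circ s t) * (1 - g%:C * expi t) =
  (h_trunc q N (cos t) g)%:C * (1 - (g * q ^+ N)%:C * expi t).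
Proof.
have e0 := expi_neq0 t.
have -> : (h_trunc q N (cos t) g)%:C = qfactor N g (expi t) * qfactor N g (expi t)^-1.
  rewrite rmorph_prod /qfactor -big_split; apply: eq_bigr => k _.
  rewrite -expiN expiNJ /expi; apply/eqP; rewrite eq_complex /=.
  have := cos2Dsin2 t; move: (cos t) (sin t) => x y xy.
  rewrite mulnC exprM (_ : g ^+ 2 * _ = (g * q ^+ k) ^+ 2 * (x ^+ 2 + y ^+ 2)); last first.
    by rewrite xy; ring.
  by apply/andP; split; apply/eqP; ring.
have s0C : s%:C != 0 :> R[i] by rewrite real_complex_neq0 // lt0r_neq0.
have E1 : qfactor N (g * s) (circ s t) = qfactor N (g * q) (expi t).
  apply: eq_bigr => k _; rewrite /circ mulrA -rmorphM; congr (1 - _%:C * _).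
  by transitivity (g * (s * s) * q ^+ k); [ring|rewrite ss].
have E2 : qfactor N (g * s) (circ s t)^-1 = qfactor N g (expi t)^-1.
  apply: eq_bigr => k _; rewrite /circ invfM mulrA -fmorphV -rmorphM; congr (1 - _%:C * _).
  by field; rewrite lt0r_neq0.
rewrite /hfactor E1 E2 mulrAC [in RHS]mulrAC; congr (_ * _).
transitivity (qfactor N.+1 g (expi t)).
  rewrite /qfactor big_ord_recl expr0 mulr1 mulrC; congr (_ * _).
  by apply: eq_bigr => k _; rewrite exprS mulrA.
by rewrite /qfactor big_ord_recr.
Qed.

Lemma hfactor_cvg (g t : R) : `|g| <= 1 -> 1 - g%:C * expi t != 0 ->
  cvgC \oo (fun N => hfactor N (g * s) (circ s t))
    ((hfun q (cos t) g)%:C / (1 - g%:C * expi t)).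
Proof.
move=> g1 g0.
have -> : (fun N => hfactor N (g * s) (circ s t)) = fun N =>
    (h_trunc q N (cos t) g)%:C * (1 - (g * q ^+ N)%:C * expi t) / (1 - g%:C * expi t).
  by apply/funext => N; rewrite -hfactor_circ mulfK.
apply: cvgCM; last exact: cvgC_cst.
rewrite -[X in cvgC _ _ X]mulr1; apply: cvgCM.
  by apply: cvgC_real; exact: hfun_cvg.
rewrite -[X in cvgC _ _ X]subr0 -[X in cvgC _ _ (_ - X)](mul0r (expi t)).
apply: cvgCB; first exact: cvgC_cst.
apply: cvgCM; last exact: cvgC_cst.
apply: (@cvgC_real _ _ _ _ _ 0); apply: (@cvg_geometric R g q).
by rewrite ger0_norm // ltW.
Qed.

End AWshift.

Section AWmoment.
Variables (R : realType) (q : R) (hq : 0 < q < 1).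
Let q0 : 0 < q. Proof. by case/andP: hq. Qed.
Let q1 : q < 1. Proof. by case/andP: hq. Qed.
Local Notation s := (Num.sqrt q).
Let s0 : 0 < s. Proof. by rewrite sqrtr_gt0. Qed.
Let s1 : s < 1. Proof. by rewrite -sqrtr1 ltr_sqrt. Qed.
Let s01 : 0 < s < 1. Proof. by rewrite s0. Qed.
Variables (a b c d : R).
Hypotheses (ha : `|a| < 1) (hb : `|b| < 1) (hc : `|c| < 1) (hd : `|d| < 1).

Lemma one_minus_neq0 (g t : R) : `|g| < 1 -> 1 - g%:C * expi t != 0.
Proof.
move=> g1; apply/negP => /eqP e.
have : normc (g%:C * expi t) = 1.
  by move/eqP: e; rewrite subr_eq0 => /eqP <-; exact: normc1.
by rewrite normcM normcR normc_expi mulr1; lra.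
Qed.

Lemma sin0_expi (t : R) : sin t = 0 -> expi t = 1 \/ expi t = -1.
Proof.
move=> st; have : cos t ^+ 2 = 1 by rewrite cos2sin2 st expr0n subr0.
move/eqP; rewrite sqrf_eq1 /expi st => /orP[/eqP ->|/eqP ->]; [by left|right].
by apply/eqP; rewrite eq_complex /= oppr0 !eqxx.
Qed.

Lemma shift_fun_sin0 N (t : R) : sin t = 0 -> shift_fun q a b c d N.+1 (circ s t) = 0.
Proof.
have sC : s%:C != 0 :> R[i] by rewrite real_complex_neq0 // lt0r_neq0.
move=> /sin0_expi [] e; rewrite /shift_fun /circ e.
  suff -> : hfactor q N.+1 s (s%:C * 1) = 0 by rewrite !(mul0r, mulr0).
  by rewrite mulr1 /hfactor /qfactor [X in _ * X]big_ord_recl expr0 mulr1 mulfV // subrr mul0r mulr0.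
suff -> : hfactor q N.+1 (- s) (s%:C * -1) = 0 by rewrite !(mul0r, mulr0).
rewrite mulrN1 /hfactor /qfactor [X in _ * X]big_ord_recl expr0 mulr1.
by rewrite invrN rmorphN mulrNN mulfV // subrr mul0r mulr0.
Qed.

(** The real linear polynomial produced by the shift: with
    [A z = (1 - a z)(1 - b z)(1 - c z)(1 - d z)], the sum of [A z / (z (1 - z^2))]
    and its conjugate on the unit circle. *)
Definition shift_lin (x : R) := (1 - a * b * c * d) * (2 * x) -
  (a + b + c + d - (a * b * c + a * b * d + a * c * d + b * c * d)).

Lemma Re_shift (t : R) : sin t != 0 ->
  complex.Re ((1 - a%:C * expi t) * (1 - b%:C * expi t) * (1 - c%:C * expi t) *
    (1 - d%:C * expi t) / (expi t * (1 - expi t ^+ 2))) = shift_lin (cos t) / 2.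
Proof.
move=> st; set w := _ / _; set e := expi t in w *.
have e0 : e != 0 := expi_neq0 t.
have e2 : 1 - e ^+ 2 != 0.
  have : e^-1 - e != 0.
    rewrite -expiN expiNJ /e /expi eq_complex /= negb_and; apply/orP; right.
    by rewrite -opprD oppr_eq0 -mulr2n mulrn_eq0.
  by apply: contra => /eqP h; rewrite -(mulfK e0 (_ - _)) mulrBl mulVf // -expr2 h mul0r.
have wJ : conjc w = (1 - a%:C * e^-1) * (1 - b%:C * e^-1) * (1 - c%:C * e^-1) *
    (1 - d%:C * e^-1) / (e^-1 * (1 - e^-1 ^+ 2)).
  have cu (u : R) : conjc (1 - u%:C * e) = 1 - u%:C * e^-1.
    rewrite /e -expiN expiNJ; case: (expi t) => x y.
    by apply/eqP; rewrite eq_complex /=; apply/andP; split; apply/eqP; ring.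
  have ce : conjc e = e^-1 by rewrite /e -expiN expiNJ.
  rewrite /w !conjcM conjc_inv !conjcM !cu -ce; congr (_ / (_ * _)).
  by rewrite [in RHS]expr2 -conjcM -expr2 (rmorphB (@conjc R)) rmorph1.
have x2 : (2 * cos t)%:C = e + e^-1.
  rewrite /e -expiN expiNJ; apply/eqP; rewrite eq_complex /=.
  by apply/andP; split; apply/eqP; ring.
(* The real part is half of the sum with the conjugate, in which [1 - z^2] cancels. *)
have := addcJ w; rewrite wJ => H.
apply: (@complexI R); apply: (mulfI (_ : 2%:R != 0 :> R[i])); first by rewrite pnatr_eq0.
rewrite -H /w.
have -> : 2%:R * (shift_lin (cos t) / 2)%:C = (shift_lin (cos t))%:C.
  rewrite -(rmorph_nat (real_complex R) 2) -(rmorphM (real_complex R)).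
  by rewrite (mulrC _ (_ / 2)) divfK // pnatr_eq0.
have -> : (shift_lin (cos t))%:C = (1 - a%:C * b%:C * c%:C * d%:C) * (e + e^-1) -
   (a%:C + b%:C + c%:C + d%:C - (a%:C * b%:C * c%:C + a%:C * b%:C * d%:C +
    a%:C * c%:C * d%:C + b%:C * c%:C * d%:C)).
  by rewrite -x2 /shift_lin !(rmorphB (real_complex R), rmorphD (real_complex R),
    rmorphM (real_complex R), rmorph1 (real_complex R)).
field.
by rewrite e0 -opprB oppr_eq0 e2.
Qed.

(** Where [sin t = 0] some factors below divide by zero; there both the weight
    and the truncated function vanish. *)
Lemma shift_fun_cvg (t : R) :
  complex.Re (shift_fun q a b c d N.+1 (circ s t)) @[N --> \oo] -->
  - (2 * s)^-1 * (aw_weight q a b c d (cos t) * shift_lin (cos t)).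
Proof.
have x1 : `|cos t| <= 1 by rewrite ler_norml cos_geN1 cos_le1.
have s1' : `|s| < 1 by rewrite ger0_norm // ltW.
have [st|st] := eqVneq (sin t) 0.
  rewrite (_ : aw_weight _ _ _ _ _ _ = 0).
    by rewrite mul0r mulr0; under eq_fun do rewrite shift_fun_sin0 //; exact: cvg_cst.
  have /eqP := cos2Dsin2 t; rewrite st expr0n addr0 => /eqP e.
  by rewrite /aw_weight hnumE // e subrr mulr0 !mul0r.
have p1 : 1 - 1%:C * expi t != 0.
  rewrite /expi eq_complex /= negb_and; apply/orP; right.
  by rewrite mul0r addr0 mul1r sub0r oppr_eq0.
have p2 : 1 - (-1)%:C * expi t != 0.
  rewrite /expi eq_complex /= negb_and; apply/orP; right.
  by rewrite mul0r addr0 mulN1r opprK add0r.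
have p3 := one_minus_neq0 t s1'.
have p4 : 1 - (- s)%:C * expi t != 0 by apply: one_minus_neq0; rewrite normrN.
have pa := one_minus_neq0 t ha; have pb := one_minus_neq0 t hb.
have pc := one_minus_neq0 t hc; have pd := one_minus_neq0 t hd.
have hn u : `|u| < 1 -> (hfun q (cos t) u)%:C != 0.
  by move=> u1; rewrite real_complex_neq0 // lt0r_neq0 // hfun_gt0.
have n1 : `|1 : R| <= 1 by rewrite normr1.
have n2 : `|-1 : R| <= 1 by rewrite normrN normr1.
have n4 : `|- s| <= 1 by rewrite normrN ltW.
have l1 := hfactor_cvg hq n1 p1.
have l2 := hfactor_cvg hq n2 p2.
have l3 := hfactor_cvg hq (ltW s1') p3.
have l4 := hfactor_cvg hq n4 p4.
have la := hfactor_cvg hq (ltW ha) pa; have lb := hfactor_cvg hq (ltW hb) pb.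
have lc := hfactor_cvg hq (ltW hc) pc; have ld := hfactor_cvg hq (ltW hd) pd.
rewrite mul1r in l1; rewrite mulN1r in l2.
have inv0 u : `|u| < 1 -> (hfun q (cos t) u)%:C / (1 - u%:C * expi t) != 0.
  by move=> u1; rewrite mulf_neq0 ?invr_neq0 ?hn ?one_minus_neq0.
have := cvgCM _ (cvgCM _ (cvgCM _ (cvgCM _ (cvgCM _
  (cvgC_cst _ (circ s t - (circ s t)^-1)) (cvgCM _ (cvgCM _ (cvgCM _ l1 l2) l3) l4))
  (cvgCV _ (inv0 _ ha) la)) (cvgCV _ (inv0 _ hb) lb)) (cvgCV _ (inv0 _ hc) lc))
  (cvgCV _ (inv0 _ hd) ld).
set L := (X in cvgC _ _ X) => LC.
have LRe : complex.Re L = - (2 * s)^-1 * (aw_weight q a b c d (cos t) * shift_lin (cos t)).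
  have -> : L = (- s^-1 * aw_weight q a b c d (cos t))%:C *
     ((1 - a%:C * expi t) * (1 - b%:C * expi t) * (1 - c%:C * expi t) *
     (1 - d%:C * expi t) / (expi t * (1 - expi t ^+ 2))).
    have e0 := expi_neq0 t; have sC : s%:C != 0 :> R[i].
      by rewrite real_complex_neq0 // lt0r_neq0.
    rewrite /L /aw_weight /hnum.
    have := hn _ ha; have := hn _ hb; have := hn _ hc; have := hn _ hd.
    move: (hfun q _ _) (hfun q _ _) (hfun q _ _) (hfun q _ _) (hfun q _ _)
      (hfun q _ _) (hfun q _ _) (hfun q _ _) => h1 h2 h3 h4 h5 h6 h7 h8.
    move=> n8 n7 n6 n5.
    have e21 : 1 - expi t ^+ 2 != 0.
      move: p1 p2; rewrite (_ : (-1)%:C = -1 :> R[i]); last first.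
        by apply/eqP; rewrite eq_complex /= oppr0 !eqxx.
      rewrite mul1r mulN1r opprK => p1 p2.
      by rewrite -[X in X - _](expr1n _ 2) subr_sqr mulf_neq0.
    have c1 : 1%:C = 1 :> R[i] by [].
    rewrite !(real_complexM, real_complexN, real_complexV, c1) /circ in p1 p2 p4 *.
    move: p1 p2 p3 p4 pa pb pc pd e0 sC e21 n5 n6 n7 n8.
    move: (expi t) (s%:C) a%:C b%:C c%:C d%:C h1%:C h2%:C h3%:C h4%:C h5%:C h6%:C h7%:C h8%:C.
    move=> e S A B C D k1 k2 k3 k4 k5 k6 k7 k8 p1 p2 p3 p4 pa pb pc pd e0 sC e21 n5 n6 n7 n8.
    rewrite mul1r in p1; field.
    by rewrite e21 e0 n8 n7 n6 n5 sC pd pc pb pa p4 p3 p2 p1.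
  case E : (_ / _) => [x y]; have := Re_shift st; rewrite E /= => ->.
  by rewrite mul0r subr0 invfM; ring.
rewrite -LRe; case: LC => + _.
by rewrite -(cvg_shiftS (fun N => complex.Re _)).
Qed.

Lemma aw_weight_cont : continuous (fun t => aw_weight q a b c d (cos t)).
Proof.
have hcos u : `|u| <= 1 -> continuous (fun t => hfun q (cos t) u).
  move=> u1 t; apply: (@continuous_comp _ _ _ cos (hfun q ^~ u)).
    exact: continuous_cos.
  exact: hfun_cont.
have s1' : `|s| <= 1 by rewrite ger0_norm ltW.
have n1 : `|1 : R| <= 1 by rewrite normr1.
have n2 : `|-1 : R| <= 1 by rewrite normrN normr1.
have n4 : `|- s| <= 1 by rewrite normrN.
have x1 t : `|cos t| <= 1 :> R by rewrite ler_norml cos_geN1 cos_le1.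
move=> t; apply: cvgM.
  by do 3!(apply: cvgM; last exact: hcos); exact: hcos.
apply: cvgV; first by rewrite !mulf_neq0 // lt0r_neq0 // hfun_gt0.
by do 3!(apply: cvgM; last by apply: hcos; exact: ltW); apply: hcos; exact: ltW.
Qed.

(** The limit of [int0pi_shift_fun]: a linear relation between the first moment
    and the total mass of the weight. *)
Lemma first_moment : int0pi (fun t => aw_weight q a b c d (cos t) * shift_lin (cos t)) = 0.
Proof.
have sc : continuous (fun t : R => shift_lin (cos t)).
  move=> t; apply: cvgB; last exact: cvg_cst.
  apply: cvgM; first exact: cvg_cst.
  by apply: cvgM; [exact: cvg_cst|exact: continuous_cos].
have vc : continuous (fun t => aw_weight q a b c d (cos t) * shift_lin (cos t)).
  by move=> t; apply: cvgM; [exact: aw_weight_cont|exact: sc].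
have [B FB] := shift_fun_bounded hq ha hb hc hd.
have FS N := shift_invariant_shift_fun hq ha hb hc hd N.
have := @int0pi_cvg R (fun N t => complex.Re (shift_fun q a b c d N.+1 (circ s t)))
  (fun t => - (2 * s)^-1 * (aw_weight q a b c d (cos t) * shift_lin (cos t))) B.
have rs : two_radii s s by left.
move=> /(_ (fun N t => proj1 (shift_cont (FS N.+1) rs t))).
have vc' : continuous (fun t => - (2 * s)^-1 * (aw_weight q a b c d (cos t) * shift_lin (cos t))).
  by move=> t; apply: cvgM; [exact: cvg_cst|exact: vc].
move=> /(_ vc' (fun n t => FB _ _) shift_fun_cvg).
under eq_fun do rewrite int0pi_shift_fun //.
rewrite int0piZ // => /(cvg_unique (@norm_hausdorff _ _) (@cvg_cst _ _ _ _ _)) /esym/eqP.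
rewrite mulf_eq0 oppr_eq0 invr_eq0 mulf_eq0 pnatr_eq0 /= (gt_eqF s0) /=.
by move/eqP.
Qed.

End AWmoment.

(** * Infinite q-shifted factorials *)

Section qpoch_inf.
Variables (R : realType) (q : R) (hq : 0 < q < 1).
Let q0 : 0 < q. Proof. by case/andP: hq. Qed.
Let q1 : q < 1. Proof. by case/andP: hq. Qed.
Let qX_ge0 k : 0 <= q ^+ k. Proof. by rewrite exprn_ge0 // ltW. Qed.
Let qX_le1 k : q ^+ k <= 1. Proof. by rewrite exprn_ile1 // ltW. Qed.

Lemma qpoch_inf_approxC (z : R[i]) :
  cvgC \oo (fun n => qpoch z q%:C n) (qpoch_inf z q%:C) /\
  forall n, normc (qpoch_inf z q%:C - qpoch z q%:C n) <=
    2 * (prod_bound q (normc z) * normc z / (1 - q)) * q ^+ n.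
Proof.
have [|l [lc lb]] := prod1D_cvg hq (M := normc z) (u := fun k => - (z * q%:C ^+ k)).
  move=> k; rewrite normcN normcM normcX normcR ger0_norm // ltW //.
suff -> : qpoch_inf z q%:C = l by [].
exact: (@lim_complex R nat \oo _ (fun n => qpoch z q%:C n) l lc.1 lc.2).
Qed.

Lemma qpochC (a : R) n : qpoch a%:C q%:C n = (qpoch a q n)%:C.
Proof.
rewrite /qpoch (rmorph_prod (real_complex R)); apply: eq_bigr => k _.
by rewrite (rmorphB (real_complex R)) (rmorphM (real_complex R)) (rmorphXn (real_complex R)).
Qed.

Lemma qpoch_inf_cvg (a : R) : qpoch a q n @[n --> \oo] --> qpoch_inf a q.
Proof.
have [[h _] _] := qpoch_inf_approxC a%:C.
have h' : qpoch a q n @[n --> \oo] --> complex.Re (qpoch_inf a%:C q%:C).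
  by move: h; under eq_fun do rewrite qpochC.
by rewrite (_ : qpoch_inf a q = complex.Re (qpoch_inf a%:C q%:C)) //; exact: cvg_lim h'.
Qed.

Lemma Re_qpoch_inf (a : R) : complex.Re (qpoch_inf a%:C q%:C) = qpoch_inf a q.
Proof.
have [[h _] _] := qpoch_inf_approxC a%:C.
apply/esym; apply: cvg_lim => //.
by move: h; under eq_fun do rewrite qpochC.
Qed.

Lemma qpoch_inf_near1 (a : R) : `|a| <= 1 ->
  `|qpoch_inf a q - 1| <= 2 * (prod_bound q 1 / (1 - q)) * `|a|.
Proof.
move=> a1; have [_ /(_ 0)] := qpoch_inf_approxC a%:C.
rewrite /qpoch big_ord0 expr0 mulr1 normcR => h.
rewrite -Re_qpoch_inf; apply: (@le_trans _ _ (normc (qpoch_inf a%:C q%:C - 1))).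
  by apply: le_trans (normcRe _); rewrite raddfB.
apply: le_trans h _; rewrite -[leRHS]mulrA ler_wpM2l // mulrAC ler_wpM2r //.
rewrite ler_wpM2r ?invr_ge0 ?subr_ge0 ?(ltW q1) // prod_bound_le //.
Qed.

Lemma qpoch_inf0 : qpoch_inf (0 : R) q = 1.
Proof.
have := @qpoch_inf_near1 0; rewrite normr0 mulr0 => /(_ ler01).
by rewrite normr_le0 subr_eq0 => /eqP.
Qed.

Lemma qpochD (K : numFieldType) (a p : K) m n :
  qpoch a p (m + n) = qpoch a p m * qpoch (a * p ^+ m) p n.
Proof.
rewrite /qpoch big_split_ord; congr (_ * _).
by apply: eq_bigr => k _; rewrite exprD mulrA.
Qed.

Lemma qpochS (K : numFieldType) (a p : K) n :
  qpoch a p n.+1 = qpoch a p n * (1 - a * p ^+ n).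
Proof. by rewrite /qpoch big_ord_recr. Qed.

Lemma qpoch_infD (a : R) m : qpoch_inf a q = qpoch a q m * qpoch_inf (a * q ^+ m) q.
Proof.
have h : qpoch a q (n + m)%N @[n --> \oo] --> qpoch_inf a q.
  by rewrite (cvg_shiftn m (fun n => qpoch a q n)); exact: qpoch_inf_cvg.
have h' : qpoch a q (n + m)%N @[n --> \oo] --> qpoch a q m * qpoch_inf (a * q ^+ m) q.
  under eq_fun do rewrite addnC qpochD.
  by apply: cvgM; [exact: cvg_cst|exact: qpoch_inf_cvg].
by rewrite -(cvg_lim _ h) // -(cvg_lim _ h').
Qed.

Lemma qpoch_gt0 (a : R) n : `|a| < 1 -> 0 < qpoch a q n.
Proof.
move=> a1; apply: prodr_gt0 => k _; rewrite subr_gt0.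
apply: le_lt_trans (ler_norm _) _; apply: le_lt_trans a1.
by rewrite normrM ler_piMr // ger0_norm.
Qed.

Lemma qpoch_inf_gt0 (a : R) : `|a| < 1 -> 0 < qpoch_inf a q.
Proof.
move=> a1; have p0 : 0 < (prod_bound q (`|a| / (1 - `|a|)))^-1 by rewrite invr_gt0 prod_bound_gt0.
apply: (lt_le_trans p0); apply: (cvgr_to_ge (@qpoch_inf_cvg a)); near=> n.
have a1' : 0 <= `|a| < 1 by rewrite normr_ge0.
apply: le_trans (prod1B_lower hq n a1') _.
apply: ler_prod => k _; apply/andP; split.
  by rewrite subr_ge0 mulr_ile1 // ltW.
by rewrite lerD2l lerN2 ler_wpM2r // ler_norm.
Unshelve. all: by end_near. Qed.

(** Euler's product identity, from splitting the factors of [(q; q)_oo] by the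
    parity of the exponent. *)
Lemma qpoch_inf_euler :
  qpoch_inf (Num.sqrt q) q * qpoch_inf (- Num.sqrt q) q * qpoch_inf (- q) q = 1.
Proof.
have qq : Num.sqrt q ^+ 2 = q by rewrite sqr_sqrtr // ltW.
have E N : qpoch q q (N * 2)%N = qpoch (Num.sqrt q) q N * qpoch (- Num.sqrt q) q N *
    (qpoch q q N * qpoch (- q) q N).
  elim: N => [|N ih]; first by rewrite /qpoch !big_ord0 !mul1r.
  rewrite mulSn add2n !qpochS ih (exprS q (N * 2)) exprM.
  have sQ : 1 - q * (q ^+ N) ^+ 2 =
      (1 - Num.sqrt q * q ^+ N) * (1 - - Num.sqrt q * q ^+ N).
    by transitivity (1 - Num.sqrt q ^+ 2 * (q ^+ N) ^+ 2); [rewrite qq|ring].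
  by rewrite sQ; ring.
have h1 : qpoch q q (N * 2)%N @[N --> \oo] --> qpoch_inf q q.
  apply: (cvg_comp _ _ _ (@qpoch_inf_cvg q)).
  apply/cvgnyPge => A; near=> n; rewrite (@leq_trans n) ?leq_pmulr //.
  by near: n; exact: nbhs_infty_ge.
have h2 : qpoch q q (N * 2)%N @[N --> \oo] --> qpoch_inf (Num.sqrt q) q *
    qpoch_inf (- Num.sqrt q) q * (qpoch_inf q q * qpoch_inf (- q) q).
  by under eq_fun do rewrite E; apply: cvgM; apply: cvgM; exact: qpoch_inf_cvg.
have n0 : qpoch_inf q q != 0 by rewrite lt0r_neq0 // qpoch_inf_gt0 // gtr0_norm.
apply: (mulfI n0); rewrite mulr1 -[RHS](cvg_lim _ h1) // (cvg_lim _ h2) //; ring.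
Unshelve. all: by end_near. Qed.

End qpoch_inf.

(** * The Askey-Wilson functional and its total mass *)

Section functional.
Variables (R : realType) (q : R) (hq : 0 < q < 1).
Local Notation s := (Num.sqrt q).
Implicit Types (a b c d : R) (P Q : {poly R}).

Definition aw_int a b c d Q : R :=
  int0pi (fun t => aw_weight q a b c d (cos t) * Q.[cos t]).

Lemma aw_intE a b c d Q :
  aw_int a b c d Q = int0pi (fun t => aw_weight q a b c d (cos t) * Q.[cos t]).
Proof. by []. Qed.

Lemma horner_cos_cont Q : continuous (fun t : R => Q.[cos t]).
Proof.
move=> t; apply: (@continuous_comp _ _ _ cos (fun x => Q.[x])).
  exact: continuous_cos.
exact: continuous_horner.
Qed.

Section fixed_parameters.
Variables (a b c d : R).
Hypotheses (ha : `|a| < 1) (hb : `|b| < 1) (hc : `|c| < 1) (hd : `|d| < 1).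

Let vQ_cont Q : continuous (fun t => aw_weight q a b c d (cos t) * Q.[cos t]).
Proof. by move=> t; apply: cvgM; [exact: aw_weight_cont|exact: horner_cos_cont]. Qed.

Lemma aw_intD P Q : aw_int a b c d (P + Q) = aw_int a b c d P + aw_int a b c d Q.
Proof.
by rewrite /aw_int -int0piD //; apply: int0pi_ext => t; rewrite hornerD mulrDr.
Qed.

Lemma aw_intZ (k : R) Q : aw_int a b c d (k *: Q) = k * aw_int a b c d Q.
Proof.
by rewrite /aw_int -int0piZ //; apply: int0pi_ext => t; rewrite hornerZ mulrCA.
Qed.

Lemma aw_int0 : aw_int a b c d 0 = 0.
Proof. by rewrite -(scale0r 0) aw_intZ mul0r. Qed.

Lemma aw_intB P Q : aw_int a b c d (P - Q) = aw_int a b c d P - aw_int a b c d Q.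
Proof. by rewrite -scaleN1r aw_intD aw_intZ mulN1r. Qed.

Lemma aw_int_sum (I : Type) (r : seq I) (p : pred I) (F : I -> {poly R}) :
  aw_int a b c d (\sum_(i <- r | p i) F i) = \sum_(i <- r | p i) aw_int a b c d (F i).
Proof. exact: (big_morph _ aw_intD aw_int0). Qed.

Lemma aw_int_first_moment : (1 - a * b * c * d) * aw_int a b c d (2 *: 'X) =
  (a + b + c + d - (a * b * c + a * b * d + a * c * d + b * c * d)) *
  aw_int a b c d 1.
Proof.
apply/eqP; rewrite -subr_eq0 -!aw_intZ -aw_intB.
apply/eqP; rewrite -[RHS](first_moment hq ha hb hc hd); apply: int0pi_ext => t.
by rewrite /shift_lin !hornerE.
Qed.

End fixed_parameters.

Lemma aw_intC12 a b c d Q : aw_int a b c d Q = aw_int b a c d Q.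
Proof. by apply: int0pi_ext => t; congr (hnum _ _ / _ * _); ring. Qed.

Lemma aw_intC23 a b c d Q : aw_int a b c d Q = aw_int a c b d Q.
Proof. by apply: int0pi_ext => t; congr (hnum _ _ / _ * _); ring. Qed.

Lemma aw_intC34 a b c d Q : aw_int a b c d Q = aw_int a b d c Q.
Proof. by apply: int0pi_ext => t; congr (hnum _ _ / _ * _); ring. Qed.

Let cos1 t : `|cos t| <= 1 :> R.
Proof. by rewrite ler_norml cos_geN1 cos_le1. Qed.

(** The first factor of h(x, a), as a polynomial in x. *)
Definition h_quad a : {poly R} := (1 + a ^+ 2)%:P - (2 * a) *: 'X.

(** Shifting a parameter by q multiplies the weight by the first factor of h. *)
Lemma aw_int_shift a b c d Q : `|a| < 1 ->
  aw_int (a * q) b c d Q = aw_int a b c d (h_quad a * Q).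
Proof.
move=> ha; apply: int0pi_ext => t; rewrite hornerM /h_quad !hornerE /=; congr (_ * _).
have n0 : 1 + a ^+ 2 - 2 * a * cos t != 0.
  have := hfun_gt0 hq ha (cos1 t); rewrite (hfun_rec hq _ (ltW ha)).
  by rewrite (_ : 1 - _ + _ = 1 + a ^+ 2 - 2 * a * cos t); [case: eqP => // ->; rewrite mul0r ltxx|ring].
rewrite /aw_weight (hfun_rec hq _ (ltW ha)).
rewrite (_ : 1 - _ + _ = 1 + a ^+ 2 - 2 * a * cos t); last by ring.
rewrite (_ : (1 + a ^+ 2 - 2 * a * cos t) *
  hfun q (cos t) (a * q) * hfun q (cos t) b * hfun q (cos t) c * hfun q (cos t) d =
  (1 + a ^+ 2 - 2 * a * cos t) *
  (hfun q (cos t) (a * q) * hfun q (cos t) b * hfun q (cos t) c * hfun q (cos t) d));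
  last by ring.
move: (hfun q (cos t) (a * q) * _ * _ * _) => Y.
by rewrite invfM; move: Y^-1 => iY; field.
Qed.

Lemma int0pi_le f g : continuous f -> continuous g -> (forall t : R, f t <= g t) ->
  int0pi f <= int0pi g.
Proof. by move=> cf cg fg; apply: le_Rintegral => //; exact: integrable0pi. Qed.

(** Because [|1 / h(x, a) - 1| = O(a)] uniformly for x in [-1, 1]. *)
Lemma aw_int_lipschitz0 b c d Q (rho : R) : `|b| < 1 -> `|c| < 1 -> `|d| < 1 ->
  rho < 1 -> exists K, forall a, `|a| <= rho ->
    `|aw_int a b c d Q - aw_int 0 b c d Q| <= `|a| * K.
Proof.
move=> hb hc hd r1; have n0 : `|0 : R| < 1 by rewrite normr0.
pose g t := `|aw_weight q 0 b c d (cos t) * Q.[cos t]|.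
have v0 : continuous (fun t => aw_weight q 0 b c d (cos t) * Q.[cos t]).
  by move=> t; apply: cvgM; [exact: aw_weight_cont|exact: horner_cos_cont].
have gc : continuous g by move=> t; apply: cvg_norm; exact: v0.
exists (h_rate q 1 / h_low q rho * int0pi g) => a ar.
have ha : `|a| < 1 by apply: le_lt_trans ar r1.
have va : continuous (fun t => aw_weight q a b c d (cos t) * Q.[cos t]).
  by move=> t; apply: cvgM; [exact: aw_weight_cont|exact: horner_cos_cont].
rewrite /aw_int -int0piB // mulrA -int0piZ //.
have dc : continuous (fun t => aw_weight q a b c d (cos t) * Q.[cos t] - aw_weight q 0 b c d (cos t) * Q.[cos t]).
  by move=> t; apply: cvgB; [exact: va|exact: v0].
apply: le_trans (le_normr_Rintegral _ _) _ => //; first exact: integrable0pi.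
apply: int0pi_le.
- by move=> t; apply: cvg_norm; exact: dc.
- by move=> t; apply: cvgM; [exact: cvg_cst|exact: gc].
move=> t; have hp := hfun_gt0 hq ha (cos1 t).
have -> : aw_weight q a b c d (cos t) * Q.[cos t] - aw_weight q 0 b c d (cos t) * Q.[cos t] =
   (1 - hfun q (cos t) a) / hfun q (cos t) a * (aw_weight q 0 b c d (cos t) * Q.[cos t]).
  rewrite /aw_weight hfun0 //; field.
  by rewrite !lt0r_neq0 // hfun_gt0.
rewrite normrM ler_wpM2r // normrM distrC mulrA ler_pM //.
  exact: hfun_near1 (ltW ha) (cos1 t).
rewrite normfV gtr0_norm // lef_pV2 ?posrE ?h_low_gt0 //.
exact: hfun_ge ar r1 (cos1 t).
Qed.

Lemma aw_int_cvg0 b c d Q (u : nat -> R) (rho : R) : `|b| < 1 -> `|c| < 1 -> `|d| < 1 ->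
  rho < 1 -> (forall n, `|u n| <= rho) -> u n @[n --> \oo] --> 0 ->
  aw_int (u n) b c d Q @[n --> \oo] --> aw_int 0 b c d Q.
Proof.
move=> hb hc hd r1 ur u0; have [K uK] := aw_int_lipschitz0 Q hb hc hd r1.
apply/subr_cvg0/norm_cvg0P.
apply: (@squeeze_cvgr _ _ _ _ (fun=> 0) (fun n => `|u n| * K)).
- by near=> n; rewrite normr_ge0 uK.
- exact: cvg_cst.
- rewrite -(mul0r K); apply: cvgM; last exact: cvg_cst.
  by rewrite -(normr0 R); apply: cvg_norm.
Unshelve. all: by end_near. Qed.

End functional.

(* Unification must not unfold the integral when comparing two parameter lists. *)
Opaque aw_int.

Section total_mass.
Variables (R : realType) (q : R) (hq : 0 < q < 1).
Let q0 : 0 < q. Proof. by case/andP: hq. Qed.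
Let q1 : q < 1. Proof. by case/andP: hq. Qed.
Let qX_ge0 k : 0 <= q ^+ k. Proof. by rewrite exprn_ge0 // ltW. Qed.
Let qX_le1 k : q ^+ k <= 1. Proof. by rewrite exprn_ile1 // ltW. Qed.
Implicit Types (a b c d : R).
Local Notation E := (aw_int q).
Local Notation "[ a ]_oo" := (qpoch_inf a q).

Lemma normr_lt1M a b : `|a| < 1 -> `|b| < 1 -> `|a * b| < 1.
Proof. by move=> a1 b1; rewrite normrM mulr_ilt1. Qed.

Lemma normr_lt1qX a n : `|a| < 1 -> `|a * q ^+ n| < 1.
Proof.
move=> a1; apply: le_lt_trans a1; by rewrite normrM (ger0_norm (qX_ge0 n)) ler_piMr.
Qed.

(** By [aw_int_shift] the integral on the left is that of [h_quad a], which has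
    degree one in x: this is [aw_int_first_moment] rewritten. *)
Lemma aw_mass_shift a b c d : `|a| < 1 -> `|b| < 1 -> `|c| < 1 -> `|d| < 1 ->
  (1 - a * b * c * d) * E (a * q) b c d 1 =
  (1 - a * b) * (1 - a * c) * (1 - a * d) * E a b c d 1.
Proof.
move=> ha hb hc hd; rewrite aw_int_shift // mulr1.
have -> : h_quad a = (1 + a ^+ 2) *: 1 - a *: (2 *: 'X).
  by rewrite /h_quad scalerA (mulrC a) alg_polyC.
have fm := aw_int_first_moment hq ha hb hc hd; rewrite aw_intZ // in fm.
rewrite aw_intB // !aw_intZ //.
transitivity ((1 - a * b * c * d) * (1 + a ^+ 2) * E a b c d 1 -
  a * ((1 - a * b * c * d) * (2 * E a b c d 'X))); first by ring.
by rewrite fm; ring.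
Qed.

Lemma aw_mass_shiftn n a b c d : `|a| < 1 -> `|b| < 1 -> `|c| < 1 -> `|d| < 1 ->
  qpoch (a * b * c * d) q n * E (a * q ^+ n) b c d 1 =
  qpoch (a * b) q n * qpoch (a * c) q n * qpoch (a * d) q n * E a b c d 1.
Proof.
move=> ha hb hc hd; elim: n => [|n ih].
  by rewrite /qpoch !big_ord0 expr0 !mulr1 !mul1r.
have := aw_mass_shift (normr_lt1qX n ha) hb hc hd.
rewrite !qpochS exprSr mulrA.
rewrite (_ : a * q ^+ n * b * c * d = a * b * c * d * q ^+ n); last by ring.
move=> h; rewrite -mulrA h mulrCA ih.
ring.
Qed.

(** The recursion [aw_mass_shift] iterated to [a q^n -> 0]. *)
Lemma aw_mass_to0 a b c d : `|a| < 1 -> `|b| < 1 -> `|c| < 1 -> `|d| < 1 ->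
  [a * b * c * d]_oo * E 0 b c d 1 =
  [a * b]_oo * [a * c]_oo * [a * d]_oo * E a b c d 1.
Proof.
move=> ha hb hc hd.
have h1 : qpoch (a * b * c * d) q n * E (a * q ^+ n) b c d 1 @[n --> \oo] -->
    [a * b * c * d]_oo * E 0 b c d 1.
  apply: cvgM; first exact: qpoch_inf_cvg.
  apply: (@aw_int_cvg0 _ _ hq b c d 1 (fun n => a * q ^+ n) `|a|) => // [n|].
    by rewrite normrM (ger0_norm (qX_ge0 n)) ler_piMr.
  by apply: (@cvg_geometric R a q); rewrite gtr0_norm.
have h2 : qpoch (a * b * c * d) q n * E (a * q ^+ n) b c d 1 @[n --> \oo] -->
    [a * b]_oo * [a * c]_oo * [a * d]_oo * E a b c d 1.
  under eq_fun do rewrite aw_mass_shiftn //.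
  by apply: cvgM; [do 2?apply: cvgM; exact: qpoch_inf_cvg|exact: cvg_cst].
exact: (cvg_unique (@norm_hausdorff _ _) h1 h2).
Qed.

(** Each of the four parameters is sent to 0 in turn. *)
Lemma aw_mass_ratio a b c d : `|a| < 1 -> `|b| < 1 -> `|c| < 1 -> `|d| < 1 ->
  [a * b * c * d]_oo * E 0 0 0 0 1 =
  [a * b]_oo * [a * c]_oo * [a * d]_oo * [b * c]_oo * [b * d]_oo * [c * d]_oo *
  E a b c d 1.
Proof.
move=> ha hb hc hd; have n0 : `|0 : R| < 1 by rewrite normr0.
have h1 := aw_mass_to0 hb n0 hc hd.
have h2 := aw_mass_to0 hc n0 n0 hd.
have h3 := aw_mass_to0 hd n0 n0 n0.
rewrite !(mulr0, mul0r, qpoch_inf0 hq, mul1r) in h1 h2 h3.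
rewrite h3 (_ : E d 0 0 0 1 = E 0 0 0 d 1); last first.
  by rewrite aw_intC12 aw_intC23 aw_intC34.
rewrite h2 (_ : E c 0 0 d 1 = E 0 0 c d 1); last by rewrite aw_intC12 aw_intC23.
rewrite h1 (_ : E b 0 c d 1 = E 0 b c d 1); last by rewrite aw_intC12.
transitivity ([b * c]_oo * [b * d]_oo * [c * d]_oo *
  ([a * b * c * d]_oo * E 0 b c d 1)); first by ring.
rewrite aw_mass_to0 //; ring.
Qed.

(** With parameters [q, -q, sqrt q, - sqrt q] the weight collapses to
    [4 sin ^ 2], which fixes the constant. *)
Lemma aw_mass_trig : E q (- q) (Num.sqrt q) (- Num.sqrt q) 1 = 2 * pi.
Proof.
have sq : 0 < Num.sqrt q < 1 by rewrite sqrtr_gt0 q0 -sqrtr1 ltr_sqrt.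
case/andP: sq => s0 s1.
have cc : continuous (fun t : R => cos (2%:~R * t)).
  by move=> t; apply: continuous_comp; [exact: mulrl_continuous|exact: continuous_cos].
rewrite aw_intE (int0pi_ext (g := fun t => 2 - 2 * cos (2%:~R * t))).
  rewrite int0piB ?int0piZ ?int0pi_cos ?int0pi_cst ?mulr0 ?subr0 //.
    by move=> t; exact: cvg_cst.
  by move=> t; apply: cvgM; [exact: cvg_cst|exact: cc].
move=> t; have x1 : `|cos t| <= 1 :> R by rewrite ler_norml cos_geN1 cos_le1.
rewrite hornerE mulr1 /aw_weight hnumE // mulfK; last first.
  by rewrite !mulf_neq0 // lt0r_neq0 // hfun_gt0 // ?normrN gtr0_norm.
rewrite (_ : 2%:~R * t = t *+ 2); last by rewrite -[2%:~R]/(2%:R) mulr_natl.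
by rewrite cos_mulr2n; ring.
Qed.

(** [aw_mass_ratio] at the parameters of [aw_mass_trig]; after splitting off first
    factors, the products on the right are the square of those in
    [qpoch_inf_euler]. *)
Lemma aw_mass0 : E 0 0 0 0 1 * [q]_oo = 2 * pi.
Proof.
set s := Num.sqrt q.
have ss : s * s = q by rewrite -expr2 sqr_sqrtr // ltW.
have s0 : 0 < s by rewrite sqrtr_gt0.
have s1 : s < 1 by rewrite -sqrtr1 ltr_sqrt.
have nq : `|q| < 1 by rewrite gtr0_norm.
have ns : `|s| < 1 by rewrite gtr0_norm.
have := @aw_mass_ratio q (- q) s (- s).
rewrite !normrN aw_mass_trig => /(_ nq nq ns ns).
have rec a : [a]_oo = (1 - a) * [a * q]_oo.
  by rewrite (qpoch_infD hq a 1) /qpoch big_ord1 expr0 expr1 mulr1.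
have eu := qpoch_inf_euler hq; rewrite -/s in eu.
have rq := rec q; have rqq := rec (q * q).
have rN := rec (- q); have rs := rec s; have rsN := rec (- s).
rewrite (_ : q * - q * s * - s = q * q * q); last first.
  by transitivity (q * q * (s * s)); [ring|rewrite ss].
rewrite (_ : q * - q = - q * q); last by ring.
rewrite (_ : q * - s = - s * q); last by ring.
rewrite (_ : q * s = s * q); last by ring.
rewrite (_ : - q * s = - s * q); last by ring.
rewrite (_ : - q * - s = s * q); last by ring.
rewrite (_ : s * - s = - q); last by rewrite mulrN ss.
move=> h.
(* Multiplying by [(1 - q)(1 - q^2)] turns [(q^3)_oo] into [(q)_oo]. *)
have q2 : (1 - s) * (1 + s) = 1 - q by rewrite -ss; ring.
rewrite opprK in rN; rewrite opprK in rsN.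
rewrite rq rqq.
transitivity ((1 - q) * (1 - q * q) * ([q * q * q]_oo * E 0 0 0 0 1)); first by ring.
rewrite h.
transitivity (2 * pi * ((1 - s) * [s * q]_oo * ((1 + s) * [- s * q]_oo) *
  ((1 + q) * [- q * q]_oo)) * ((1 - s) * [s * q]_oo * ((1 + s) * [- s * q]_oo) *
  [- q]_oo)).
  rewrite (_ : 1 - q * q = (1 - q) * (1 + q)); last by ring.
  by rewrite -q2; ring.
by rewrite -rs -rsN -rN eu !mulr1.
Qed.

Theorem aw_integral a b c d : `|a| < 1 -> `|b| < 1 -> `|c| < 1 -> `|d| < 1 ->
  E a b c d 1 = 2 * pi * [a * b * c * d]_oo /
   ([q]_oo * ([a * b]_oo * [a * c]_oo * [a * d]_oo * [b * c]_oo * [b * d]_oo *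
    [c * d]_oo)).
Proof.
move=> ha hb hc hd; rewrite -aw_mass0.
have n0 x y : `|x| < 1 -> `|y| < 1 -> [x * y]_oo != 0.
  by move=> x1 y1; rewrite lt0r_neq0 // qpoch_inf_gt0 // normr_lt1M.
have nq : [q]_oo != 0 by rewrite lt0r_neq0 // qpoch_inf_gt0 // gtr0_norm.
set D := [q]_oo * _; have D0 : D != 0 by rewrite !mulf_neq0 // n0.
apply: (mulIf D0); rewrite divfK // /D {D D0}.
transitivity ([q]_oo * ([a * b]_oo * [a * c]_oo * [a * d]_oo * [b * c]_oo *
   [b * d]_oo * [c * d]_oo * E a b c d 1)); first by ring.
by rewrite -aw_mass_ratio //; ring.
Qed.

End total_mass.

(** * Terminating q-series as q-differences *)

Section qdiff.
Variables (R : realType) (q : R) (hq : 0 < q < 1).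
Let q0 : 0 < q. Proof. by case/andP: hq. Qed.
Let q1 : q < 1. Proof. by case/andP: hq. Qed.
Let qn0 : q != 0. Proof. exact: lt0r_neq0. Qed.

(** The operator [prod_(i < n) (1 - q^(-i) S)] at 0, where [S] shifts the argument of
    [f] by one; [f k] stands for the value at [q^k] of a function of one variable.
    The explicit form is the one met in terminating q-series. *)
Definition qdiff n (f : nat -> R) : R :=
  \sum_(k < n.+1) qpoch (q ^- n) q k / qpoch q q k * q ^+ k * f k.

Lemma qpoch_qq_neq0 n : qpoch q q n != 0.
Proof. by rewrite lt0r_neq0 // qpoch_gt0 // gtr0_norm. Qed.

Lemma qpochSl (a : R) n : qpoch a q n.+1 = (1 - a) * qpoch (a * q) q n.
Proof.
rewrite /qpoch big_ord_recl expr0 mulr1; congr (_ * _).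
by apply: eq_bigr => i _; rewrite exprS mulrA.
Qed.

Lemma qpoch_qN_eq0 n : qpoch (q ^- n) q n.+1 = 0.
Proof. by rewrite qpochS mulVf ?expf_neq0 // subrr mulr0. Qed.

(** Summation by parts: [qdiff n.+1] of [f] is [qdiff n] of the q-derivative
    of [f]. *)
Lemma qdiff_parts n f g : (forall k, f k - f k.+1 = q ^+ k * g k) ->
  qdiff n.+1 f = qdiff n g.
Proof.
move=> fg; pose e k := qpoch (q ^- n) q k / qpoch q q k.
have ek k : qpoch (q ^- n.+1) q k.+1 / qpoch q q k.+1 * q ^+ k.+1 = e k.+1 - e k.
  have qN' : q ^- n.+1 * q = q ^- n by rewrite exprS invfM mulrAC mulVf // mul1r.
  rewrite /e qpochSl qN' (qpochS q) (qpochS (q ^- n)) [q ^+ k.+1]exprSr.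
  have h1 := qpoch_qq_neq0 k; have := qpoch_qq_neq0 k.+1; rewrite qpochS mulf_eq0 negb_or.
  move=> /andP[_ h2]; have qN := expf_neq0 n qn0.
  rewrite [q ^+ n.+1]exprSr; field.
  by rewrite h1 h2 qN qn0.
have e0 : e n.+1 = 0 by rewrite /e qpoch_qN_eq0 mul0r.
rewrite /qdiff big_ord_recl.
under eq_bigr => i _ do rewrite lift0 ek mulrBl.
rewrite sumrB big_ord_recr /= -/(e n.+1) e0 mul0r addr0.
have -> : qpoch (q ^- n.+1) q 0 / qpoch q q 0 * q ^+ 0 * f 0 = e 0 * f 0.
  by rewrite /e /qpoch !big_ord0 expr0 mulr1.
rewrite addrA -[e 0 * f 0 + _](big_ord_recl _ (fun i => e i * f i)) -sumrB.
by apply: eq_bigr => i _; rewrite -mulrBr fg /e; ring.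
Qed.

Lemma qdiff_ext n f g : (forall k, (k <= n)%N -> f k = g k) -> qdiff n f = qdiff n g.
Proof. by move=> fg; apply: eq_bigr => k _; rewrite fg // -ltnS. Qed.

Lemma qdiffZ n (x : R) f : qdiff n (fun k => x * f k) = x * qdiff n f.
Proof. by rewrite /qdiff mulr_sumr; apply: eq_bigr => k _; rewrite mulrCA. Qed.

Lemma qdiffD n f g : qdiff n (fun k => f k + g k) = qdiff n f + qdiff n g.
Proof. by rewrite /qdiff -big_split; apply: eq_bigr => k _; rewrite mulrDr. Qed.

Lemma qdiff_sum n m (f : 'I_m -> nat -> R) :
  qdiff n (fun k => \sum_(i < m) f i k) = \sum_(i < m) qdiff n (f i).
Proof.
by rewrite /qdiff exchange_big; apply: eq_bigr => k _; rewrite mulr_sumr.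
Qed.

(** Each summation by parts lowers the degree by one, and constants have
    q-derivative 0. *)
Lemma qdiff_monomial n j : (j <= n)%N ->
  qdiff n (fun k => (q ^+ k) ^+ j) = if j == n then qpoch q q n else 0.
Proof.
elim: n j => [|n ih] j.
  rewrite leqn0 => /eqP ->; rewrite /qdiff big_ord1 /qpoch !big_ord0 !expr0.
  by rewrite !mulr1 divr1.
case: j => [|j] jn.
  rewrite (@qdiff_parts _ _ (fun=> 0 * 0)); last by move=> k; rewrite !expr0 subrr !mulr0.
  by rewrite qdiffZ mul0r.
rewrite (@qdiff_parts _ _ (fun k => (1 - q ^+ j.+1) * (q ^+ k) ^+ j)); last first.
  by move=> k; rewrite [q ^+ k.+1]exprS exprMn (exprS (q ^+ k)); ring.
rewrite qdiffZ ih // eqSS; case: eqP => [->|_]; last by rewrite mulr0.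
by rewrite qpochS exprS mulrC.
Qed.

Lemma qdiff_poly n (p : {poly R}) : (size p <= n.+1)%N ->
  qdiff n (fun k => p.[q ^+ k]) = p`_n * qpoch q q n.
Proof.
move=> pn; rewrite (@qdiff_ext _ _ (fun k => \sum_(i < n.+1) p`_i * (q ^+ k) ^+ i)); last first.
  by move=> k _; rewrite (horner_coef_wide _ pn).
rewrite qdiff_sum big_ord_recr /= qdiffZ qdiff_monomial // eqxx big1 ?add0r // => i _.
by rewrite qdiffZ qdiff_monomial 1?ltnW // ltn_eqF // mulr0.
Qed.

Lemma qdiff_poly0 n (p : {poly R}) : (size p <= n)%N ->
  qdiff n (fun k => p.[q ^+ k]) = 0.
Proof. by move=> pn; rewrite qdiff_poly ?nth_default ?mul0r // ltnW. Qed.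

Lemma qpoch_neq0W (Y : R) n : (forall i, 1 - Y * q ^+ i != 0) -> qpoch Y q n != 0.
Proof. by move=> Y0; apply/prodf_neq0 => i _. Qed.

(** The inverse of [(Y t; q)_m] has as q-derivative a multiple of the inverse of
    [(Y t; q)_(m+1)]. *)
Lemma qdiff_inv n m (Y : R) : (forall i, 1 - Y * q ^+ i != 0) ->
  qdiff n (fun k => (qpoch (Y * q ^+ k) q m)^-1) =
  Y ^+ n * qpoch (q ^+ m) q n / qpoch Y q (n + m).
Proof.
move=> Y0; elim: n m => [|n ih] m.
  rewrite /qdiff big_ord1 /qpoch !big_ord0 !expr0 !mulr1 divr1 !mul1r.
  by [].
have YY j i : 1 - Y * q ^+ j * q ^+ i != 0 by rewrite -mulrA -exprD.
rewrite (@qdiff_parts _ _ (fun k => Y * (1 - q ^+ m) * (qpoch (Y * q ^+ k) q m.+1)^-1)).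
  by rewrite qdiffZ ih addSnnS (exprS Y) qpochSl -(exprSr q); ring.
move=> k; have n1 := qpoch_neq0W m (YY k.+1); have n2 := YY k 0; have n3 := YY k m.
have h : (1 - Y * q ^+ k) * qpoch (Y * q ^+ k.+1) q m =
    qpoch (Y * q ^+ k) q m * (1 - Y * q ^+ k * q ^+ m).
  by rewrite exprSr mulrA -qpochSl qpochS.
have n4 := qpoch_neq0W m (YY k).
rewrite expr0 mulr1 in n2.
rewrite qpochS; move: h n1 n2 n3 n4.
move: (qpoch (Y * q ^+ k) q m) (qpoch (Y * q ^+ k.+1) q m) => A B h n1 n2 n3 n4.
have -> : B = A * (1 - Y * q ^+ k * q ^+ m) / (1 - Y * q ^+ k) by rewrite -h mulrC mulKf.
by field; rewrite n2 n3 n4.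
Qed.

(** Division by [1 - Y t] leaves the constant remainder [p (1 / Y)]; the quotient has
    degree less than [n] and is annihilated. *)
Lemma qdiff_div n (p : {poly R}) (Y : R) : (forall i, 1 - Y * q ^+ i != 0) ->
  Y != 0 -> (size p <= n.+1)%N ->
  qdiff n (fun k => p.[q ^+ k] / (1 - Y * q ^+ k)) =
  Y ^+ n * p.[Y^-1] * qpoch q q n / qpoch Y q n.+1.
Proof.
move=> Y0 Yn0 pn.
have /factor_theorem[r rE] : root (p - p.[Y^-1]%:P) Y^-1.
  by rewrite rootE !hornerE subrr.
have rn : (size r <= n)%N.
  have [->|r0] := eqVneq r 0; first by rewrite size_poly0.
  have : (size (p - p.[Y^-1]%:P)%R <= n.+1)%N.
    rewrite (leq_trans (size_polyD _ _)) // geq_max pn size_polyN.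
    by rewrite (leq_trans (size_polyC_leq1 _)).
  by rewrite rE size_Mmonic ?monicXsubC // size_XsubC addn2.
rewrite (@qdiff_ext _ _ (fun k => p.[Y^-1] * (qpoch (Y * q ^+ k) q 1)^-1 +
   (- Y^-1) * r.[q ^+ k])); last first.
  move=> k _; rewrite /qpoch big_ord1 expr0 mulr1.
  have -> : p.[q ^+ k] = p.[Y^-1] + r.[q ^+ k] * (q ^+ k - Y^-1).
    have := congr1 (fun P => P.[q ^+ k]) rE; rewrite !hornerE => <-.
    by rewrite addrC subrK.
  by field; rewrite Yn0 Y0.
rewrite qdiffD !qdiffZ qdiff_poly0 // mulr0 addr0 qdiff_inv // addn1 expr1.
by ring.
Qed.

Lemma prod_linear_coef n (u v : nat -> R) :
  (size (\prod_(i < n) ((u i)%:P + v i *: 'X))%R <= n.+1)%N /\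
  (\prod_(i < n) ((u i)%:P + v i *: 'X))`_n = \prod_(i < n) v i.
Proof.
elim: n => [|n [sz co]]; first by rewrite !big_ord0 size_poly1 coef1.
rewrite !big_ord_recr /=; set P := \prod_(i < n) _ in sz co *.
rewrite mulrDr -scalerAr [P * (u n)%:P]mulrC mul_polyC; split.
  rewrite (leq_trans (size_polyD _ _)) // geq_max.
  rewrite (leq_trans (size_scale_leq _ _)) ?(leq_trans sz) //=.
  rewrite (leq_trans (size_scale_leq _ _)) // (leq_trans (size_polyMleq _ _)) //.
  by rewrite size_polyX addn2.
rewrite coefD !coefZ coefMX /= nth_default // mulr0 add0r co mulrC //.
Qed.

(** The polynomial in t with values [(X t; q)_n]. *)
Definition qpoch_poly n (X : R) : {poly R} :=
  \prod_(i < n) (1%:P + (- (X * q ^+ i)) *: 'X).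

Lemma size_qpoch_poly n X : (size (qpoch_poly n X) <= n.+1)%N.
Proof. by have [] := prod_linear_coef n (fun=> 1) (fun i => - (X * q ^+ i)). Qed.

Lemma horner_qpoch_poly n X t : (qpoch_poly n X).[t] = qpoch (X * t) q n.
Proof.
rewrite /qpoch_poly horner_prod; apply: eq_bigr => i _.
by rewrite !hornerE /=; ring.
Qed.

(** For [Y = 0] the right-hand side is the leading coefficient, by
    [qdiff_poly]; otherwise [qdiff_div] applies. *)
Lemma qdiff_qpoch_div n (X Y : R) : (forall i, 1 - Y * q ^+ i != 0) ->
  qdiff n (fun k => qpoch (X * q ^+ k) q n / (1 - Y * q ^+ k)) =
  \prod_(i < n) (Y - X * q ^+ i) * qpoch q q n / qpoch Y q n.+1.
Proof.
move=> Y0; have [->|Yn0] := eqVneq Y 0.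
  rewrite (@qdiff_ext _ _ (fun k => (qpoch_poly n X).[q ^+ k])); last first.
    by move=> k _; rewrite mul0r subr0 divr1 horner_qpoch_poly.
  rewrite qdiff_poly ?size_qpoch_poly //.
  have [_ ->] := prod_linear_coef n (fun=> 1) (fun i => - (X * q ^+ i)).
  have -> : qpoch 0 q n.+1 = 1 :> R by apply: big1 => i _; rewrite mul0r subr0.
  rewrite divr1; congr (_ * _); by apply: eq_bigr => i _; rewrite sub0r.
rewrite (@qdiff_ext _ _ (fun k => (qpoch_poly n X).[q ^+ k] / (1 - Y * q ^+ k))); last first.
  by move=> k _; rewrite horner_qpoch_poly.
rewrite qdiff_div ?size_qpoch_poly // horner_qpoch_poly; congr (_ * _ / _).
rewrite -[n in Y ^+ n]card_ord -prodr_const -big_split; apply: eq_bigr => i _ /=.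
by rewrite mulrBr mulr1 mulrA mulrCA mulfV // mulr1.
Qed.

(** Reversing the product: the factor [1 - q^(-i-1)] is [- q^(-i-1) (1 - q^(i+1))]. *)
Lemma qpoch_qN_top n :
  qpoch (q ^- n) q n * q ^+ n * \prod_(i < n) q ^+ i = (-1) ^+ n * qpoch q q n.
Proof.
rewrite -mulrA -[n in q ^+ n * _]card_ord -prodr_const -big_split /=.
rewrite /qpoch (reindex_inj rev_ord_inj) /= -big_split /=.
rewrite -[n in (-1) ^+ n]card_ord -prodr_const -big_split /=.
apply: eq_bigr => i _; rewrite -exprS.
have -> : q ^- n * q ^+ (n - i.+1) = q ^- i.+1.
  apply: (mulIf (expf_neq0 i.+1 qn0)); rewrite mulVf ?expf_neq0 //.
  by rewrite -mulrA -exprD subnK // mulVf ?expf_neq0.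
by rewrite mulrBl mulVf ?expf_neq0 // mul1r exprS; ring.
Qed.

End qdiff.

(** * Askey-Wilson polynomials with nonzero first parameter *)

Section aw_poly.
Variables (R : realType) (q : R) (hq : 0 < q < 1).
Let q0 : 0 < q. Proof. by case/andP: hq. Qed.
Let q1 : q < 1. Proof. by case/andP: hq. Qed.
Let qn0 : q != 0. Proof. exact: lt0r_neq0. Qed.
Implicit Types (a b c d : R) (P Q : {poly R}).
Local Notation E := (aw_int q).

(** [(a e^(it), a e^(-it); q)_m] as a polynomial in [x = cos t]. *)
Definition aw_basis m a : {poly R} := \prod_(i < m) h_quad (a * q ^+ i).

Definition aw_lead n a b c d : R := 2 ^+ n * qpoch (a * b * c * d * q ^ (n%:Z - 1)) q n.

Definition aw_coef n a b c d k : R :=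
  qpoch (q ^- n) q k * qpoch (a * b * c * d * q ^ (n%:Z - 1)) q k /
  (qpoch (a * b) q k * qpoch (a * c) q k * qpoch (a * d) q k * qpoch q q k) * q ^+ k.

(** The terminating series that defines the n-th polynomial, for [a <> 0]. *)
Definition aw_poly n a b c d : {poly R} :=
  (qpoch (a * b) q n * qpoch (a * c) q n * qpoch (a * d) q n / a ^+ n) *:
  \sum_(k < n.+1) aw_coef n a b c d k *: aw_basis k a.

(** The squared norm of [aw_poly n a b c d]. *)
Definition aw_norm n a b c d : R :=
  E a b c d 1 * qpoch (a * b * c * d * q ^ (n%:Z - 1)) q n *
  (qpoch (a * b) q n * qpoch (a * c) q n * qpoch (a * d) q n * qpoch (b * c) q n *
   qpoch (b * d) q n * qpoch (c * d) q n * qpoch q q n) /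
  qpoch (a * b * c * d) q (2 * n).

Lemma aw_basis_coef m a : (size (aw_basis m a) <= m.+1)%N /\
  (aw_basis m a)`_m = (- 2 * a) ^+ m * \prod_(i < m) q ^+ i.
Proof.
have -> : aw_basis m a =
    \prod_(i < m) ((1 + (a * q ^+ i) ^+ 2)%:P + (- 2 * a * q ^+ i) *: 'X).
  by apply: eq_bigr => i _; rewrite /h_quad -scaleNr; congr (_ + _ *: _); ring.
have [sz ->] := prod_linear_coef m (fun i => 1 + (a * q ^+ i) ^+ 2) (fun i => - 2 * a * q ^+ i).
by split => //; rewrite big_split prodr_const card_ord.
Qed.

Lemma aw_basisS m a : aw_basis m.+1 a = h_quad (a * q ^+ m) * aw_basis m a.
Proof. by rewrite /aw_basis big_ord_recr /= mulrC. Qed.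

Lemma aw_int_basis k a b c d Q : `|a| < 1 ->
  E (a * q ^+ k) b c d Q = E a b c d (aw_basis k a * Q).
Proof.
move=> ha; elim: k Q => [|k ih] Q; first by rewrite /aw_basis big_ord0 expr0 mulr1 mul1r.
rewrite exprSr mulrA aw_int_shift ?normr_lt1qX // ih aw_basisS.
by congr (E _ _ _ _ _); ring.
Qed.

Section four.
Variables (a b c d : R).
Hypotheses (ha : `|a| < 1) (hb : `|b| < 1) (hc : `|c| < 1) (hd : `|d| < 1).

Let D := a * b * c * d.
Let hD : `|D| < 1. Proof. by rewrite !normr_lt1M. Qed.

Let qp_neq0 x n : `|x| < 1 -> qpoch x q n != 0.
Proof. by move=> x1; rewrite lt0r_neq0 // qpoch_gt0. Qed.

(** Products of basis elements for two different parameters are absorbed by the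
    weight, so that their integrals are total masses. *)
Lemma aw_int_basis2 k m : E a b c d (aw_basis k a * aw_basis m b) =
  E a b c d 1 * (qpoch (a * b) q (k + m) * qpoch (a * c) q k * qpoch (a * d) q k *
  qpoch (b * c) q m * qpoch (b * d) q m) / qpoch D q (k + m).
Proof.
have h1 := aw_mass_shiftn hq k ha hb hc hd.
have hak := normr_lt1qX hq k ha.
have h2 := aw_mass_shiftn hq m hb hak hc hd.
rewrite -[aw_basis m b]mulr1 -aw_int_basis // aw_intC12 -aw_int_basis //.
have e1 := @qpochD _ (a * b) q k m; have e2 := @qpochD _ D q k m.
rewrite e1 e2 -/D in h1 *.
rewrite (_ : b * (a * q ^+ k) * c * d = D * q ^+ k) in h2; last by rewrite /D; ring.
rewrite (_ : b * (a * q ^+ k) = a * b * q ^+ k) in h2; last by ring.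
rewrite [E b _ _ _ _]aw_intC12 in h2.
have n1 := qp_neq0 k hD; have n2 : qpoch (D * q ^+ k) q m != 0.
  by rewrite qp_neq0 // normr_lt1qX.
apply: (mulIf (mulf_neq0 n1 n2)); rewrite divfK ?mulf_neq0 //.
transitivity (qpoch D q k * (qpoch (D * q ^+ k) q m * E (b * q ^+ m) (a * q ^+ k) c d 1)).
  by ring.
rewrite h2; transitivity (qpoch (a * b * q ^+ k) q m * qpoch (b * c) q m * qpoch (b * d) q m *
  (qpoch D q k * E (a * q ^+ k) b c d 1)); first by ring.
by rewrite h1; ring.
Qed.

Lemma aw_poly_basis n m : a != 0 ->
  E a b c d (aw_poly n a b c d * aw_basis m b) =
  E a b c d 1 * (qpoch (a * b) q n * qpoch (a * c) q n * qpoch (a * d) q n / a ^+ n) *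
  (qpoch (b * c) q m * qpoch (b * d) q m) *
  qdiff q n (fun k => qpoch (a * b * q ^+ k) q m *
    (qpoch (D * q ^ (n%:Z - 1)) q k / qpoch D q (k + m))).
Proof.
move=> a0; rewrite /aw_poly -scalerAl aw_intZ // mulr_suml aw_int_sum //.
rewrite /qdiff !mulr_sumr; apply: eq_bigr => k _.
rewrite -(scalerAl (aw_coef n a b c d k)) aw_intZ // aw_int_basis2 /aw_coef -/D qpochD.
have n1 : qpoch (a * b) q k != 0 by rewrite qp_neq0 // normr_lt1M.
have n2 : qpoch (a * c) q k != 0 by rewrite qp_neq0 // normr_lt1M.
have n3 : qpoch (a * d) q k != 0 by rewrite qp_neq0 // normr_lt1M.
have n4 := qp_neq0 (k + m) hD; have n5 := qpoch_qq_neq0 hq k.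
move: n1 n2 n3 n4 n5.
move: (qpoch (a * b) q k) (qpoch (a * c) q k) (qpoch (a * d) q k) (qpoch D q (k + m))
  (qpoch q q k) (qpoch (q ^- n) q k) (qpoch _ q k) => A B C F G H K n1 n2 n3 n4 n5.
by field; rewrite n1 n2 n3 n4 n5 expf_neq0.
Qed.

Lemma qpochY n k : (0 < n)%N ->
  qpoch (D * q ^ (n%:Z - 1)) q k = qpoch D q (n.-1 + k) / qpoch D q n.-1.
Proof.
case: n => // n _; rewrite qpochD [X in _ = X / _]mulrC mulfK ?qp_neq0 //.
by rewrite (_ : n.+1%:Z - 1 = n%:Z) // -addn1 PoszD addrK.
Qed.

(** The ratios of q-shifted factorials left in [aw_poly_basis] are polynomials
    in [q^k] of degrees [m] and [n - 1 - m]. *)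
Lemma aw_orth_basis n m : a != 0 -> (m < n)%N ->
  E a b c d (aw_poly n a b c d * aw_basis m b) = 0.
Proof.
move=> a0 mn; rewrite aw_poly_basis //.
pose p := qpoch_poly q m (a * b) * qpoch_poly q (n.-1 - m) (D * q ^+ m).
rewrite (@qdiff_ext _ q n _ (fun k => (qpoch D q n.-1)^-1 * p.[q ^+ k])).
  rewrite qdiffZ qdiff_poly0 ?mulr0 //.
  rewrite (leq_trans (size_polyMleq _ _)) //.
  have := leq_add (size_qpoch_poly q m (a * b)) (size_qpoch_poly q (n.-1 - m) (D * q ^+ m)).
  by move=> h; lia.
move=> k kn; rewrite /p hornerM !horner_qpoch_poly qpochY ?(leq_ltn_trans _ mn) //.
have -> : (n.-1 + k = (k + m) + (n.-1 - m))%N by lia.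
rewrite qpochD (_ : D * q ^+ m * q ^+ k = D * q ^+ (k + m)); last by rewrite exprD; ring.
have n1 := qp_neq0 (k + m) hD; have n2 := qp_neq0 n.-1 hD.
by field; rewrite n1 n2.
Qed.

(** For [m = n] the second ratio becomes [1 / (1 - Y q^k)] with
    [Y = abcd q^(n-1)]. *)
Lemma aw_norm_basis n : a != 0 ->
  E a b c d (aw_poly n a b c d * aw_basis n b) =
  E a b c d 1 * (qpoch (a * b) q n * qpoch (a * c) q n * qpoch (a * d) q n *
   qpoch (b * c) q n * qpoch (b * d) q n * qpoch (c * d) q n * qpoch q q n) /
  qpoch D q (2 * n) * ((- b) ^+ n * \prod_(i < n) q ^+ i).
Proof.
move=> a0; rewrite aw_poly_basis //.
case: n => [|n].
  rewrite /qdiff big_ord1 /qpoch !big_ord0 !expr0; field.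
  by [].
set Y := D * q ^+ n.
have Y0 i : 1 - Y * q ^+ i != 0.
  have : `|Y * q ^+ i| < 1 by do 2!apply: normr_lt1qX => //.
  by rewrite lter_norml subr_eq0 => /andP[_ h]; rewrite gt_eqF.
rewrite (@qdiff_ext _ q n.+1 _ (fun k => (qpoch D q n)^-1 *
    (qpoch (a * b * q ^+ k) q n.+1 / (1 - Y * q ^+ k)))); last first.
  move=> k _; rewrite qpochY // [n.+1.-1]/= addnS (qpochS D) [(k + n)%N]addnC.
  rewrite (_ : D * q ^+ (n + k) = Y * q ^+ k); last by rewrite exprD mulrA.
  have n1 := qp_neq0 (n + k) hD; have n2 := qp_neq0 n hD; have n3 := Y0 k.
  by field; rewrite n1 n2 n3.
rewrite qdiffZ qdiff_qpoch_div //.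
have -> : \prod_(i < n.+1) (Y - a * b * q ^+ i) =
    (- (a * b)) ^+ n.+1 * (\prod_(i < n.+1) q ^+ i) * qpoch (c * d) q n.+1.
  have -> : (- (a * b)) ^+ n.+1 = \prod_(i < n.+1) - (a * b) by rewrite prodr_const card_ord.
  rewrite /qpoch -[RHS]mulrA.
  rewrite [X in _ * (_ * X)](reindex_inj rev_ord_inj) -!big_split /=.
  apply: eq_bigr => i _; rewrite subSS /Y /D.
  rewrite (_ : q ^+ n = q ^+ i * q ^+ (n - i)); last by rewrite -exprD subnKC // -ltnS.
  by ring.
have -> : qpoch D q (2 * n.+1) = qpoch D q n * qpoch Y q n.+2.
  by rewrite -qpochD; congr (qpoch _ _ _); lia.
have n1 := qp_neq0 n hD; have n2 := qpoch_neq0W n.+2 Y0.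
have -> : (- (a * b)) ^+ n.+1 = (- b) ^+ n.+1 * a ^+ n.+1.
  by rewrite -exprMn; congr (_ ^+ _); ring.
by field; rewrite n1 n2 expf_neq0.
Qed.

Lemma aw_poly_coef n : a != 0 -> (size (aw_poly n a b c d) <= n.+1)%N /\
  (aw_poly n a b c d)`_n = aw_lead n a b c d.
Proof.
move=> a0; split.
  rewrite (leq_trans (size_scale_leq _ _)) // (leq_trans (size_sum _ _ _)) //.
  apply/bigmax_leqP => k _; rewrite (leq_trans (size_scale_leq _ _)) //.
  by rewrite (leq_trans (aw_basis_coef k a).1) // ltn_ord.
rewrite coefZ coef_sum big_ord_recr /= big1 ?add0r; last first.
  move=> k _; rewrite coefZ nth_default ?mulr0 //.
  by rewrite (leq_trans (aw_basis_coef k a).1) // ltn_ord.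
rewrite coefZ (aw_basis_coef n a).2 /aw_coef /aw_lead.
have n1 : qpoch (a * b) q n != 0 by rewrite qp_neq0 // normr_lt1M.
have n2 : qpoch (a * c) q n != 0 by rewrite qp_neq0 // normr_lt1M.
have n3 : qpoch (a * d) q n != 0 by rewrite qp_neq0 // normr_lt1M.
have n5 := qpoch_qq_neq0 hq n; have an := expf_neq0 n a0.
rewrite exprMn -(mulrN1 2) exprMn.
have S1 : (-1) ^+ n * (-1) ^+ n = 1 :> R by rewrite -exprMn mulrNN mulr1 expr1n.
transitivity ((qpoch (q ^- n) q n * q ^+ n * \prod_(i < n) q ^+ i) * (-1) ^+ n /
  qpoch q q n * (2 ^+ n * qpoch (a * b * c * d * q ^ (n%:Z - 1)) q n)).
  by field; rewrite n1 n2 n3 n5 an.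
by rewrite qpoch_qN_top // (mulrAC ((-1) ^+ n) (qpoch q q n)) S1 mul1r mulfV // mul1r.
Qed.

Lemma aw_basis_reduce n Q : b != 0 -> (size Q <= n.+1)%N ->
  (size (Q - (Q`_n / ((- 2 * b) ^+ n * \prod_(i < n) q ^+ i)) *: aw_basis n b)%R <= n)%N.
Proof.
move=> b0 Qn; have [sz co] := aw_basis_coef n b.
apply/leq_sizeP => j nj; rewrite coefB coefZ.
have [->|jn] := eqVneq j n.
  rewrite co divfK ?subrr // mulf_neq0 ?expf_neq0 ?mulf_neq0 ?oppr_eq0 ?pnatr_eq0 //.
  by apply/prodf_neq0 => i _; rewrite expf_neq0.
have nj' : (n.+1 <= j)%N by rewrite ltn_neqAle eq_sym jn.
by rewrite (nth_default _ (leq_trans Qn nj')) (nth_default _ (leq_trans sz nj')) mulr0 subr0.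
Qed.

(** For [b <> 0] the elements [aw_basis m b], [m < n], span the polynomials of
    size at most [n]. *)
Lemma aw_orth_lt n Q : a != 0 -> b != 0 -> (size Q <= n)%N ->
  E a b c d (aw_poly n a b c d * Q) = 0.
Proof.
move=> a0 b0 Qn; suff h m : (m <= n)%N -> forall Q, (size Q <= m)%N ->
    E a b c d (aw_poly n a b c d * Q) = 0 by exact: (h n).
elim: m => [|m ih] mn {Qn}Q Qm.
  move: Qm; rewrite size_poly_leq0 => /eqP ->; rewrite mulr0.
  exact: aw_int0.
have := ih (ltnW mn) _ (aw_basis_reduce b0 Qm).
rewrite mulrBr aw_intB // -scalerAr aw_intZ // aw_orth_basis // mulr0 subr0.
by [].
Qed.

(** Only the leading coefficient of [Q] matters, by [aw_orth_lt]. *)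
Lemma aw_norm_lead n Q : a != 0 -> b != 0 -> (size Q <= n.+1)%N ->
  E a b c d (aw_poly n a b c d * Q) =
  Q`_n / ((- 2 * b) ^+ n * \prod_(i < n) q ^+ i) *
  E a b c d (aw_poly n a b c d * aw_basis n b).
Proof.
move=> a0 b0 Qn; have := aw_orth_lt a0 b0 (aw_basis_reduce b0 Qn).
by rewrite mulrBr aw_intB // -scalerAr aw_intZ // => /eqP; rewrite subr_eq0 => /eqP.
Qed.

Lemma aw_orth_neq n m : a != 0 -> b != 0 -> n != m ->
  E a b c d (aw_poly n a b c d * aw_poly m a b c d) = 0.
Proof.
move=> a0 b0; rewrite neq_ltn => /orP[nm|mn].
  rewrite mulrC aw_orth_lt // (leq_trans (aw_poly_coef n a0).1) //.
by rewrite aw_orth_lt // (leq_trans (aw_poly_coef m a0).1).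
Qed.

Lemma aw_norm_eq n : a != 0 -> b != 0 ->
  E a b c d (aw_poly n a b c d * aw_poly n a b c d) = aw_norm n a b c d.
Proof.
move=> a0 b0; have [sz co] := aw_poly_coef n a0.
rewrite aw_norm_lead // co aw_norm_basis // /aw_lead /aw_norm -/D.
have n1 : \prod_(i < n) q ^+ i != 0 by apply/prodf_neq0 => i _; rewrite expf_neq0.
have n2 := qp_neq0 (2 * n) hD.
have n3 : (- b) ^+ n != 0 by rewrite expf_neq0 // oppr_eq0.
have n4 : 2 ^+ n != 0 :> R by rewrite expf_neq0 // pnatr_eq0.
rewrite (_ : (- 2 * b) ^+ n = 2 ^+ n * (- b) ^+ n); last first.
  by rewrite -exprMn; congr (_ ^+ _); ring.
by field; rewrite n1 n2 n3 n4.
Qed.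

End four.
End aw_poly.

(** * Askey-Wilson polynomials are polynomials in the first parameter *)

Section tame.
Variables (R : realType) (q : R) (hq : 0 < q < 1).
Let q0 : 0 < q. Proof. by case/andP: hq. Qed.
Let q1 : q < 1. Proof. by case/andP: hq. Qed.
Let qn0 : q != 0. Proof. exact: lt0r_neq0. Qed.
Local Notation A := {poly R}.
Implicit Types (f g : nat -> {poly A}) (N r k j : nat).

(** Functions of [k] that are, modulo [a^r], polynomials in [a] and [a q^k]. The
    restriction to [k < N] is for [down_prod], whose recursion stops at
    [k = n]. *)
Definition tame N r f := forall j, (j < r)%N -> exists p : {poly A},
  (size p <= j.+1)%N /\ forall k, (k < N)%N -> (f k)`_j = p.[(q ^+ k)%:P].

Lemma tame_le N r r' f : (r' <= r)%N -> tame N r f -> tame N r' f.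
Proof. by move=> rr tf j jr; apply: tf; exact: leq_trans jr rr. Qed.

Lemma tame_cst N r (F : {poly A}) : tame N r (fun=> F).
Proof.
move=> j _; exists (F`_j)%:P; split; last by move=> k _; rewrite hornerC.
by rewrite (leq_trans (size_polyC_leq1 _)).
Qed.

Lemma tameM N r f g : tame N r f -> tame N r g -> tame N r (fun k => f k * g k).
Proof.
move=> tf tg j jr.
have /choice[pf pfP] : forall i : 'I_j.+1, exists p : {poly A},
    (size p <= i.+1)%N /\ forall k, (k < N)%N -> (f k)`_i = p.[(q ^+ k)%:P].
  by move=> i; apply: tf; rewrite (leq_trans _ jr) // ltnS -ltnS.
have /choice[pg pgP] : forall i : 'I_j.+1, exists p : {poly A},
    (size p <= (j - i).+1)%N /\ forall k, (k < N)%N -> (g k)`_(j - i) = p.[(q ^+ k)%:P].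
  by move=> i; apply: tg; rewrite (leq_ltn_trans _ jr) // leq_subr.
exists (\sum_(i < j.+1) pf i * pg i); split.
  rewrite (leq_trans (size_sum _ _ _)) //; apply/bigmax_leqP => i _.
  rewrite (leq_trans (size_polyMleq _ _)) //.
  have := leq_add (pfP i).1 (pgP i).1; have := ltn_ord i; lia.
move=> k kN; rewrite coefM horner_sum; apply: eq_bigr => i _.
by rewrite hornerM -(pfP i).2 // -(pgP i).2.
Qed.

Lemma tameD N r f g : tame N r f -> tame N r g -> tame N r (fun k => f k + g k).
Proof.
move=> tf tg j jr; have [p [ps pf]] := tf j jr; have [p' [ps' pg]] := tg j jr.
exists (p + p'); split; first by rewrite (leq_trans (size_polyD _ _)) // geq_max ps.
by move=> k kN; rewrite coefD pf // pg // hornerD.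
Qed.

Lemma tame_shift N r f : tame N.+1 r f -> tame N r (fun k => f k.+1).
Proof.
move=> tf j jr; have [p [ps pf]] := tf j jr.
exists (p \Po (q%:P *: 'X)); split; last first.
  move=> k kN; rewrite pf // horner_comp hornerZ hornerX exprS polyCM.
  by [].
have [->|p0] := eqVneq p 0; first by rewrite comp_poly0 size_poly0.
rewrite (leq_trans (size_comp_poly_leq _ _)) // size_scale ?size_polyX ?polyC_eq0 //.
by rewrite /= muln1; move: ps; rewrite -ltnS prednK // size_poly_gt0.
Qed.

Lemma tame_qX N r f : tame N r f -> tame N r.+1 (fun k => (q ^+ k)%:P *: ('X * f k)).
Proof.
move=> tf [|j] jr.
  by exists 0; rewrite size_poly0; split => // k _; rewrite coefZ coefXM eqxx mulr0 horner0.
have [p [ps pf]] := tf j jr.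
exists ('X * p); split.
  by rewrite (leq_trans (size_polyMleq _ _)) // size_polyX.
by move=> k kN; rewrite coefZ coefXM /= pf // hornerM hornerX.
Qed.

Lemma q_antiderivative (p : {poly A}) n : (size p <= n)%N -> exists P : {poly A},
  (size P <= n.+1)%N /\ forall t : R, P.[(q * t)%:P] - P.[t%:P] = t%:P * p.[t%:P].
Proof.
move=> pn; pose w l : R := (q ^+ l.+1 - 1)^-1.
exists (\poly_(i < n.+1) (if i is l.+1 then p`_l * (w l)%:P else 0)).
split; first exact: size_poly.
move=> t; rewrite !horner_poly !big_ord_recl /= !mul0r !add0r -sumrB.
rewrite (horner_coef_wide _ pn) mulr_sumr; apply: eq_bigr => i _.
rewrite /bump /= add1n -!polyC_exp exprMn polyCM.
have e : (w i)%:P * ((q ^+ i.+1)%:P - 1) = 1 :> A.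
  rewrite -polyCB -polyCM mulVf ?subr_eq0 //.
  by rewrite lt_eqF // exprn_ilt1 // ltW.
rewrite (exprS t) polyCM; move: ((q ^+ i.+1)%:P) (w i)%:P e => Q W e.
transitivity (p`_i * (t%:P * (t ^+ i)%:P) * (W * (Q - 1))); first by ring.
by rewrite e; ring.
Qed.

(** The coefficients of [f] are q-antiderivatives of those of [g], whence one
    more degree for one more power of [a]. This applies to all the factors of
    the series, which satisfy first-order recursions in [k]. *)
Lemma tame_diff N r f g : tame N r g ->
  (forall k, (k < N)%N -> f k.+1 - f k = (q ^+ k)%:P *: ('X * g k)) ->
  tame N.+1 r.+1 f.
Proof.
move=> tg fg [|j] jr.
  exists ((f 0)`_0)%:P; split; first by rewrite (leq_trans (size_polyC_leq1 _)).
  elim=> [|k ih] kN; first by rewrite hornerC.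
  have := congr1 (fun P : {poly A} => P`_0) (fg k kN).
  rewrite coefB coefZ coefXM eqxx mulr0 => /eqP; rewrite subr_eq0 => /eqP ->.
  by rewrite ih ?hornerC // ltnW.
have [p [ps pf]] := tg j jr.
have [P [Ps Pp]] := q_antiderivative ps.
exists (P + ((f 0)`_j.+1 - P.[1])%:P); split.
  rewrite (leq_trans (size_polyD _ _)) // geq_max Ps.
  by rewrite (leq_trans (size_polyC_leq1 _)).
elim=> [|k ih] kN; first by rewrite hornerD hornerC expr0 addrC subrK.
have := congr1 (fun P : {poly A} => P`_j.+1) (fg k kN).
rewrite coefB coefZ coefXM /= pf // -Pp -exprS => /eqP.
rewrite subr_eq ih ?(ltnW kN) // !hornerD !hornerC => /eqP ->.
by ring.
Qed.

Section series.
Variables (n : nat) (b c d : R).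

(** [(a g q^k; q)_(n-k)] as a polynomial in [a]; it arises as the quotient of
    [(a g; q)_n] by [(a g; q)_k]. *)
Definition down_prod (g : R) k : {poly A} :=
  \prod_(i < n - k) (1 - (g * q ^+ (k + i))%:P *: 'X).

(** [(a g; q)_k] as a polynomial in [a]. *)
Definition up_prod (g : R) k : {poly A} :=
  \prod_(i < k) (1 - (g * q ^+ i)%:P *: 'X).

(** [aw_basis k a] as a polynomial in [a] over the polynomials in x. *)
Definition basis_prod k : {poly A} :=
  \prod_(i < k) (1 - ((2 * q ^+ i) *: 'X) *: 'X + (q ^+ i ^+ 2)%:P *: 'X^2).

Lemma tame_up_prod (g : R) N r : tame N r (up_prod g).
Proof.
elim: r N => [//|r ih] [|N]; first by move=> j _; exists 0; rewrite size_poly0.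
apply: (@tame_diff _ _ _ (fun k => (- g)%:P%:P * up_prod g k)).
  by apply: tameM => //; exact: tame_cst.
move=> k _; rewrite /up_prod big_ord_recr /= -/(up_prod g k).
rewrite -!mul_polyC polyCM polyCN [(_ * _)%:P]polyCM.
by ring.
Qed.

Lemma tame_basis_prod N r : tame N r basis_prod.
Proof.
elim: r N => [//|r ih] [|N]; first by move=> j _; exists 0; rewrite size_poly0.
apply: (@tame_diff _ _ _ (fun k => ((- 2) *: 'X)%:P * basis_prod k +
   (q ^+ k)%:P *: ('X * basis_prod k))).
  apply: tameD; first by apply: tameM => //; exact: tame_cst.
  by apply: (@tame_le _ r.+1) => //; exact: tame_qX.
move=> k _; rewrite /basis_prod big_ord_recr /= -/(basis_prod k).
rewrite -!mul_polyC !(polyCM, polyCN, polyC_exp).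
by ring.
Qed.

Lemma tame_down_prod (g : R) r : tame n.+1 r (down_prod g).
Proof.
elim: r => [//|r ih].
apply: (@tame_diff _ _ _ (fun k => g%:P%:P * down_prod g k.+1)).
  by apply: tameM; [exact: tame_cst|exact: tame_shift].
move=> k kn; have -> : down_prod g k = (1 - (g * q ^+ k)%:P *: 'X) * down_prod g k.+1.
  rewrite /down_prod -(subnSK kn) big_ord_recl addn0; congr (_ * _).
  by apply: eq_bigr => i _; rewrite lift0 addnS addSn.
by rewrite -!mul_polyC polyCM [(_ * _)%:P]polyCM; ring.
Qed.

(** [a^n] times the Askey-Wilson polynomial, as a polynomial in [a] (the outer
    variable) and [x] (the inner one). *)
Definition aw_series : {poly A} := \sum_(k < n.+1)
  (qpoch (q ^- n) q k / qpoch q q k * q ^+ k)%:P *: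
  (up_prod (b * c * d * q ^ (n%:Z - 1)) k * basis_prod k *
   (down_prod b k * down_prod c k * down_prod d k)).

(** The coefficient of [a^j] is the n-th q-difference of a polynomial of degree at
    most [j < n]. *)
Lemma aw_series_coef j : (j < n)%N -> aw_series`_j = 0.
Proof.
move=> jn.
have [p [ps pf]] : exists p : {poly A}, (size p <= j.+1)%N /\
  forall k, (k < n.+1)%N -> (up_prod (b * c * d * q ^ (n%:Z - 1)) k * basis_prod k *
   (down_prod b k * down_prod c k * down_prod d k))`_j = p.[(q ^+ k)%:P].
  apply: (@tameM n.+1 n) => //; apply: tameM.
  - exact: tame_up_prod.
  - exact: tame_basis_prod.
  - by apply: tameM; exact: tame_down_prod.
  - exact: tame_down_prod.
rewrite coef_sum; transitivity (\sum_(i < j.+1) p`_i *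
    (qdiff q n (fun k => (q ^+ k) ^+ i))%:P).
  under [RHS]eq_bigr => i _ do rewrite /qdiff (rmorph_sum (@polyC R)) mulr_sumr.
  rewrite exchange_big /=; apply: eq_bigr => k _.
  rewrite coefZ pf // (horner_coef_wide _ ps) mulr_sumr; apply: eq_bigr => i _.
  by rewrite [in RHS]polyCM -polyC_exp; ring.
apply: big1 => i _; have ij := ltn_ord i.
rewrite qdiff_monomial //; last by rewrite (leq_trans _ jn) // ltnW.
by rewrite ltn_eqF ?mulr0 // (leq_trans ij).
Qed.

(** The coefficients of the Askey-Wilson polynomial as a polynomial in [a]. *)
Definition aw_series_term j : {poly R} := aw_series`_(j + n).

Definition aw_series_len : nat := (size aw_series).+1.

Lemma aw_poly_series a : `|a| < 1 -> `|b| < 1 -> `|c| < 1 -> `|d| < 1 -> a != 0 ->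
  aw_poly q n a b c d = \sum_(j < aw_series_len) a ^+ j *: aw_series_term j.
Proof.
move=> ha hb hc hd a0; have an := expf_neq0 n a0.
have E : aw_series.[a%:P] = a ^+ n *: aw_poly q n a b c d.
  rewrite /aw_poly scalerA mulrCA mulfV // mulr1 scaler_sumr horner_sum.
  apply: eq_bigr => k _; rewrite hornerZ !hornerM.
  have hk (g : R) : (down_prod g k).[a%:P] = (qpoch (a * g * q ^+ k) q (n - k))%:P.
    rewrite /down_prod horner_prod (rmorph_prod (@polyC R)); apply: eq_bigr => i _.
    by rewrite (rmorphB (@polyC R)) rmorph1 !hornerE /= -polyCM; congr (_ - polyC _); rewrite exprD; ring.
  have hu (g : R) : (up_prod g k).[a%:P] = (qpoch (a * g) q k)%:P.
    rewrite /up_prod horner_prod (rmorph_prod (@polyC R)); apply: eq_bigr => i _.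
    by rewrite (rmorphB (@polyC R)) rmorph1 !hornerE /= -polyCM; congr (_ - polyC _); ring.
  have hB : (basis_prod k).[a%:P] = aw_basis q k a.
    rewrite /basis_prod horner_prod; apply: eq_bigr => i _.
    rewrite !hornerE /h_quad -!mul_polyC polyCD exprMn -exprM mulnC.
    by rewrite !(polyCM, polyCD, polyC_exp, polyC1) /=; ring.
  rewrite hu hB !hk /aw_coef.
  have qq (g : R) : `|g| < 1 -> qpoch (a * g) q n = qpoch (a * g) q k * qpoch (a * g * q ^+ k) q (n - k).
    by move=> _; rewrite -qpochD subnKC // -ltnS.
  have nz (g : R) : `|g| < 1 -> qpoch (a * g) q k != 0.
    by move=> g1; rewrite lt0r_neq0 // qpoch_gt0 // normr_lt1M.
  rewrite !qq // scalerA.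
  set c0 := _ / _ * q ^+ k; set c1 := qpoch (a * (_ * q ^ _)) q k.
  set c2 := qpoch (a * b * _) q _; set c3 := qpoch (a * c * _) q _.
  set c4 := qpoch (a * d * _) q _.
  transitivity ((c0 * c1 * (c2 * c3 * c4))%:P * aw_basis q k a).
    by rewrite !polyCM; ring.
  rewrite mul_polyC; congr (_ *: _); rewrite /c0 /c1 {c0 c1}.
  have := nz _ hb; have := nz _ hc; have := nz _ hd; have := qpoch_qq_neq0 hq k.
  move=> n1 n2 n3 n4.
  rewrite (_ : a * (b * c * d * q ^ (n%:Z - 1)) = a * b * c * d * q ^ (n%:Z - 1)); last by ring.
  by field; rewrite n1 n2 n3 n4.
apply: (scalerI an); rewrite -E.
have sz : (size aw_series <= n + aw_series_len)%N by rewrite (leq_trans (leqnSn _)) ?leq_addl.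
rewrite (horner_coef_wide _ sz) big_split_ord /= big1 ?add0r; last first.
  by move=> i _; rewrite aw_series_coef // mul0r.
rewrite scaler_sumr; apply: eq_bigr => i _.
by rewrite /aw_series_term addnC scalerA -exprD mulrC -polyC_exp mul_polyC addnC.
Qed.

End series.
End tame.

(** * Orthogonality for all parameters *)

Section orthogonality.
Variables (R : realType) (q : R) (hq : 0 < q < 1).
Implicit Types (a b c d : R) (P Q : {poly R}).
Local Notation E := (aw_int q).

Lemma cvg_qpoch (u : nat -> R) (x p : R) n : u @ \oo --> x ->
  qpoch (u N) p n @[N --> \oo] --> qpoch x p n.
Proof.
move=> ux; elim: n => [|n ih].
  by rewrite /qpoch big_ord0; under eq_fun do rewrite big_ord0; exact: cvg_cst.
rewrite qpochS; under eq_fun do rewrite qpochS.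
apply: cvgM => //; apply: cvgB; first exact: cvg_cst.
by apply: cvgM => //; exact: cvg_cst.
Qed.

Lemma cvg_ord_sum m (f : 'I_m -> nat -> R) (l : 'I_m -> R) :
  (forall i, f i @ \oo --> l i) ->
  \sum_(i < m) f i N @[N --> \oo] --> \sum_(i < m) l i.
Proof.
elim: m f l => [|m ih] f l fl.
  by rewrite big_ord0; under eq_fun do rewrite big_ord0; exact: cvg_cst.
rewrite big_ord_recl; under eq_fun do rewrite big_ord_recl.
by apply: cvgD; [exact: fl|apply: ih => i; exact: fl].
Qed.

Lemma aw_int_bilinear a b c d m m' (x y : nat -> R) (B B' : nat -> {poly R}) :
  `|a| < 1 -> `|b| < 1 -> `|c| < 1 -> `|d| < 1 ->
  E a b c d ((\sum_(i < m) x i *: B i) * (\sum_(j < m') y j *: B' j)) =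
  \sum_(i < m) \sum_(j < m') x i * y j * E a b c d (B i * B' j).
Proof.
move=> ha hb hc hd; rewrite mulr_suml aw_int_sum //; apply: eq_bigr => i _.
rewrite mulr_sumr aw_int_sum //; apply: eq_bigr => j _.
by rewrite -scalerAl -scalerAr scalerA aw_intZ.
Qed.

(** Continuity of the integral of a product when the coefficients of both
    factors and two of the parameters vary. *)
Lemma aw_int_bilinear_cvg (u v : nat -> R) a b c d m m' (x y : nat -> nat -> R)
    (X Y : nat -> R) (B B' : nat -> {poly R}) :
  (forall N, `|u N| < 1) -> (forall N, `|v N| < 1) ->
  `|a| < 1 -> `|b| < 1 -> `|c| < 1 -> `|d| < 1 ->
  (forall Q, E (u N) (v N) c d Q @[N --> \oo] --> E a b c d Q) ->
  (forall i, x i @ \oo --> X i) -> (forall i, y i @ \oo --> Y i) ->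
  E (u N) (v N) c d ((\sum_(i < m) x i N *: B i) * (\sum_(j < m') y j N *: B' j))
    @[N --> \oo] -->
  E a b c d ((\sum_(i < m) X i *: B i) * (\sum_(j < m') Y j *: B' j)).
Proof.
move=> hu hv ha hb hc hd uE xX yY; rewrite aw_int_bilinear //.
under eq_fun do rewrite (@aw_int_bilinear _ _ _ _ _ _ (x ^~ _) (y ^~ _)) //.
apply: cvg_ord_sum => i; apply: cvg_ord_sum => j.
by apply: cvgM; [apply: cvgM|exact: uE].
Qed.

Lemma aw_norm_cvg (u v : nat -> R) n a b c d :
  `|a| < 1 -> `|b| < 1 -> `|c| < 1 -> `|d| < 1 -> u @ \oo --> a -> v @ \oo --> b ->
  E (u N) (v N) c d 1 @[N --> \oo] --> E a b c d 1 ->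
  aw_norm q n (u N) (v N) c d @[N --> \oo] --> aw_norm q n a b c d.
Proof.
move=> ha hb hc hd ua vb uE.
have D : u N * v N * c * d @[N --> \oo] --> a * b * c * d.
  by do 2![apply: cvgM; last exact: cvg_cst]; apply: cvgM.
have M (x : R) (w : nat -> R) (y : R) : w @ \oo --> y -> w N * x @[N --> \oo] --> y * x.
  by move=> wy; apply: cvgM => //; exact: cvg_cst.
apply: cvgM; last first.
  apply: cvgV; last exact: cvg_qpoch.
  by rewrite lt0r_neq0 // qpoch_gt0 // !normr_lt1M.
apply: cvgM.
  by apply: cvgM => //; apply: cvg_qpoch; apply: M.
do 2![apply: cvgM; last exact: cvg_cst].
do 4![apply: cvgM; last by apply: cvg_qpoch; exact: M].
by apply: cvg_qpoch; exact: cvgM.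
Qed.

(** A sequence of admissible nonzero parameters tending to 0. *)
Definition vanishing N : R := N.+2%:R^-1.

Lemma vanishing_neq0 N : vanishing N != 0.
Proof. by rewrite invr_neq0 // pnatr_eq0. Qed.

Lemma vanishing_le N : `|vanishing N| <= 2^-1.
Proof.
rewrite gtr0_norm ?invr_gt0 // lef_pV2 ?posrE // ler_nat //.
Qed.

Lemma vanishing_lt1 N : `|vanishing N| < 1.
Proof. by apply: le_lt_trans (vanishing_le N) _; rewrite invf_lt1 // ltr1n. Qed.

Lemma vanishing_cvg : vanishing @ \oo --> (0 : R).
Proof.
have h := @cvg_harmonic R.
rewrite (_ : vanishing = fun N => harmonic (N + 1)%N); last first.
  by apply/funext => N; rewrite /vanishing /harmonic /= addn1.
by rewrite (cvg_shiftn 1).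
Qed.

Let lt1_0 : `|0 : R| < 1. Proof. by rewrite normr0. Qed.

Lemma aw_int_vanishing b c d Q : `|b| < 1 -> `|c| < 1 -> `|d| < 1 ->
  E (vanishing N) b c d Q @[N --> \oo] --> E 0 b c d Q.
Proof.
move=> hb hc hd; apply: (@aw_int_cvg0 _ _ hq b c d Q vanishing 2^-1) => //.
- by rewrite invf_lt1 // ltr1n.
- exact: vanishing_le.
- exact: vanishing_cvg.
Qed.

(** The case [b = 0] is the limit of [b] along [vanishing]; the coefficients of
    the polynomials are continuous in [b] as long as [a] stays fixed and nonzero. *)
Lemma aw_orth_a a b c d n m : `|a| < 1 -> `|b| < 1 -> `|c| < 1 -> `|d| < 1 ->
  a != 0 -> E a b c d (aw_poly q n a b c d * aw_poly q m a b c d) =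
  (n == m)%:R * aw_norm q n a b c d.
Proof.
move=> ha hb hc hd a0.
have nz b' : `|b'| < 1 -> b' != 0 ->
    E a b' c d (aw_poly q n a b' c d * aw_poly q m a b' c d) =
    (n == m)%:R * aw_norm q n a b' c d.
  move=> hb' b0; have [<-|nm] := eqVneq n m; first by rewrite mul1r aw_norm_eq.
  by rewrite mul0r aw_orth_neq.
have [->|b0] := eqVneq b 0; last exact: nz.
have uE Q : E a (vanishing N) c d Q @[N --> \oo] --> E a 0 c d Q.
  rewrite aw_intC12; under eq_fun do rewrite aw_intC12.
  exact: aw_int_vanishing.
pose x n (b : R) k := qpoch (a * b) q n * qpoch (a * c) q n * qpoch (a * d) q n / a ^+ n *
  aw_coef q n a b c d k.
have xE n' b' : aw_poly q n' a b' c d = \sum_(k < n'.+1) x n' b' k *: aw_basis q k a.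
  by rewrite /aw_poly scaler_sumr; apply: eq_bigr => k _; rewrite scalerA.
have xc n' k : x n' (vanishing N) k @[N --> \oo] --> x n' 0 k.
  have M : a * vanishing N @[N --> \oo] --> a * 0 by apply: cvgM; [exact: cvg_cst|exact: vanishing_cvg].
  have MM y : a * vanishing N * y @[N --> \oo] --> a * 0 * y by apply: cvgM => //; exact: cvg_cst.
  apply: cvgM.
    do 3![apply: cvgM; last exact: cvg_cst]; exact: cvg_qpoch.
  apply: cvgM; last exact: cvg_cst.
  apply: cvgM.
    apply: cvgM; first exact: cvg_cst.
    apply: cvg_qpoch; do 3![apply: cvgM; last exact: cvg_cst]; exact: M.
  apply: cvgV; last by do 3![apply: cvgM; last exact: cvg_cst]; exact: cvg_qpoch.
  by rewrite !mulf_neq0 ?qpoch_qq_neq0 // lt0r_neq0 // qpoch_gt0 // normr_lt1M.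
have h1 := @aw_int_bilinear_cvg (fun=> a) vanishing a 0 c d n.+1 m.+1
  (fun k N => x n (vanishing N) k) (fun k N => x m (vanishing N) k) (x n 0) (x m 0)
  (aw_basis q ^~ a) (aw_basis q ^~ a) (fun=> ha) vanishing_lt1 ha lt1_0 hc hd uE (xc n) (xc m).
rewrite -!xE in h1; rewrite -(cvg_lim _ h1) //; apply: cvg_lim => //.
under eq_fun do rewrite -!xE nz ?vanishing_neq0 ?vanishing_lt1 //.
apply: cvgM; first exact: cvg_cst.
apply: (@aw_norm_cvg (fun=> a)) => //; first exact: cvg_cst.
exact: vanishing_cvg.
Qed.

(** By [aw_poly_series], the value for [a = 0] is the limit of the others. *)
Definition aw_poly_ext n a b c d : {poly R} :=
  if a == 0 then aw_series_term q n b c d 0 else aw_poly q n a b c d.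

(** For [a = 0], the limit along [vanishing] of the case [a <> 0]: by
    [aw_poly_series] the coefficients converge. *)
Theorem aw_orthogonality a b c d n m : `|a| < 1 -> `|b| < 1 -> `|c| < 1 -> `|d| < 1 ->
  E a b c d (aw_poly_ext n a b c d * aw_poly_ext m a b c d) =
  (n == m)%:R * aw_norm q n a b c d.
Proof.
move=> ha hb hc hd; rewrite /aw_poly_ext; have [->|a0] := eqVneq a 0; last exact: aw_orth_a.
have uE Q := @aw_int_vanishing b c d Q hb hc hd.
have pw j : vanishing N ^+ j @[N --> \oo] --> (0 : R) ^+ j.
  elim: j => [|j ih]; first by rewrite expr0; exact: cvg_cst.
  rewrite exprS; under eq_fun do rewrite exprS.
  by apply: cvgM => //; exact: vanishing_cvg.
have h1 := @aw_int_bilinear_cvg vanishing (fun=> b) 0 b c d (aw_series_len q n b c d)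
  (aw_series_len q m b c d) (fun k N => vanishing N ^+ k) (fun k N => vanishing N ^+ k)
  (fun k => 0 ^+ k) (fun k => 0 ^+ k)
  (aw_series_term q n b c d) (aw_series_term q m b c d)
  vanishing_lt1 (fun=> hb) lt1_0 hb hc hd uE pw pw.
have s0 k : \sum_(j < aw_series_len q k b c d) 0 ^+ j *: aw_series_term q k b c d j =
    aw_series_term q k b c d 0.
  rewrite /aw_series_len big_ord_recl expr0 scale1r big1 ?addr0 // => i _.
  by rewrite lift0 exprS mul0r scale0r.
rewrite !s0 in h1; rewrite -(cvg_lim _ h1) //; apply: cvg_lim => //.
under eq_fun do rewrite -!aw_poly_series ?vanishing_lt1 ?vanishing_neq0 // aw_orth_a ?vanishing_lt1 ?vanishing_neq0 //.
apply: cvgM; first exact: cvg_cst.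
apply: (@aw_norm_cvg vanishing (fun=> b)) => //; first exact: vanishing_cvg.
exact: cvg_cst.
Qed.

End orthogonality.

(** * Integrals of products over the square *)

Section square.
Variable R : realType.
Local Notation mu := (@lebesgue_measure R).
Local Notation I := (`[(-1 : R), 1]%classic).
Implicit Types f g : R -> R.

(** The regularity of both factors of the integrand, which need not extend
    continuously to the end points as they contain [acos]. *)
Definition bounded_measurable f := measurable_fun I f /\
  exists B, forall x, -1 <= x <= 1 -> `|f x| <= B.

Let mI : measurable I. Proof. exact: measurable_itv. Qed.

Let muI : mu I = 2%:E.
Proof.
have := @lebesgue_measure_itv R `[-1, 1]; rewrite /= lte_fin.
by rewrite (_ : -1 < 1 :> R) ?lt0r_neq0 //= ?opprK //; apply: lt_trans (ltr01); rewrite oppr_lt0.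
Qed.

Let muI_fin : (mu I < +oo)%E. Proof. by rewrite muI ltry. Qed.

Lemma bounded_of (T : Type) (A : set T) (f : T -> R) (B : R) :
  (forall x, A x -> `|f x| <= B) -> [bounded f x | x in A].
Proof.
move=> fB; exists B; split; first exact: num_real.
by move=> M BM x Ax; apply: le_trans (fB x Ax) (ltW BM).
Qed.

Lemma bounded_measurable_integrable f : bounded_measurable f ->
  mu.-integrable I (EFin \o f).
Proof.
move=> [mf [B fB]]; apply: measurable_bounded_integrable => //.
by apply: (@bounded_of _ _ _ B) => x /=; rewrite in_itv /=; exact: fB.
Qed.

Let patch_prod f g : (fun z : R * R => f z.1 * g z.2) \_ (@square R) =
  (fun z : R * R => (f \_ I) z.1 * (g \_ I) z.2).
Proof.
apply/funext => -[x y] /=; rewrite /patch /= in_setX /=.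
by case: ifPn => [/andP[-> ->]|] //; rewrite negb_and => /orP[/negbTE ->|/negbTE ->];
  rewrite ?mul0r ?mulr0.
Qed.

Let measurable_patch f : measurable_fun I f -> measurable_fun setT (f \_ I).
Proof. by move=> mf; apply/(measurable_restrictT _ _).1. Qed.

Lemma measurable_prod f g : measurable_fun I f -> measurable_fun I g ->
  measurable_fun setT (fun z : R * R => (f \_ I) z.1 * (g \_ I) z.2).
Proof.
move=> mf mg; apply: measurable_funM; apply: measurableT_comp => //; exact: measurable_patch.
Qed.

Lemma square_integrable f g : bounded_measurable f -> bounded_measurable g ->
  (@lebesgue2 R).-integrable (@square R) (EFin \o (fun z => f z.1 * g z.2)).
Proof.
move=> [mf [B fB]] [mg [C gC]].
have ms : measurable (@square R) by apply: measurableX.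
apply: measurable_bounded_integrable => //.
- have e := @product_measure1E _ _ _ _ R mu mu I I mI mI.
  have : ((mu \x mu)%E (I `*` I) < +oo)%E.
    rewrite [X in (X < _)%E]e; apply: lte_mul_pinfty => //.
    by rewrite (_ : _ I = 2%:E) //; exact muI.
  by move=> h; exact: h.
- by apply/(measurable_restrictT _ _).2 => //; rewrite patch_prod; exact: measurable_prod.
apply: (@bounded_of _ _ _ (B * C)) => -[x y] /= [].
by rewrite /= !in_itv /= => hx hy; rewrite normrM ler_pM // ?fB ?gC.
Qed.

Lemma square_Rintegral f g : bounded_measurable f -> bounded_measurable g ->
  \int[@lebesgue2 R]_(z in @square R) (f z.1 * g z.2) =
  (\int[mu]_(x in I) f x) * (\int[mu]_(y in I) g y).
Proof.
move=> bf bg; have := square_integrable bf bg.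
case: (bf) (bg) => mf _ [mg _] ifg.
have ms : measurable (@square R) by apply: measurableX.
rewrite Rintegral_mkcond patch_prod [X in _ = X * _]Rintegral_mkcond
  [X in _ = _ * X]Rintegral_mkcond.
have iP0 h : bounded_measurable h -> mu.-integrable setT (EFin \o (h \_ I)).
  move=> bh; have := bounded_measurable_integrable bh; rewrite -restrict_EFin.
  have [e _] := integrable_restrict mu mI measurableT (EFin \o h).
  by rewrite setTI in e; exact: e.
have iG := iP0 _ bf; have iH := iP0 _ bg.
have iP : (@lebesgue2 R).-integrable setT (EFin \o (fun z : R * R => (f \_ I) z.1 * (g \_ I) z.2)).
  rewrite -patch_prod -restrict_EFin; move: ifg.
  have [e _] := integrable_restrict (@lebesgue2 R) ms measurableT
    (EFin \o (fun z : R * R => f z.1 * g z.2)).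
  by rewrite setTI in e; exact: e.
rewrite {1}/Rintegral -(integral12_prod_meas1 iP) /fubini_F /=.
have fH : (\int[mu]_y ((g \_ I) y)%:E)%E = (\int[mu]_y (g \_ I) y)%:E.
  by rewrite /Rintegral fineK //; exact: integrable_fin_num.
under eq_integral => x _.
  under eq_integral => y _ do rewrite EFinM.
  rewrite integralZl // fH.
  over.
rewrite integralZr //= fineM //.
exact: integrable_fin_num.
Qed.

End square.

(** * From the angle to the variable x = cos t *)

Section weight.
Variables (R : realType) (q : R) (hq : 0 < q < 1).
Let q0 : 0 < q. Proof. by case/andP: hq. Qed.
Let q1 : q < 1. Proof. by case/andP: hq. Qed.
Local Notation s := (Num.sqrt q).
Local Notation mu := (@lebesgue_measure R).
Local Notation I := (`[(-1 : R), 1]%classic).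
Implicit Types (f g : R -> R) (a b c d x t : R).

Lemma bounded_measurable_cont f : (forall x, -1 < x < 1 -> {for x, continuous f}) ->
  (exists B, forall x, -1 <= x <= 1 -> `|f x| <= B) -> bounded_measurable f.
Proof.
move=> cf fB; split => //.
apply: (@measurable_fun_itv_cc _ (-1) 1 false true).
apply: subspace_continuous_measurable_fun => //.
by apply: continuous_in_subspaceT => x; rewrite inE /= in_itv /=; exact: cf.
Qed.

Lemma bounded_measurableM f g : bounded_measurable f -> bounded_measurable g ->
  bounded_measurable (fun x => f x * g x).
Proof.
move=> [mf [B fB]] [mg [C gC]]; split; first exact: measurable_funM.
by exists (B * C) => x xI; rewrite normrM ler_pM // ?fB ?gC.
Qed.

Lemma bounded_measurable_ext f g : (forall x, -1 <= x <= 1 -> f x = g x) ->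
  bounded_measurable f -> bounded_measurable g.
Proof.
move=> fg [mf [B fB]]; split; last by exists B => x xI; rewrite -fg // fB.
by apply: eq_measurable_fun mf => x; rewrite inE /= in_itv /=; exact: fg.
Qed.

Lemma continuous_bounded_measurable f : continuous f -> bounded_measurable f.
Proof.
move=> cf; apply: bounded_measurable_cont; first by move=> x _; exact: cf.
have [|u _ hu] := @EVT_max R f (-1) 1 _ (continuous_subspaceT cf).
  by apply: le_trans ler01; rewrite oppr_le0.
have [|v _ hv] := @EVT_min R f (-1) 1 _ (continuous_subspaceT cf).
  by apply: le_trans ler01; rewrite oppr_le0.
exists (`|f u| + `|f v|) => x xI.
have xI' : x \in `[-1, 1] by rewrite in_itv.
rewrite ler_norml; apply/andP; split.
  have := hv x xI'; have := ler_norm (- f v); rewrite normrN; have := normr_ge0 (f u); lra.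
have := hu x xI'; have := ler_norm (f u); have := normr_ge0 (f v); lra.
Qed.

Let norm1 x : -1 <= x <= 1 -> `|x| <= 1.
Proof. by rewrite ler_norml. Qed.

Lemma hfun_inv_bounded_measurable a : `|a| < 1 ->
  bounded_measurable (fun x => (hfun q x a)^-1).
Proof.
move=> a1; apply: bounded_measurable_cont.
  move=> x /andP[x0 x1]; apply: cvgV; last exact: (hfun_cont hq (ltW a1)).
  by rewrite lt0r_neq0 // hfun_gt0 // norm1 // !ltW.
exists (h_low q `|a|)^-1 => x xI; have h := hfun_gt0 hq a1 (norm1 xI).
rewrite normfV gtr0_norm // lef_pV2 ?posrE ?h_low_gt0 //.
exact: (hfun_ge hq (lexx _) a1 (norm1 xI)).
Qed.

Definition h_reg x := hfun q x q * hfun q x (- q) * hfun q x s * hfun q x (- s).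

Let s1 : `|s| <= 1.
Proof. by rewrite ger0_norm ?sqrtr_ge0 // -sqrtr1 ler_sqrt // ltW. Qed.

Let qq1 : `|q| <= 1.
Proof. by rewrite gtr0_norm // ltW. Qed.

Lemma h_reg_cont : continuous h_reg.
Proof.
by move=> x; do 3![apply: cvgM; last by apply: hfun_cont; rewrite ?normrN];
  apply: hfun_cont.
Qed.

Lemma sqrt_weight_cont : continuous (fun x : R => 4 * Num.sqrt (1 - x ^+ 2)).
Proof.
move=> x; apply: cvgM; first exact: cvg_cst.
apply: (@continuous_comp _ _ _ (fun x => 1 - x ^+ 2) Num.sqrt).
  by apply: cvgB; [exact: cvg_cst|exact: exprn_continuous].
exact: sqrt_continuous.
Qed.

(** At [x = 1] and [x = -1] both sides vanish, as [x / 0 = 0]. *)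
Lemma weightE x (K : R) : -1 <= x <= 1 ->
  hnum q x / (K * Num.sqrt (1 - x ^+ 2)) = 4 * Num.sqrt (1 - x ^+ 2) * h_reg x / K.
Proof.
move=> xI; rewrite hnumE // -/(h_reg x) invfM.
have x2 : 0 <= 1 - x ^+ 2 by case/andP: xI; nra.
have [e|e] := eqVneq (Num.sqrt (1 - x ^+ 2)) 0.
  by rewrite e invr0 !(mulr0, mul0r).
have {1}-> : 1 - x ^+ 2 = Num.sqrt (1 - x ^+ 2) * Num.sqrt (1 - x ^+ 2).
  by rewrite -expr2 sqr_sqrtr.
move: (K^-1) => K'; field.
exact: e.
Qed.

Lemma weight_bounded_measurable a b c : `|a| < 1 -> `|b| < 1 -> `|c| < 1 ->
  bounded_measurable (fun x =>
    hnum q x / (hfun q x a * hfun q x b * hfun q x c * Num.sqrt (1 - x ^+ 2))).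
Proof.
move=> ha hb hc; apply: (@bounded_measurable_ext (fun x =>
  4 * Num.sqrt (1 - x ^+ 2) * h_reg x *
  ((hfun q x a)^-1 * (hfun q x b)^-1 * (hfun q x c)^-1))).
  by move=> x xI; rewrite weightE // !invfM.
apply: bounded_measurableM.
  apply: bounded_measurableM; apply: continuous_bounded_measurable.
    exact: sqrt_weight_cont.
  exact: h_reg_cont.
by do 2![apply: bounded_measurableM; last exact: hfun_inv_bounded_measurable];
  exact: hfun_inv_bounded_measurable.
Qed.

Lemma poly_bounded_measurable (P : {poly R}) : bounded_measurable (fun x => P.[x]).
Proof. by apply: continuous_bounded_measurable; exact: continuous_horner. Qed.

(** The substitution [x = cos t]; the integrand is continuous on [-1, 1] by
    [weightE]. *)
Lemma aw_int_x a b c d (P : {poly R}) : `|a| < 1 -> `|b| < 1 -> `|c| < 1 -> `|d| < 1 ->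
  \int[mu]_(x in I) (P.[x] * (hnum q x /
   (hfun q x a * hfun q x b * hfun q x c * hfun q x d * Num.sqrt (1 - x ^+ 2)))) =
  aw_int q a b c d P.
Proof.
move=> ha hb hc hd.
pose G x := P.[x] * (4 * Num.sqrt (1 - x ^+ 2) * h_reg x /
   (hfun q x a * hfun q x b * hfun q x c * hfun q x d)).
transitivity (\int[mu]_(x in I) G x).
  by apply: eq_Rintegral => x; rewrite inE /= in_itv /= => xI; rewrite /G weightE.
have Gc x : -1 <= x <= 1 -> {for x, continuous G}.
  move=> xI; apply: cvgM; first exact: continuous_horner.
  apply: cvgM.
    by apply: cvgM; [exact: sqrt_weight_cont|exact: h_reg_cont].
  apply: cvgV.
    by rewrite !mulf_neq0 // lt0r_neq0 // hfun_gt0 // norm1.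
  by do 3![apply: cvgM; last by apply: hfun_cont => //; exact: ltW];
    apply: hfun_cont => //; exact: ltW.
have Gw : {within `[cos pi, cos 0], continuous G}.
  apply: continuous_in_subspaceT => x; rewrite inE /= in_itv /= cospi cos0.
  exact: Gc.
have dcos : (@cos R)^`()%classic = (fun x => - sin x).
  by apply/funext => x; rewrite derive1E; apply: derive_val.
have h := @integration_by_substitution_decreasing R cos G 0 pi (pi_ge0 R) _ _ _ _ _ Gw.
rewrite cospi cos0 in h.
rewrite aw_intE /int0pi /Rintegral h.
- congr fine; apply: eq_integral => t; rewrite inE /= in_itv /= => tI.
  have e : Num.sqrt (1 - cos t ^+ 2) = sin t.
    by rewrite -sin2cos2 sqrtr_sqr ger0_norm ?sin_ge0_pi.
  rewrite dcos /= /G /aw_weight hnumE // -/(h_reg _) -!sin2cos2 /=; congr (_%:E).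
  transitivity (P.[cos t] * (4 * Num.sqrt (1 - cos t ^+ 2) * h_reg (cos t) /
    (hfun q (cos t) a * hfun q (cos t) b * hfun q (cos t) c * hfun q (cos t) d)) *
    - (- sin t)); first by [].
  by rewrite e opprK; ring.
- by move=> x y xI yI; rewrite ltr_cos.
- move=> x _; rewrite dcos; apply: continuousN; exact: continuous_sin.
- rewrite dcos; apply: cvgP; apply: cvg_at_right_filter; apply: continuousN; exact: continuous_sin.
- rewrite dcos; apply: cvgP; apply: cvg_at_left_filter; apply: continuousN; exact: continuous_sin.
- split.
  + by move=> x _; apply: ex_derive.
  + by apply: cvg_at_right_filter; exact: continuous_cos.
  + by apply: cvg_at_left_filter; exact: continuous_cos.
Qed.

End weight.

(** * Values of the polynomials and of the denominators *)

Section formula.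
Variables (R : realType) (q : R) (hq : 0 < q < 1).
Let q0 : 0 < q. Proof. by case/andP: hq. Qed.
Let q1 : q < 1. Proof. by case/andP: hq. Qed.
Implicit Types (a b c d x t : R).

Lemma aw_basis_expi k a t :
  qpoch (a%:C * expi t) q%:C k * qpoch (a%:C * expi (- t)) q%:C k =
  ((aw_basis q k a).[cos t])%:C.
Proof.
rewrite /aw_basis horner_prod (rmorph_prod (real_complex R)) -big_split.
apply: eq_bigr => i _; rewrite /h_quad !hornerE -(rmorphXn (real_complex R)) /=.
apply/eqP; rewrite eq_complex expiNJ /=.
have := cos2Dsin2 t; move: (cos t) (sin t) (q ^+ i) => x y Q xy.
have y2 : y ^+ 2 = 1 - x ^+ 2 by rewrite -xy addrAC subrr add0r.
apply/andP; split; apply/eqP; last by ring.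
transitivity (1 - 2 * a * Q * x + (a * Q) ^+ 2 * (x ^+ 2 + y ^+ 2)); first by ring.
by rewrite xy; ring.
Qed.

Lemma aw_formulaE n t a b c d :
  aw_formula q n t a b c d = ((aw_poly q n a b c d).[cos t])%:C.
Proof.
rewrite /aw_formula /aw_poly hornerZ [RHS]real_complexM; congr (_ * _).
  by rewrite /qpochs !big_cons big_nil mulr1 mulrA.
rewrite horner_sum real_complex_sum; apply: eq_bigr => k _.
rewrite hornerZ [RHS]real_complexM -aw_basis_expi /aw_coef /qpochs !big_cons !big_nil !mulr1 !qpochC.
rewrite !(real_complexM, real_complexV); move: (qpoch (_%:C * _) _ _) (qpoch (_%:C * _) _ _) => A B.
rewrite !invfM; ring.
Qed.

(** For [a = 0] the limit is that of the polynomial in [a] given by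
    [aw_poly_series], at 0. *)
Lemma askey_wilsonE n x a b c d : `|b| < 1 -> `|c| < 1 -> `|d| < 1 -> -1 <= x <= 1 ->
  askey_wilson q n x a b c d = ((aw_poly_ext q n a b c d).[x])%:C.
Proof.
move=> hb hc hd xI; rewrite /askey_wilson /aw_poly_ext.
have cx : cos (acos x) = x by rewrite acosK // in_itv.
case: eqP => [_|_]; last by rewrite aw_formulaE cx.
have near0 : \forall a \near (0 : R)^', aw_formula q n (acos x) a b c d =
    (\sum_(j < aw_series_len q n b c d) a ^+ j * (aw_series_term q n b c d j).[x])%:C.
  near=> e.
  have a0 : e != 0 by near: e; exact: nbhs_dnbhs_neq.
  have a1 : `|e| < 1.
    have : `|0 - e| < 1.
      near: e; apply: cvg_within.
      by have /cvgrPdist_lt : y @[y --> (0 : R)] --> (0 : R) by []; apply.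
    by rewrite sub0r normrN.
  rewrite aw_formulaE cx aw_poly_series // horner_sum.
  by congr (_%:C); apply: eq_bigr => j _; rewrite hornerZ.
pose P : {poly R} := \poly_(j < aw_series_len q n b c d) (aw_series_term q n b c d j).[x].
have PE e : P.[e] = \sum_(j < aw_series_len q n b c d) e ^+ j * (aw_series_term q n b c d j).[x].
  by rewrite horner_poly; apply: eq_bigr => j _; rewrite mulrC.
have P0 : P.[0] = (aw_series_term q n b c d 0).[x] by rewrite horner_coef0 coef_poly.
apply: lim_complex => /=.
  apply: (@cvg_trans _ (P.[e] @[e --> (0 : R)^'])).
    by apply: near_eq_cvg; apply: filterS near0 => e ->; rewrite PE.
  have cP : P.[e] @[e --> (0 : R)] --> P.[0] by exact: continuous_horner.
  by rewrite -P0; apply: cvg_trans cP; apply: cvg_app; exact: cvg_within.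
apply: (@cvg_trans _ ((fun=> 0 : R) @ (0 : R)^')); last exact: cvg_cst.
by apply: near_eq_cvg; apply: filterS near0 => e ->.
Unshelve. all: by end_near. Qed.

(** [(d e^(it); q)_oo]. *)
Definition qpoch_expi d t : R[i] := qpoch_inf (d%:C * expi t) q%:C.

Let normc_d d t : normc (d%:C * expi t) = `|d|.
Proof. by rewrite normcM normcR normc_expi mulr1. Qed.

Lemma qpoch_expi_cont d : `|d| <= 1 -> contC (qpoch_expi d).
Proof.
move=> d1 t; set C := 2 * (prod_bound q `|d| * `|d| / (1 - q)).
have C0 : 0 <= C.
  by rewrite mulr_ge0 // divr_ge0 ?subr_ge0 ?(ltW q1) // mulr_ge0 // ltW // prod_bound_gt0.
have approx u N : normc (qpoch_expi d u - qpoch (d%:C * expi u) q%:C N) <= C * q ^+ N.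
  by have [_ h] := qpoch_inf_approxC hq (d%:C * expi u); have := h N; rewrite normc_d.
have cN N : contC (fun u => qpoch (d%:C * expi u) q%:C N).
  move=> u; apply: cvgC_prod => k _; apply: cvgCB; first exact: cvgC_cst.
  apply: cvgCM; last exact: cvgC_cst.
  by apply: cvgCM; [exact: cvgC_cst|exact: cvgC_expi].
split.
- apply: (@geometric_limit_cont _ q C (fun u => complex.Re (qpoch_expi d u))
    (fun N u => complex.Re (qpoch (d%:C * expi u) q%:C N))) => //.
    by move=> N u; have [] := cN N u.
  near=> u => N; rewrite -raddfB; apply: le_trans (normcRe _) _; exact: approx.
- apply: (@geometric_limit_cont _ q C (fun u => complex.Im (qpoch_expi d u))
    (fun N u => complex.Im (qpoch (d%:C * expi u) q%:C N))) => //.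
    by move=> N u; have [] := cN N u.
  near=> u => N; rewrite -raddfB; apply: le_trans (normcIm _) _; exact: approx.
Unshelve. all: by end_near. Qed.

Lemma qpoch_expi_sqr d t : `|d| <= 1 -> qpoch_expi d t * conjc (qpoch_expi d t) = (hfun q (cos t) d)%:C.
Proof.
move=> d1; have [h _] := qpoch_inf_approxC hq (d%:C * expi t).
have [g1 g2] := cvgCM _ h (cvgC_conj _ h).
have E n : qpoch (d%:C * expi t) q%:C n * conjc (qpoch (d%:C * expi t) q%:C n) =
    (h_trunc q n (cos t) d)%:C.
  rewrite /h_trunc (rmorph_prod (real_complex R)) (rmorph_prod (@conjc R)) -big_split.
  apply: eq_bigr => k _ /=; rewrite -real_complexX.
  apply/eqP; rewrite eq_complex /= mulnC exprM.
  have := cos2Dsin2 t; move: (cos t) (sin t) (q ^+ k) => x y Q xy.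
  apply/andP; split; apply/eqP; last by ring.
  transitivity (1 - 2 * d * x * Q + (d * Q) ^+ 2 * (x ^+ 2 + y ^+ 2)); first by ring.
  by rewrite xy; ring.
have l := @hfun_cvg _ _ hq d (cos t) d1.
have {}g1 : h_trunc q n (cos t) d @[n --> \oo] --> complex.Re (qpoch_expi d t * conjc (qpoch_expi d t)).
  apply: cvg_trans g1; apply: near_eq_cvg; near=> N.
  by rewrite E.
have {}g2 : (fun=> 0) @ \oo --> complex.Im (qpoch_expi d t * conjc (qpoch_expi d t)).
  apply: cvg_trans g2; apply: near_eq_cvg; near=> N.
  by rewrite E.
apply/eqP; rewrite eq_complex; apply/andP; split; apply/eqP.
  exact: (cvg_unique (@norm_hausdorff _ _) g1 l).
exact: (cvg_unique (@norm_hausdorff _ _) g2 (@cvg_cst _ _ _ _ _)).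
Unshelve. all: by end_near. Qed.

Lemma normc_conj (z : R[i]) : normc (conjc z) = normc z.
Proof. by case: z => x y /=; rewrite sqrrN. Qed.

Lemma normc_inv_pair (u v : R[i]) (A B : R) : normc u ^+ 2 = A -> normc v ^+ 2 = B ->
  normc (u * conjc v)^-1 ^+ 2 = A^-1 * B^-1.
Proof. by move=> <- <-; rewrite normcV normcM normc_conj exprVn exprMn invfM. Qed.

Lemma normc_qpoch_expi d t : `|d| < 1 -> normc (qpoch_expi d t) ^+ 2 = hfun q (cos t) d.
Proof.
move=> d1; have := congr1 (@normc R) (qpoch_expi_sqr t (ltW d1)).
rewrite normcM normc_conj -expr2 normcR gtr0_norm // hfun_gt0 //.
by rewrite ler_norml cos_geN1 cos_le1.
Qed.

Lemma qpoch_expi_neq0 d t : `|d| < 1 -> qpoch_expi d t != 0.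
Proof.
move=> d1; apply/negP => /eqP e; have := normc_qpoch_expi t d1.
rewrite e normc0 expr0n /= => /eqP; apply/negP; rewrite eq_sym lt0r_neq0 //.
by rewrite hfun_gt0 // ler_norml cos_geN1 cos_le1.
Qed.

(** The inverse of the product of the two denominators in the integrand, the
    second one conjugated. *)
Definition qpoch_expi_pair d d' x : R[i] := (qpoch_expi d (acos x) * conjc (qpoch_expi d' (acos x)))^-1.

Lemma qpoch_expi_pair_bounded_measurable d d' : `|d| < 1 -> `|d'| < 1 ->
  bounded_measurable (fun x => complex.Re (qpoch_expi_pair d d' x)) /\
  bounded_measurable (fun x => complex.Im (qpoch_expi_pair d d' x)).
Proof.
move=> hd hd'; pose F t : R[i] := (qpoch_expi d t * conjc (qpoch_expi d' t))^-1.
have cF : contC F.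
  move=> t; apply: cvgCV.
    by rewrite mulf_neq0 ?conjc_eq0 // qpoch_expi_neq0.
  apply: cvgCM; first exact: (qpoch_expi_cont (ltW hd)).
  exact: (cvgC_conj _ (qpoch_expi_cont (ltW hd') t)).
have bF t : normc (F t) <= 1 + (h_low q `|d|)^-1 * (h_low q `|d'|)^-1.
  have c1 : `|cos t| <= 1 by rewrite ler_norml cos_geN1 cos_le1.
  have l u : `|u| < 1 -> 0 <= (hfun q (cos t) u)^-1 <= (h_low q `|u|)^-1.
    move=> u1; have h0 := hfun_gt0 hq u1 c1.
    rewrite invr_ge0 (ltW h0) lef_pV2 ?posrE ?h_low_gt0 //.
    exact: (hfun_ge hq (lexx _) u1 c1).
  have /andP[l0 l1] := l _ hd; have /andP[l0' l1'] := l _ hd'.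
  apply: (@le_trans _ _ (1 + normc (F t) ^+ 2)).
    by have := sqr_ge0 (normc (F t) - 1); have := normc_ge0 (F t); nra.
  rewrite lerD2l /F (normc_inv_pair (normc_qpoch_expi t hd) (normc_qpoch_expi t hd')).
  exact: ler_pM.
have acosc x : -1 < x < 1 -> {for x, continuous (@acos R)} := @continuous_acos R x.
split; apply: bounded_measurable_cont.
- move=> x xI; apply: (@continuous_comp _ _ _ (@acos R) (fun t => complex.Re (F t))).
    exact: acosc.
  by have [] := cF (acos x).
- by eexists => x _; apply: le_trans (normcRe _) (bF _).
- move=> x xI; apply: (@continuous_comp _ _ _ (@acos R) (fun t => complex.Im (F t))).
    exact: acosc.
  by have [] := cF (acos x).
- by eexists => x _; apply: le_trans (normcIm _) (bF _).
Qed.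

(** The finite products in [aw_norm] are absorbed by the infinite ones of the
    total mass. *)
Lemma aw_norm_closed n a b c d : `|a| < 1 -> `|b| < 1 -> `|c| < 1 -> `|d| < 1 ->
  aw_norm q n a b c d = 2 * pi *
   (qpoch_inf (a * b * c * d * q ^+ (2 * n)) q *
    qpoch (a * b * c * d * q ^ (n%:Z - 1)) q n /
    qpochs_inf [:: q ^+ n.+1; a * b * q ^+ n; a * c * q ^+ n; a * d * q ^+ n;
      b * c * q ^+ n; b * d * q ^+ n; c * d * q ^+ n] q).
Proof.
move=> ha hb hc hd; rewrite /aw_norm aw_integral // /qpochs_inf !big_cons big_nil mulr1.
have nq : `|q| < 1 by rewrite gtr0_norm.
have hD : `|a * b * c * d| < 1 by rewrite !normr_lt1M.
have n1 x y : `|x| < 1 -> `|y| < 1 -> qpoch (x * y) q n != 0.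
  by move=> x1 y1; rewrite lt0r_neq0 // qpoch_gt0 // normr_lt1M.
have n2 x y : `|x| < 1 -> `|y| < 1 -> qpoch_inf (x * y * q ^+ n) q != 0.
  by move=> x1 y1; rewrite lt0r_neq0 // qpoch_inf_gt0 // normr_lt1qX // normr_lt1M.
have n3 : qpoch_inf (q ^+ n.+1) q != 0.
  by rewrite lt0r_neq0 // qpoch_inf_gt0 // exprS normr_lt1qX.
have n4 := qpoch_qq_neq0 hq n.
have n5 : qpoch (a * b * c * d) q (2 * n) != 0 by rewrite lt0r_neq0 // qpoch_gt0.
rewrite (qpoch_infD hq (a * b * c * d) (2 * n)) (qpoch_infD hq q n) -exprS.
rewrite (qpoch_infD hq (a * b) n) (qpoch_infD hq (a * c) n) (qpoch_infD hq (a * d) n).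
rewrite (qpoch_infD hq (b * c) n) (qpoch_infD hq (b * d) n) (qpoch_infD hq (c * d) n).
have := n1 _ _ ha hb; have := n1 _ _ ha hc; have := n1 _ _ ha hd.
have := n1 _ _ hb hc; have := n1 _ _ hb hd; have := n1 _ _ hc hd.
have := n2 _ _ ha hb; have := n2 _ _ ha hc; have := n2 _ _ ha hd.
have := n2 _ _ hb hc; have := n2 _ _ hb hd; have := n2 _ _ hc hd.
move: (qpoch (a * b) q n) (qpoch (a * c) q n) (qpoch (a * d) q n) (qpoch (b * c) q n)
  (qpoch (b * d) q n) (qpoch (c * d) q n) (qpoch_inf (a * b * q ^+ n) q)
  (qpoch_inf (a * c * q ^+ n) q) (qpoch_inf (a * d * q ^+ n) q)
  (qpoch_inf (b * c * q ^+ n) q) (qpoch_inf (b * d * q ^+ n) q) (qpoch_inf (c * d * q ^+ n) q).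
move: (qpoch_inf (q ^+ n.+1) q) n3 (qpoch q q n) n4 (qpoch _ q (2 * n)) n5.
move=> r1 h1 r2 h2 r3 h3 r4 r5 r6 r7 r8 r9 s4 s5 s6 s7 s8 s9.
move=> z9 z8 z7 z6 z5 z4 y9 y8 y7 y6 y5 y4; field.
by rewrite h1 h2 h3 z9 z8 z7 z6 z5 z4 y9 y8 y7 y6 y5 y4.
Qed.

End formula.

(** * The bivariate theorem *)

Theorem theorem8p3 (R : realType) (q : R) (hq : 0 < q < 1)
  (a1 b1 c1 d1 a2 b2 c2 d2 : R)
  (ha1 : -1 < a1 < 1) (hb1 : -1 < b1 < 1)
  (hc1 : -1 < c1 < 1) (hd1 : -1 < d1 < 1)
  (ha2 : -1 < a2 < 1) (hb2 : -1 < b2 < 1)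
  (hc2 : -1 < c2 < 1) (hd2 : -1 < d2 < 1)
  (gamma delta : R) (hgamma : 0 <= gamma) (hdelta : 0 <= delta)
  (j k m n : nat) :
  let p := biv_aw q a1 b1 c1 d1 a2 b2 c2 d2 gamma delta in
  let W := biv_weight q a1 b1 c1 a2 b2 c2 d2 in
  let f := fun z : R * R =>
    p j k z.1 z.2 * (p m n z.1 z.2)^* * (W z.1 z.2)%:C in
  (* e s = q^(s + gamma n + delta) *)
  let e := fun s : R => q `^ (s + gamma * n%:R + delta) in
  integrableC (@lebesgue2 R) (@square R) f /\
  integralC (@lebesgue2 R) (@square R) f =
    ((4 * pi ^+ 2 * (j == m)%:R * (k == n)%:R
      * qpoch_inf (a1 * b1 * c1 * d1 * e (2 * m%:R)) q
      * qpoch (a1 * b1 * c1 * d1 * e (m%:R - 1)) q m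
      / qpochs_inf [:: q ^+ m.+1; a1 * b1 * q ^+ m; a1 * c1 * q ^+ m;
                       b1 * c1 * q ^+ m; a1 * d1 * e m%:R;
                       b1 * d1 * e m%:R; c1 * d1 * e m%:R] q)
     * (qpoch_inf (a2 * b2 * c2 * d2 * q ^+ (2 * n)) q
        * qpoch (a2 * b2 * c2 * d2 * q ^ (n%:Z - 1)) q n
        / qpochs_inf [:: q ^+ n.+1; a2 * b2 * q ^+ n; a2 * c2 * q ^+ n;
                         a2 * d2 * q ^+ n; b2 * c2 * q ^+ n;
                         b2 * d2 * q ^+ n; c2 * d2 * q ^+ n] q))%:C.
Proof.
move=> p W f e.
have conjcR (x : R) : conjc x%:C = x%:C by rewrite /conjc /= oppr0.
have q0 : 0 < q by case/andP: hq.
have q1 : q < 1 by case/andP: hq.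
have A1 : `|a1| < 1 by rewrite ltr_norml.
have B1 : `|b1| < 1 by rewrite ltr_norml.
have C1 : `|c1| < 1 by rewrite ltr_norml.
have A2 : `|a2| < 1 by rewrite ltr_norml.
have B2 : `|b2| < 1 by rewrite ltr_norml.
have C2 : `|c2| < 1 by rewrite ltr_norml.
have D2 : `|d2| < 1 by rewrite ltr_norml.
pose D (k : nat) := d1 * q `^ (gamma * k%:R + delta).
have D1 k' : `|D k'| < 1.
  have d1' : `|d1| < 1 by rewrite ltr_norml.
  rewrite normrM; apply: le_lt_trans d1'; rewrite ler_piMr //.
  rewrite ger0_norm ?powR_ge0 // -[leRHS](powRr0 q); apply: ger_powR; first by rewrite q0 (ltW q1).
  by rewrite addr_ge0 // mulr_ge0.
pose Pj := aw_poly_ext q j a1 b1 c1 (D k); pose Pm := aw_poly_ext q m a1 b1 c1 (D n).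
pose Qk := aw_poly_ext q k a2 b2 c2 d2; pose Qn := aw_poly_ext q n a2 b2 c2 d2.
pose W1 x := hnum q x /
  (hfun q x a1 * hfun q x b1 * hfun q x c1 * Num.sqrt (1 - x ^+ 2)).
pose W2 y := hnum q y /
  (hfun q y a2 * hfun q y b2 * hfun q y c2 * hfun q y d2 * Num.sqrt (1 - y ^+ 2)).
pose gR x := (Pj * Pm).[x] * W1 x * complex.Re (qpoch_expi_pair q (D k) (D n) x).
pose gI x := (Pj * Pm).[x] * W1 x * complex.Im (qpoch_expi_pair q (D k) (D n) x).
pose r y := (Qk * Qn).[y] * W2 y.
have fE z : square (R := R) z ->
    complex.Re (f z) = gR z.1 * r z.2 /\ complex.Im (f z) = gI z.1 * r z.2.
  case: z => x y [] /=; rewrite !in_itv /= => xI yI.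
  have -> : f (x, y) = ((Pj * Pm).[x] * W1 x * r y)%:C * qpoch_expi_pair q (D k) (D n) x.
    rewrite /f /p /W /biv_aw -[biv_weight _ _ _ _ _ _ _ _ _ _]/(W1 x * W2 y) /= -/(D k) -/(D n).
    rewrite !(askey_wilsonE hq) // -/Pj -/Pm -/Qk -/Qn.
    rewrite -/(qpoch_expi q (D k) (acos x)) -/(qpoch_expi q (D n) (acos x)) /qpoch_expi_pair /r !hornerM.
    move: (qpoch_expi q (D k) (acos x)) (qpoch_expi q (D n) (acos x)) (W1 x) (W2 y) => u v w1 w2.
    rewrite !real_complexM -[(_ / v)^*]/(conjc (_ / v)) !conjcM !conjc_inv !conjcR (invfM u).
    by ring.
  rewrite /gR /gI; case: (qpoch_expi_pair _ _ _ _) => u v /=.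
  by split; ring.
have [bR bI] := qpoch_expi_pair_bounded_measurable hq (D1 k) (D1 n).
have bPW : bounded_measurable (fun x => (Pj * Pm).[x] * W1 x).
  apply: bounded_measurableM; first exact: poly_bounded_measurable.
  exact: weight_bounded_measurable.
have bgR : bounded_measurable gR by exact: bounded_measurableM.
have bgI : bounded_measurable gI by exact: bounded_measurableM.
have br : bounded_measurable r.
  apply: bounded_measurableM; first exact: poly_bounded_measurable.
  have bW := bounded_measurableM (weight_bounded_measurable hq A2 B2 C2)
    (hfun_inv_bounded_measurable hq D2).
  apply: bounded_measurable_ext bW => y _; rewrite /W2 !invfM; ring.
have ms : measurable (@square R) by apply: measurableX; exact: measurable_itv.
split.
  split.
    apply: eq_integrable (square_integrable bgR br) => // z.
    by rewrite inE => /fE[+ _] /= => ->.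
  apply: eq_integrable (square_integrable bgI br) => // z.
  by rewrite inE => /fE[_ +] /= => ->.
rewrite /integralC.
have -> : \int[@lebesgue2 R]_(z in @square R) complex.Re (f z) =
    \int[@lebesgue2 R]_(z in @square R) (gR z.1 * r z.2).
  by apply: eq_Rintegral => z; rewrite inE => /fE[].
have -> : \int[@lebesgue2 R]_(z in @square R) complex.Im (f z) =
    \int[@lebesgue2 R]_(z in @square R) (gI z.1 * r z.2).
  by apply: eq_Rintegral => z; rewrite inE => /fE[].
rewrite !square_Rintegral //.
have rint : \int[@lebesgue_measure R]_(y in `[(-1 : R), 1]) r y =
    (k == n)%:R * aw_norm q k a2 b2 c2 d2.
  by rewrite aw_int_x // aw_orthogonality.
rewrite rint; have [kn|kn] := eqVneq k n; last first.
  by rewrite !(mul0r, mulr0).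
rewrite !mul1r mulr1.
have pair x : -1 <= x <= 1 -> qpoch_expi_pair q (D k) (D n) x = ((hfun q x (D n))^-1)%:C.
  move=> xI; rewrite /qpoch_expi_pair -kn qpoch_expi_sqr ?(ltW (D1 k)) //.
  rewrite acosK ?in_itv //; exact/esym/(fmorphV (real_complex R)).
have -> : \int[@lebesgue_measure R]_(x in `[(-1 : R), 1]) gI x = 0.
  rewrite -[RHS](mul0r (fine (@lebesgue_measure R `[(-1 : R), 1]%classic))).
  rewrite -Rintegral_cst //.
  apply: eq_Rintegral => x; rewrite inE /= in_itv /= => xI.
  by rewrite /gI pair //= mulr0.
have -> : \int[@lebesgue_measure R]_(x in `[(-1 : R), 1]) gR x =
    (j == m)%:R * aw_norm q j a1 b1 c1 (D n).
  rewrite -aw_orthogonality // -aw_int_x //; apply: eq_Rintegral => x.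
  rewrite inE /= in_itv /= => xI; rewrite /gR pair // /W1 /Pj kn /= -mulrA; congr (_ * _).
  by rewrite !invfM; ring.
rewrite kn !aw_norm_closed //; apply/eqP; rewrite eq_complex /= mul0r eqxx andbT.
apply/eqP; have eE (z : int) : e z%:~R = q ^ z * q `^ (gamma * n%:R + delta).
  by rewrite /e -addrA powRD ?(gt_eqF q0) ?implybT // powR_intmul // ltW.
have e1 : e m%:R = q ^+ m * q `^ (gamma * n%:R + delta) := eE m.
have e2 : e (2 * m%:R) = q ^+ (2 * m) * q `^ (gamma * n%:R + delta).
  by rewrite -natrM; exact: (eE (2 * m)%N).
have e3 : e (m%:R - 1) = q ^ (m%:Z - 1) * q `^ (gamma * n%:R + delta).
  by rewrite -eE intrB.
rewrite e1 e2 e3 /qpochs_inf !big_cons !big_nil !mulr1.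
have [->|jm] := eqVneq j m; last by rewrite !(mulr0, mul0r).
have DE x y : x * D n * y = x * d1 * (y * q `^ (gamma * n%:R + delta)) by rewrite /D; ring.
rewrite !DE !invfM; ring.
Qed.
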